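(* Let $(E,\mathcal{L},\mathcal{B})$ be a weakly left-resolving normal labelled space over the alphabet $\mathcal{A}$. Let $\{p_A,\ s_a : A\in\mathcal{B},\ a\in\mathcal{A}\}$ be the universal representation of $(E,\mathcal{L},\mathcal{B})$ that generates $C^*(E,\mathcal{L},\mathcal{B})$, let $\{q_A,\ t_a : A\in\mathcal{B},\ a\in\mathcal{A}\}$ be a representation of $(E,\mathcal{L},\mathcal{B})$ in a $C^*$-algebra $\mathcal{X}$ and let $\pi$ be the unique $*$-homomorphism from $C^*(E,\mathcal{L},\mathcal{B})$ to $\mathcal{X}$ that maps each $p_A$ to $q_A$ and each $s_a$ to $t_a$. Then $\pi$ is injective if and only if both of the following hold: $q_A$ is non-zero whenever $A\neq\emptyset$; and for each $z\in\mathbb{T}$ there exists a $*$-homomorphism $\beta_z:C^*(\{q_A,t_a:A\in\mathcal{B},a\in\mathcal{A}\})\to C^*(\{q_A,t_a:A\in\mathcal{B},a\in\mathcal{A}\})$ such that $\beta_z(q_A)=q_A$ and $\beta_z(t_a)=zt_a$ for all $A\in\mathcal{B}$ and $a\in\mathcal{A}$.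
   Context: A directed graph $E=(E^0,E^1,r,s)$ consists of sets $E^0$ (vertices), $E^1$ (edges) and maps $r,s:E^1\to E^0$. A path of length $n\ge 1$ is a sequence $\lambda=\lambda_1\cdots\lambda_n$ of edges with $r(\lambda_i)=s(\lambda_{i+1})$; $s(\lambda)=s(\lambda_1)$, $r(\lambda)=r(\lambda_n)$; $E^n$ is the set of paths of length $n$, $E^*=\bigcup_{n\ge 1}E^n$; $E^0_{\text{sink}}=\{v\in E^0: s^{-1}(v)=\emptyset\}$. A labelled graph $(E,\mathcal{L})$ over a countable alphabet $\mathcal{A}$ is a directed graph with a map $\mathcal{L}:E^1\to\mathcal{A}$, assumed surjective, extended to paths by $\mathcal{L}(e_1\cdots e_n)=\mathcal{L}(e_1)\cdots\mathcal{L}(e_n)$; $\mathcal{L}^*(E)=\bigcup_{n\ge1}\mathcal{L}(E^n)$. For $\alpha\in\mathcal{L}^*(E)$ and $A\subseteq E^0$: $r(\alpha)=\{r(\lambda):\lambda\in E^*,\ \mathcal{L}(\lambda)=\alpha\}$, $r(A,\alpha)=\{r(\lambda):\lambda\in E^*,\ \mathcal{L}(\lambda)=\alpha,\ s(\lambda)\in A\}$, $\mathcal{L}(AE^1)=\{\mathcal{L}(e):e\in E^1,\ s(e)\in A\}$. A collection $\mathcal{B}\subseteq 2^{E^0}$ is accommodating for $(E,\mathcal{L})$ if $r(\alpha)\in\mathcal{B}$ and $r(A,\alpha)\in\mathcal{B}$ for all $A\in\mathcal{B}$, $\alpha\in\mathcal{L}^*(E)$, and $\mathcal{B}$ is closed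 under finite intersections and unions. A labelled space is a triple $(E,\mathcal{L},\mathcal{B})$ with $\mathcal{B}$ accommodating; it is normal if $\mathcal{B}$ is also closed under relative complements; it is weakly left-resolving if $r(A,\alpha)\cap r(B,\alpha)=r(A\cap B,\alpha)$ for all $A,B\in\mathcal{B}$, $\alpha\in\mathcal{L}^*(E)$. A representation of a weakly left-resolving normal labelled space $(E,\mathcal{L},\mathcal{B})$ in a $C^*$-algebra consists of projections $\{p_A:A\in\mathcal{B}\}$ and partial isometries $\{s_a:a\in\mathcal{A}\}$ such that: (i) $p_Ap_B=p_{A\cap B}$ and $p_{A\cup B}=p_A+p_B-p_{A\cap B}$ for $A,B\in\mathcal{B}$, where $p_\emptyset=0$; (ii) $p_As_a=s_ap_{r(A,a)}$ for $a\in\mathcal{A}$, $A\in\mathcal{B}$; (iii) $s_a^*s_a=p_{r(a)}$, and $s_a^*s_b=0$ unless $a=b$; (iv) for $A\in\mathcal{B}$ with $\mathcal{L}(AE^1)$ finite and $A\cap B=\emptyset$ for all $B\in\mathcal{B}$ satisfying $B\subseteq E^0_{\text{sink}}$, $p_A=\sum_{a\in\mathcal{L}(AE^1)}s_ap_{r(A,a)}s_a^*$. $C^*(E,\mathcal{L},\mathcal{B})$ is the $C^*$-algebra generated by a universal representation of $(E,\mathcal{L},\mathcal{B})$. $C^*(S)$ denotes the $C^*$-subalgebra generated by a set $S$; $\mathbb{T}$ is the unit circle in $\mathbb{C}$. *)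

(* Defs.v *)
From HB Require Import structures.
From mathcomp Require Import all_boot all_order all_algebra.
From mathcomp Require Export complex.
From mathcomp Require Import boolp classical_sets functions cardinality fsbigop.
From mathcomp Require Import reals topology normedtype measurable_structure.

Set Implicit Arguments.
Unset Strict Implicit.
Unset Printing Implicit Defensive.

Import Order.TTheory GRing.Theory Num.Theory.
Import numFieldNormedType.Exports.

Local Open Scope classical_set_scope.
Local Open Scope ring_scope.

Reserved Notation "x ** y" (at level 40, left associativity).

(* The multiplication is a field of this mixin, rather than the one of the
   ring hierarchy, because the rings of MathComp have a unit and a C*-algebra
   need not have one. The scalars are R[i], so the norm takes its values in
   the nonnegative real elements of R[i]. *)
HB.mixin Record CompleteNormedModule_isCstarAlgebra (R : realType) T
    & CompleteNormedModule R[i] T := {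
  cmul : T -> T -> T;
  cstar : T -> T;
  cmulA : associative cmul;
  cmulDl : left_distributive cmul +%R;
  cmulDr : right_distributive cmul +%R;
  cmulZl : forall (c : R[i]) x y, cmul (c *: x) y = c *: cmul x y;
  cmulZr : forall (c : R[i]) x y, cmul x (c *: y) = c *: cmul x y;
  cstarK : involutive cstar;
  cstarD : {morph cstar : x y / x + y};
  cstarZ : forall (c : R[i]) x, cstar (c *: x) = c^* *: cstar x;
  cstarM : forall x y, cstar (cmul x y) = cmul (cstar y) (cstar x);
  cnormM : forall x y, `|cmul x y| <= `|x| * `|y|;
  cnorm_star_mul : forall x, `|cmul (cstar x) x| = `|x| ^+ 2
}.

#[short(type="cstarAlgType")]
HB.structure Definition CstarAlgebra (R : realType) :=
  {T of CompleteNormedModule_isCstarAlgebra R T & CompleteNormedModule R[i] T}.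

Notation "x ** y" := (cmul x y) : ring_scope.

Section CstarAlgebras.
Variables (R : realType) (X Y : cstarAlgType R).

Definition is_projection (x : X) : Prop := x ** x = x /\ cstar x = x.

Definition is_partial_isometry (x : X) : Prop := x ** cstar x ** x = x.

Record cstar_subalgebra (D : set X) : Prop := CstarSubalgebra {
  subalg_closed_top : closed D;
  subalg0 : D 0;
  subalgD : forall x y, D x -> D y -> D (x + y);
  subalgZ : forall (c : R[i]) x, D x -> D (c *: x);
  subalgM : forall x y, D x -> D y -> D (x ** y);
  subalg_star : forall x, D x -> D (cstar x)
}.

Definition cstar_generated (S : set X) : set X := smallest cstar_subalgebra S.

(* f is a *-homomorphism on the subset D; its values outside D are ignored. *)
Record star_hom_on (D : set X) (f : X -> Y) : Prop := StarHomOn {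
  star_homD : forall x y, D x -> D y -> f (x + y) = f x + f y;
  star_homZ : forall (c : R[i]) x, D x -> f (c *: x) = c *: f x;
  star_homM : forall x y, D x -> D y -> f (x ** y) = f x ** f y;
  star_hom_star : forall x, D x -> f (cstar x) = cstar (f x)
}.

Definition star_hom (f : X -> Y) : Prop := star_hom_on setT f.

End CstarAlgebras.

Record digraph := Digraph {
  vertex : Type;
  edge : Type;
  erange : edge -> vertex;
  esource : edge -> vertex
}.

Fixpoint is_path (E : digraph) (e : edge E) (l : seq (edge E)) : Prop :=
  if l is f :: l' then erange e = esource f /\ is_path f l' else True.

(* A path of length >= 1, as its first edge and the list of the others. *)
Record gpath (E : digraph) := GPath {
  first_edge : edge E;
  next_edges : seq (edge E);
  gpathP : is_path first_edge next_edges
}.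

Section LabelledGraphs.
Variable E : digraph.

Definition psource (l : gpath E) : vertex E := esource (first_edge l).

Definition prange (l : gpath E) : vertex E :=
  erange (last (first_edge l) (next_edges l)).

Definition sinks : set (vertex E) := [set v | forall e, esource e <> v].

Variables (Al : countType) (L : edge E -> Al).

Definition plabel (l : gpath E) : seq Al :=
  map L (first_edge l :: next_edges l).

Definition labelled_words : set (seq Al) := range plabel.

Definition wrange (alpha : seq Al) : set (vertex E) :=
  [set v | exists l, plabel l = alpha /\ prange l = v].

Definition rel_range (A : set (vertex E)) (alpha : seq Al) : set (vertex E) :=
  [set v | exists l, [/\ plabel l = alpha, A (psource l) & prange l = v]].

Definition out_labels (A : set (vertex E)) : set Al :=
  [set L e | e in [set e | A (esource e)]].

Variable B : set (set (vertex E)).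

Record accommodating : Prop := Accommodating {
  accom_wrange : forall alpha, labelled_words alpha -> B (wrange alpha);
  accom_rel_range : forall A alpha,
    B A -> labelled_words alpha -> B (rel_range A alpha);
  accom_setI : setI_closed B;
  accom_setU : setU_closed B
}.

Definition normal_collection : Prop := setD_closed B.

Definition weakly_left_resolving : Prop :=
  forall A A' alpha, B A -> B A' -> labelled_words alpha ->
    rel_range A alpha `&` rel_range A' alpha = rel_range (A `&` A') alpha.

Section Representations.
Variables (R : realType) (X : cstarAlgType R).

(* Only the values of p on B matter. The finitely supported sum in rep_sum is
   the ordinary finite sum, since out_labels A is finite there. *)
Record representation (p : set (vertex E) -> X) (s : Al -> X) : Prop :=
  Representation {
  rep_projection : forall A, B A -> is_projection (p A);
  rep_partial_isometry : forall a, is_partial_isometry (s a);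
  rep_set0 : B set0 -> p set0 = 0;
  rep_setI : forall A A', B A -> B A' -> p A ** p A' = p (A `&` A');
  rep_setU : forall A A', B A -> B A' ->
    p (A `|` A') = p A + p A' - p (A `&` A');
  rep_commute : forall A a, B A -> p A ** s a = s a ** p (rel_range A [:: a]);
  rep_initial : forall a, cstar (s a) ** s a = p (wrange [:: a]);
  rep_orthogonal : forall a b, a <> b -> cstar (s a) ** s b = 0;
  rep_sum : forall A, B A -> finite_set (out_labels A) ->
    (forall A', B A' -> A' `<=` sinks -> A `&` A' = set0) ->
    p A = \sum_(a \in out_labels A)
            s a ** p (rel_range A [:: a]) ** cstar (s a)
}.

Definition rep_algebra (p : set (vertex E) -> X) (s : Al -> X) : set X :=
  cstar_generated (p @` B `|` range s).

End Representations.

(* C, with (p, s), is C*(E, L, B). The map f below is unique because p and s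
   generate C and *-homomorphisms of C*-algebras are continuous. *)
Record universal_representation (R : realType) (C : cstarAlgType R)
    (p : set (vertex E) -> C) (s : Al -> C) : Prop := UniversalRepresentation {
  univ_rep : representation p s;
  univ_generated : rep_algebra p s = setT;
  univ_hom : forall (Y : cstarAlgType R) (q : set (vertex E) -> Y) (t : Al -> Y),
    representation q t ->
    exists f : C -> Y, [/\ star_hom f, forall A, B A -> f (p A) = q A
                         & forall a, f (s a) = t a]
}.

End LabelledGraphs.

(* Main.v *)
(* The direction from right to left compares norms on the dense *-subalgebra of C
   spanned by the products s_a1 ... s_am p_A s_bn^* ... s_b1^*, graded by the
   degree m - n.

   In degree 0 it is filtered by "levels", where level n + 1 consists of the
   u + sum s_a y s_b^* with u in the span of the p_A and y of level n. If
   q_A <> 0 for A <> set0, then pi is injective on the closure of each level: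
   an element of its kernel can only involve regular sets A at level 0, and these
   are removed with the last relation of a representation. An injective
   *-homomorphism of C*-algebras is isometric, so pi is isometric on each
   homogeneous component x, through x^* x. Averages of the beta_z over roots of
   unity show that |pi y_k| <= |pi y| for the component y_k of degree k of y, so
   |y| <= (2 n + 1) |pi y| if y has degrees in [-n, n]. Applying this to the
   powers of y^* y, whose degrees grow linearly, gives |y| <= |pi y|.

   From left to right, beta_z is pi gamma_z pi^-1, where gamma_z comes from the
   universal property, and q_A <> 0 because p_A <> 0. The latter is seen in a
   representation on l2 of the space of boundary paths, whose points are labelled
   paths together with the prime filters of B that they pass through.

   That *-homomorphisms are contractive, and isometric when injective, is deduced
   from one construction: if |k| <= 1 and k = k^*, then k is the real part of the
   unitary k + i sqrt (1 - k^2), where the root is a limit of polynomials in k^2. *)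
From HB Require Import structures.
Require Import Defs.
From mathcomp Require Import all_boot all_order all_algebra finmap.
From mathcomp Require Import boolp classical_sets functions cardinality fsbigop.
From mathcomp Require Import reals topology normedtype sequences.
From mathcomp Require Import ring lra zify.

Set Implicit Arguments.
Unset Strict Implicit.
Unset Printing Implicit Defensive.

Import Order.TTheory GRing.Theory Num.Theory.
Import numFieldNormedType.Exports.

Local Open Scope classical_set_scope.
Local Open Scope ring_scope.
Local Open Scope complex_scope.

(** * Norms with real values *)

(** What shapes the boundary paths is the last relation of a representation. A set to which it
    applies may contain sinks, as long as no set of [B] made of sinks meets it. At such a vertex the
    right-hand side vanishes, so the obvious operators on paths of edges do not form a
    representation. Moreover, two edges with the same label and range may start at vertices that [B]
    does not separate, so a vertex has no well-defined predecessor along a label. Prime filters see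
    only what [B] sees: one that contains a regular set can always be continued, and its predecessor
    along a label is its pullback.

    In the direction from right to left, the [beta_z] come with no continuity in z, so degrees are
    separated by finite averages instead of integrals over the circle.

    A C*-algebra need not have a unit, so for the isometry of injective homomorphisms the roots of 1
    - k^2 are taken among the operators on the algebra itself. These operators and those on l2 are
    two instances of one construction. *)

Section RealNorm.
Variables (R : realType) (V : normedModType R[i]).
Implicit Types (x y : V) (c : R[i]).

(** The norm takes its values in [R[i]], while suprema, square roots and real arithmetic need
    elements of [R]. *)
Definition nr x : R := complex.Re `|x|.

Lemma nrE x : `|x| = (nr x)%:C.
Proof. by rewrite /nr RRe_real // ger0_real. Qed.

Lemma nr_ge0 x : 0 <= nr x.
Proof. by rewrite -lecR -nrE normr_ge0. Qed.

Lemma nr0 : nr 0 = 0.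
Proof. by rewrite /nr normr0. Qed.

Lemma nr_eq0 x : (nr x == 0) = (x == 0).
Proof. by rewrite -[RHS]normr_eq0 nrE eq_complex /= eqxx andbT. Qed.

Lemma nrD x y : nr (x + y) <= nr x + nr y.
Proof. by rewrite -lecR rmorphD /= -!nrE ler_normD. Qed.

Lemma nrN x : nr (- x) = nr x.
Proof. by rewrite /nr normrN. Qed.

Lemma nr_distC x y : nr (x - y) = nr (y - x).
Proof. by rewrite -opprB nrN. Qed.

Definition cabs c : R := complex.Re `|c|.

Lemma cabsE c : `|c| = (cabs c)%:C.
Proof. by rewrite /cabs RRe_real // ger0_real. Qed.

Lemma cabs_ge0 c : 0 <= cabs c.
Proof. by rewrite -lecR -cabsE normr_ge0. Qed.

Lemma cabsM c d : cabs (c * d) = cabs c * cabs d.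
Proof. by apply: complexI; rewrite -cabsE normrM !cabsE rmorphM. Qed.

Lemma cabs0 : cabs 0 = 0. Proof. by rewrite /cabs normr0. Qed.

Lemma cabs1 : cabs 1 = 1. Proof. by rewrite /cabs normr1. Qed.

Lemma cabsJ c : cabs (c^*)%R = cabs c.
Proof. by rewrite /cabs norm_conjC. Qed.

Lemma cabsr (r : R) : cabs r%:C = `|r|.
Proof. by rewrite /cabs normc_def /= expr0n /= addr0 sqrtr_sqr. Qed.

Lemma cabs_eq0 c : (cabs c == 0) = (c == 0).
Proof. by rewrite -[RHS]normr_eq0 cabsE eq_complex /= eqxx andbT. Qed.

Lemma nrZ c x : nr (c *: x) = cabs c * nr x.
Proof. by apply: complexI; rewrite -nrE normrZ nrE cabsE rmorphM. Qed.

Lemma nrZr (r : R) x : nr (r%:C *: x) = `|r| * nr x.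
Proof. by rewrite nrZ cabsr. Qed.

Lemma nr_sum (I : Type) (l : seq I) (P : pred I) (F : I -> V) :
  nr (\sum_(i <- l | P i) F i) <= \sum_(i <- l | P i) nr (F i).
Proof.
elim/big_ind2: _ => [|x r y s hx hy|i _]; rewrite ?nr0 //.
exact: le_trans (nrD _ _) (lerD hx hy).
Qed.

Lemma nr_triangle z x y : nr (x - y) <= nr (x - z) + nr (z - y).
Proof. by rewrite (le_trans _ (nrD _ _)) // addrA subrK. Qed.

Lemma nr_eq0_eps x : (forall e : R, 0 < e -> nr x <= e) -> x = 0.
Proof.
move=> h; apply/eqP; rewrite -nr_eq0 eq_le nr_ge0 andbT.
by apply/ler_addgt0Pl => e /h; rewrite addr0.
Qed.

Lemma cvg_nrP T (F : set_system T) {FF : Filter F} (u : T -> V) (l : V) :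
  (u @ F --> l) <-> forall e : R, 0 < e -> \forall n \near F, nr (u n - l) < e.
Proof.
split=> [h e e0|h].
  have/cvgrPdist_lt/(_ e%:C) := h; rewrite ltcR => /(_ e0).
  by apply: filterS => n; rewrite distrC nrE ltcR.
apply/cvgrPdist_lt => e e0; rewrite -[e]RRe_real ?gtr0_real //.
have : 0 < complex.Re e by rewrite -ltcR RRe_real ?gtr0_real.
by move=> /h; apply: filterS => n; rewrite distrC nrE ltcR.
Qed.

Lemma cvg_nr_unique (u : nat -> V) (l l' : V) :
  u @ \oo --> l -> u @ \oo --> l' -> l = l'.
Proof. by move=> h h'; apply: cvg_unique h h'; exact: norm_hausdorff. Qed.

Lemma closed_nrP (D : set V) x :
  closed D -> (forall e : R, 0 < e -> exists2 y, D y & nr (x - y) < e) -> D x.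
Proof.
move=> Dc h; apply: Dc => U /nbhs_ballP[e /= e0 xU].
have e1 : 0 < complex.Re e by rewrite -ltcR RRe_real ?gtr0_real.
have [y Dy xy] := h _ e1; exists y; split=> //; apply: xU.
by rewrite -ball_normE /= nrE -[e]RRe_real ?gtr0_real ?ltcR.
Qed.

Lemma closure_nrP (D : set V) x :
  closure D x <-> (forall e : R, 0 < e -> exists2 y, D y & nr (x - y) < e).
Proof.
split=> [h e e0|h].
  have [|y [Dy xy]] := h (ball x e%:C).
    by apply: nbhsx_ballx; rewrite ltcR.
  by exists y => //; move: xy; rewrite -ball_normE /= nrE ltcR.
apply: (closed_nrP (@closed_closure _ D)) => e /h[y Dy xy].
by exists y => //; exact: subset_closure.
Qed.

Lemma closed_cvgn (D : set V) (u : nat -> V) (l : V) :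
  closed D -> (forall n, D (u n)) -> u @ \oo --> l -> D l.
Proof. by move=> Dc Du; apply: closed_cvg => //; exact: nearW. Qed.

Lemma cvgn_nrP (u : nat -> V) (l : V) :
  u @ \oo --> l <->
  forall e : R, 0 < e -> exists N, forall n, (N <= n)%N -> nr (u n - l) < e.
Proof.
split=> [/(@cvg_nrP _ _ _ u l) h e /h [N _ hN]|h].
  by exists N => n; exact: hN.
by apply/(@cvg_nrP _ _ _ u l) => e /h [N hN]; exists N => // n; exact: hN.
Qed.

Lemma cvg_nr_le (u : nat -> V) (l : V) M :
  u @ \oo --> l -> (forall n, nr (u n) <= M) -> nr l <= M.
Proof.
move=> /cvgn_nrP h uM; apply/ler_addgt0Pl => e /h[N /(_ N (leqnn N)) uN].
rewrite -[l](subrK (u N)) (le_trans (nrD _ _)) // lerD //.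
by rewrite nr_distC ltW.
Qed.

End RealNorm.

Lemma cvg_lipschitz (R : realType) (V W : normedModType R[i]) (f : V -> W)
    (M : R) T (F : set_system T) {FF : Filter F} (u : T -> V) (l : V) :
  (forall x y, nr (f x - f y) <= M * nr (x - y)) ->
  u @ F --> l -> (fun n => f (u n)) @ F --> f l.
Proof.
move=> fM /(@cvg_nrP _ _ _ F FF u l) ul; apply/cvg_nrP => e e0.
pose M' := `|M| + 1; have M'0 : 0 < M' by rewrite ltr_wpDl.
have /ul : 0 < e / M' by rewrite divr_gt0.
apply: filterS => n; rewrite ltr_pdivlMr // => h.
apply: le_lt_trans (fM _ _) _; apply: le_lt_trans h.
rewrite mulrC ler_wpM2l ?nr_ge0 // (le_trans (ler_norm _)) //.
by rewrite lerDl.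
Qed.

(** The increments of [t] telescope, so distances between terms of [u] are bounded by distances
    between terms of the convergent sequence [t]. *)
Lemma dominated_cvg (R : realType) (V : completeNormedModType R[i])
    (u : nat -> V) (t : nat -> R) (M : R) :
  (forall n, t n <= M) -> (forall n, nr (u n.+1 - u n) <= t n.+1 - t n) ->
  exists l : V, u @ \oo --> l.
Proof.
move=> tM ut.
have tnd : nondecreasing_seq t.
  apply/nondecreasing_seqP => n; rewrite -subr_ge0.
  exact: le_trans (nr_ge0 _) (ut n).
have ud m n : (m <= n)%N -> nr (u n - u m) <= t n - t m.
  elim: n => [|n ih]; first by rewrite leqn0 => /eqP ->; rewrite !subrr nr0.
  rewrite leq_eqVlt => /predU1P[->|]; first by rewrite !subrr nr0.
  rewrite ltnS => /ih h; rewrite (le_trans (nr_triangle (u n) _ _)) //.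
  have -> : t n.+1 - t m = (t n.+1 - t n) + (t n - t m) by ring.
  by rewrite lerD.
have tc : cvg (t @ \oo).
  by apply: nondecreasing_is_cvgn => //; exists M => _ [n _ <-].
apply/cvg_ex; apply: cauchy_cvg; apply/cauchyP => e e0.
have e1 : 0 < complex.Re e by rewrite -ltcR RRe_real ?gtr0_real.
have /cvgrPdist_lt/(_ _ e1)[N _ tN] := tc.
exists (u N), N => //= n /= Nn.
rewrite -ball_normE /= nrE -[e]RRe_real ?gtr0_real // ltcR nr_distC.
apply: le_lt_trans (ud _ _ Nn) _.
have lt n' : t n' <= lim (t @ \oo) by exact: nondecreasing_cvgn_le.
have := tN N (leqnn N); rewrite ger0_norm ?subr_ge0 //.
by apply: le_lt_trans; rewrite lerB.
Qed.

(** * Algebra and continuity for the C*-norm *)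

Section CstarNorm.
Variables (R : realType) (X : cstarAlgType R).
Implicit Types x y z : X.

Lemma nrM x y : nr (x ** y) <= nr x * nr y.
Proof. by rewrite -lecR rmorphM /= -!nrE cnormM. Qed.

Lemma nr_star_mul x : nr (cstar x ** x) = nr x ^+ 2.
Proof. by apply: complexI; rewrite -nrE cnorm_star_mul nrE rmorphXn. Qed.

Lemma cmul0x x : 0 ** x = 0.
Proof. by have := cmulDl 0 0 x; rewrite addr0 => /(congr1 (+%R^~ (- (0 ** x)))); rewrite subrr addrK. Qed.

Lemma cmulx0 x : x ** 0 = 0.
Proof. by have := cmulDr x 0 0; rewrite addr0 => /(congr1 (+%R^~ (- (x ** 0)))); rewrite subrr addrK. Qed.

Lemma cmulNx x y : (- x) ** y = - (x ** y).
Proof. by rewrite -scaleN1r cmulZl scaleN1r. Qed.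

Lemma cmulxN x y : x ** (- y) = - (x ** y).
Proof. by rewrite -scaleN1r cmulZr scaleN1r. Qed.

Lemma cmulBl x y z : (x - y) ** z = x ** z - y ** z.
Proof. by rewrite cmulDl cmulNx. Qed.

Lemma cmulBr x y z : x ** (y - z) = x ** y - x ** z.
Proof. by rewrite cmulDr cmulxN. Qed.

Lemma cstar0 : cstar (0 : X) = 0.
Proof. by rewrite -(scale0r 0) cstarZ conjC0 !scale0r. Qed.

Lemma cstarN x : cstar (- x) = - cstar x.
Proof. by rewrite -scaleN1r cstarZ rmorphN1 scaleN1r. Qed.

Lemma cstarB x y : cstar (x - y) = cstar x - cstar y.
Proof. by rewrite cstarD cstarN. Qed.

Lemma cmul_suml (I : Type) (l : seq I) (P : pred I) (F : I -> X) y :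
  (\sum_(i <- l | P i) F i) ** y = \sum_(i <- l | P i) F i ** y.
Proof.
by elim/big_rec2: _ => [|i x z _ <-]; rewrite ?cmul0x // cmulDl.
Qed.

Lemma cmul_sumr (I : Type) (l : seq I) (P : pred I) (F : I -> X) y :
  y ** (\sum_(i <- l | P i) F i) = \sum_(i <- l | P i) y ** F i.
Proof.
by elim/big_rec2: _ => [|i x z _ <-]; rewrite ?cmulx0 // cmulDr.
Qed.

Lemma cstar_sum (I : Type) (l : seq I) (P : pred I) (F : I -> X) :
  cstar (\sum_(i <- l | P i) F i) = \sum_(i <- l | P i) cstar (F i).
Proof.
by elim/big_rec2: _ => [|i x z _ <-]; rewrite ?cstar0 // cstarD.
Qed.

Lemma nr_star x : nr (cstar x) = nr x.
Proof.
have le y : nr y <= nr (cstar y).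
  have [->|/eqP y0] := eqVneq (nr y) 0; first exact: nr_ge0.
  have ygt : 0 < nr y by rewrite lt_def nr_ge0 andbT; apply/eqP.
  rewrite -(ler_pM2r ygt) -expr2 -nr_star_mul; exact: nrM.
by apply/eqP; rewrite eq_le le andbT -{2}[x]cstarK le.
Qed.

Lemma star_mul_eq0 x : cstar x ** x = 0 -> x = 0.
Proof.
move=> /(congr1 (@nr _ _)); rewrite nr_star_mul nr0 => /eqP.
by rewrite sqrf_eq0 nr_eq0 => /eqP.
Qed.

Lemma cvg_mull T (F : set_system T) {FF : Filter F} (u : T -> X) (l : X) y :
  u @ F --> l -> (fun n => u n ** y) @ F --> l ** y.
Proof.
apply: (@cvg_lipschitz _ _ _ (fun x : X => x ** y) (nr y)) => a b.
by rewrite -cmulBl mulrC nrM.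
Qed.

Lemma cvg_mulr T (F : set_system T) {FF : Filter F} (u : T -> X) (l : X) y :
  u @ F --> l -> (fun n => y ** u n) @ F --> y ** l.
Proof.
apply: (@cvg_lipschitz _ _ _ (fun x : X => y ** x) (nr y)) => a b.
by rewrite -cmulBr nrM.
Qed.

Lemma cvg_star T (F : set_system T) {FF : Filter F} (u : T -> X) (l : X) :
  u @ F --> l -> (fun n => cstar (u n)) @ F --> cstar l.
Proof.
apply: (@cvg_lipschitz _ _ _ (@cstar _ X) 1) => a b.
by rewrite -cstarB nr_star mul1r.
Qed.

Lemma cvg_sqr (u : nat -> X) (l : X) (M : R) : (forall n, nr (u n) <= M) ->
  u @ \oo --> l -> (fun n => u n ** u n) @ \oo --> l ** l.
Proof.
move=> uM ul; have lM := cvg_nr_le ul uM.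
apply/cvgn_nrP => e e0; have /cvgn_nrP h := ul.
have M1 : 0 < M *+ 2 + 1 by rewrite ltr_wpDl // mulrn_wge0 // (le_trans (nr_ge0 l)).
have /h : 0 < e / (M *+ 2 + 1) by rewrite divr_gt0.
case=> N hN; exists N => n /hN; rewrite ltr_pdivlMr //; apply: le_lt_trans.
have -> : u n ** u n - l ** l = (u n - l) ** u n + l ** (u n - l).
  by rewrite cmulBl cmulBr addrA subrK.
rewrite (le_trans (nrD _ _)) // (le_trans (lerD (nrM _ _) (nrM _ _))) //.
rewrite [nr l * _]mulrC -mulrDr ler_wpM2l ?nr_ge0 //.
by rewrite mulr2n ler_wpDr // lerD.
Qed.

End CstarNorm.

(** * Contractivity of *-homomorphisms *)

Section HalfRoot.
Variables (R : realType) (X : cstarAlgType R).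
Implicit Types (x y e : X).

(* The solution of e = (x + e^2) / 2, that is, e = 1 - sqrt (1 - x), obtained by
   iteration from 0. The same iteration at x = 1 in R increases and is bounded
   by 1, and its increments bound those of hroot_seq. *)
Fixpoint hroot_seq x n : X :=
  if n is n'.+1 then (2^-1)%:C *: (x + hroot_seq x n' ** hroot_seq x n')
  else 0.

Fixpoint hroot_maj n : R :=
  if n is n'.+1 then 2^-1 * (1 + hroot_maj n' ^+ 2) else 0.

Lemma hroot_maj01 n : 0 <= hroot_maj n <= 1.
Proof.
elim: n => [|n /andP[h0 h1]] /=; first by rewrite lexx ler01.
apply/andP; split; first by rewrite mulr_ge0 ?invr_ge0 // addr_ge0 // sqr_ge0.
have : hroot_maj n ^+ 2 <= 1 by rewrite exprn_ile1.
lra.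
Qed.

Lemma nr_hroot_seq x n : nr x <= 1 -> nr (hroot_seq x n) <= hroot_maj n.
Proof.
move=> x1; elim: n => [|n ih] /=; first by rewrite nr0.
rewrite nrZr ger0_norm ?invr_ge0 // ler_wpM2l ?invr_ge0 //.
rewrite (le_trans (nrD _ _)) // lerD // (le_trans (nrM _ _)) // expr2.
by rewrite ler_pM // nr_ge0.
Qed.

Lemma nr_hroot_seqB x n : nr x <= 1 ->
  nr (hroot_seq x n.+1 - hroot_seq x n) <= hroot_maj n.+1 - hroot_maj n.
Proof.
move=> x1; elim: n => [|n ih].
  rewrite /= cmul0x addr0 !subr0 expr0n /= addr0 nrZr ger0_norm ?invr_ge0 //.
  by rewrite ler_wpM2l ?invr_ge0.
set u := hroot_seq x n.+1; set v := hroot_seq x n.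
(* The splitting u^2 - v^2 = (u - v) u + v (u - v) holds without commutation. The majorant is split
   in the same way, so the bounds match term by term. *)
have -> : hroot_seq x n.+2 - u =
    (2^-1)%:C *: ((u - v) ** u + v ** (u - v)).
  rewrite [u in _ - u]/= -[hroot_seq x n.+2]/((2^-1)%:C *: (x + u ** u)).
  rewrite -scalerBr cmulBl cmulBr addrA subrK -/v; congr (_ *: _).
  by rewrite opprD addrACA subrr add0r.
rewrite nrZr ger0_norm ?invr_ge0 //.
have -> : hroot_maj n.+2 - hroot_maj n.+1 = 2^-1 *
    ((hroot_maj n.+1 - hroot_maj n) * hroot_maj n.+1 +
     hroot_maj n * (hroot_maj n.+1 - hroot_maj n)).
  rewrite -[hroot_maj n.+2]/(2^-1 * (1 + hroot_maj n.+1 ^+ 2)).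
  by rewrite {2}/hroot_maj -/hroot_maj; ring.
rewrite ler_wpM2l ?invr_ge0 // (le_trans (nrD _ _)) // lerD //.
  by rewrite (le_trans (nrM _ _)) // ler_pM ?nr_ge0 // nr_hroot_seq.
by rewrite (le_trans (nrM _ _)) // ler_pM ?nr_ge0 // nr_hroot_seq.
Qed.

Definition hroot x : X := lim (hroot_seq x @ \oo).

Lemma cvg_hroot x : nr x <= 1 -> hroot_seq x @ \oo --> hroot x.
Proof.
move=> x1; suff /cvg_ex : exists l : X, hroot_seq x @ \oo --> l by [].
apply: (@dominated_cvg _ _ _ hroot_maj 1) => n.
  by have /andP[] := hroot_maj01 n.
exact: nr_hroot_seqB.
Qed.

Lemma nr_hroot x : nr x <= 1 -> nr (hroot x) <= 1.
Proof.
move=> x1; apply: cvg_nr_le (cvg_hroot x1) _ => n.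
by rewrite (le_trans (nr_hroot_seq n x1)) //; have /andP[] := hroot_maj01 n.
Qed.

(* With a unit this says that (1 - hroot x)^2 = 1 - x. *)
Lemma hrootE x : nr x <= 1 -> hroot x + hroot x = x + hroot x ** hroot x.
Proof.
move=> x1; have hc := cvg_hroot x1.
have hs : (fun n => hroot_seq x n ** hroot_seq x n) @ \oo -->
    hroot x ** hroot x.
  apply: cvg_sqr hc => n; apply: le_trans (nr_hroot_seq n x1) _.
  by have /andP[_] := hroot_maj01 n; exact.
have h1 : (fun n => hroot_seq x n.+1) @ \oo -->
    (2^-1)%:C *: (x + hroot x ** hroot x).
  by rewrite /=; apply: cvgZl_tmp; apply: cvgD => //; exact: cvg_cst.
have h2 : (fun n => hroot_seq x n.+1) @ \oo --> hroot x.
  apply/cvgn_nrP => d d0; have /cvgn_nrP/(_ d d0)[N hN] := hc.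
  by exists N => n Nn; apply: hN; exact: leqW.
rewrite {1 2}(cvg_nr_unique h2 h1) -scalerDl -rmorphD /=.
rewrite [X in X%:C *: _](_ : _ = 1) ?scale1r //.
by lra.
Qed.

Lemma hroot_closed (D : set X) x : cstar_subalgebra D -> nr x <= 1 -> D x ->
  D (hroot x).
Proof.
move=> DD x1 Dx; apply: closed_cvgn (cvg_hroot x1) => //.
  exact: subalg_closed_top DD.
elim=> [|n ih] /=; first exact: subalg0.
by apply: subalgZ => //; apply: subalgD => //; exact: subalgM.
Qed.

Lemma hroot_seq_star x n : cstar x = x ->
  cstar (hroot_seq x n) = hroot_seq x n.
Proof.
move=> xs; elim: n => [|n ih] /=; first exact: cstar0.
rewrite cstarZ cstarD cstarM ih xs; congr (_ *: _).
by rewrite conj_Creal // complex_real.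
Qed.

Lemma hroot_star x : nr x <= 1 -> cstar x = x -> cstar (hroot x) = hroot x.
Proof.
move=> x1 xs; have hc := cvg_hroot x1.
apply: (cvg_nr_unique _ hc).
by rewrite -(funext (fun n => hroot_seq_star n xs)); exact: cvg_star.
Qed.

Lemma hroot_seq_comm x y n : x ** y = y ** x ->
  hroot_seq x n ** y = y ** hroot_seq x n.
Proof.
move=> xy; elim: n => [|n ih] /=; first by rewrite cmul0x cmulx0.
by rewrite cmulZl cmulZr cmulDl cmulDr xy -cmulA ih cmulA ih -cmulA.
Qed.

Lemma hroot_comm x y : nr x <= 1 -> x ** y = y ** x ->
  hroot x ** y = y ** hroot x.
Proof.
move=> x1 xy; have hc := cvg_hroot x1.
apply: (@cvg_nr_unique _ _ (fun n => hroot_seq x n ** y)).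
  exact: cvg_mull.
by rewrite (funext (fun n => hroot_seq_comm n xy)); exact: cvg_mulr.
Qed.

End HalfRoot.

Section StarHom.
Variables (R : realType) (X Y : cstarAlgType R).
Variables (D : set X) (f : X -> Y).
Hypotheses (DD : cstar_subalgebra D) (fh : star_hom_on D f).

Lemma subalgN x : D x -> D (- x).
Proof. by move=> Dx; rewrite -scaleN1r; exact: subalgZ. Qed.

Lemma subalgB x y : D x -> D y -> D (x - y).
Proof. by move=> Dx Dy; apply: subalgD => //; exact: subalgN. Qed.

Lemma subalg_sum (I : eqType) (l : seq I) (P : pred I) (F : I -> X) :
  (forall i, i \in l -> P i -> D (F i)) -> D (\sum_(i <- l | P i) F i).
Proof.
move=> h; rewrite big_seq_cond; elim/big_rec: _ => [|i x /andP[il Pi] Dx].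
  exact: subalg0.
by apply: subalgD => //; exact: h.
Qed.

Lemma star_hom0 : f 0 = 0.
Proof. by rewrite -(scale0r 0) (star_homZ fh) ?scale0r //; exact: subalg0. Qed.

Lemma star_homN x : D x -> f (- x) = - f x.
Proof. by move=> Dx; rewrite -scaleN1r (star_homZ fh) // scaleN1r. Qed.

Lemma star_homB x y : D x -> D y -> f (x - y) = f x - f y.
Proof. by move=> Dx Dy; rewrite (star_homD fh) ?star_homN //; exact: subalgN. Qed.

Lemma star_hom_sum (I : eqType) (l : seq I) (P : pred I) (F : I -> X) :
  (forall i, i \in l -> P i -> D (F i)) ->
  f (\sum_(i <- l | P i) F i) = \sum_(i <- l | P i) f (F i).
Proof.
elim: l => [|i l ih] h; first by rewrite !big_nil star_hom0.
have hl j : j \in l -> P j -> D (F j).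
  by move=> jl; apply: h; rewrite in_cons jl orbT.
rewrite !big_cons; case: ifP => Pi; last exact: ih.
rewrite (star_homD fh) ?ih //; first by apply: h => //; exact: mem_head.
exact: subalg_sum.
Qed.

End StarHom.

(* With u = a + i b, the hypotheses give u^* u = y^* y, and likewise for
   a - i b; and a is the half sum of the two. *)
Lemma re_part_le (R : realType) (X : cstarAlgType R) (a b y : X) :
  cstar a ** a + cstar b ** b = cstar y ** y ->
  cstar a ** b = cstar b ** a -> nr a <= nr y.
Proof.
move=> aby ab.
have nu (c : R[i]) : (c^*)%R = - c -> c * c = -1 -> nr (a + c *: b) = nr y.
  move=> cs cc; apply/eqP; rewrite -(eqrXn2 (ltn0Sn 1)) ?nr_ge0 //; apply/eqP.
  rewrite -!nr_star_mul -aby; congr nr.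
  rewrite cstarD cstarZ cs !(cmulDl, cmulDr) !cmulZl !cmulZr scalerA mulNr cc.
  by rewrite opprK scale1r ab scaleNr addrA addrK.
have ci : (('i%R : R[i])^*)%R = - 'i%R by rewrite conjCi.
have ii : 'i%R * 'i%R = -1 :> R[i] by rewrite -expr2 sqrCi.
have h1 := nu _ ci ii.
have h2 : nr (a + (- 'i%R) *: b) = nr y.
  by apply: nu; [rewrite rmorphN /= ci | rewrite mulrNN].
have := nrD (a + 'i%R *: b) (a + (- 'i%R) *: b).
rewrite h1 h2 addrACA -scalerDl subrr scale0r addr0.
have -> : a + a = (2 : R)%:C *: a by rewrite rmorph_nat scaler_nat mulr2n.
by rewrite nrZr ger0_norm //; lra.
Qed.

Section Contractive.
Variables (R : realType) (X Y : cstarAlgType R).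
Variables (D : set X) (f : X -> Y).
Hypotheses (DD : cstar_subalgebra D) (fh : star_hom_on D f).

(* The root e of k^2 gives 1 - k^2 = (1 - e)^2. This relation is algebraic, so f
   preserves it, and f k is the real part of an element that acts as a unitary.
   No continuity of f is used. *)
Lemma star_hom_sa_le1 k : D k -> cstar k = k -> nr k <= 1 -> nr (f k) <= 1.
Proof.
move=> Dk ks k1; pose x := k ** k.
have Dx : D x by exact: subalgM.
have x1 : nr x <= 1.
  by rewrite (le_trans (nrM _ _)) // mulr_ile1 ?nr_ge0.
have De := hroot_closed DD x1 Dx.
have es : cstar (hroot x) = hroot x.
  by apply: hroot_star => //; rewrite /x cstarM ks.
have ek : hroot x ** k = k ** hroot x.
  by apply: hroot_comm => //; rewrite /x cmulA.
pose l := f k; pose g := f (hroot x).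
have ls : cstar l = l by rewrite -(star_hom_star fh) // ks.
have gs : cstar g = g by rewrite -(star_hom_star fh) // es.
have gl : g ** l = l ** g by rewrite -!(star_homM fh) // ek.
have gE : g + g = l ** l + g ** g.
  rewrite -!(star_homM fh) // -!(star_homD fh) ?hrootE //; first exact: subalgM.
(* [y - g ** y] stands for (1 - g) y, as [Y] need not have a unit; [gE] is (1 - g)^2 = 1 - l^2
   multiplied out. *)
have lM y : nr (l ** y) <= nr y.
  apply: (@re_part_le _ _ _ (y - g ** y)).
    rewrite cstarB !cstarM ls gs !(cmulBl, cmulBr).
    have -> : cstar y ** l ** (l ** y) = cstar y ** (l ** l) ** y.
      by rewrite !cmulA.
    have -> : l ** l = g + g - g ** g by rewrite gE addrK.
    rewrite cmulBr cmulDr cmulBl cmulDl !cmulA.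
    set a := cstar y ** g ** y; set c := _ ** g ** y; set d := _ ** y.
    by rewrite addrC opprB -addrA -[a + a - c]addrA [c - a + _]addrA subrK [c + _]addrC !subrK.
  rewrite !cstarM cstarB cstarM ls gs !(cmulBl, cmulBr) !cmulA.
  by rewrite -(cmulA (cstar y) l g) -gl cmulA.
have := lM l; rewrite -{1}ls nr_star_mul => h.
have := nr_ge0 l; rewrite le_eqVlt => /predU1P[<- //|l0].
by rewrite -(ler_pM2r l0) mul1r -expr2.
Qed.

Lemma star_hom_sa_le k : D k -> cstar k = k -> nr (f k) <= nr k.
Proof.
move=> Dk ks; apply/ler_addgt0Pl => e e0.
have k0 : 0 < e + nr k by rewrite ltr_wpDr ?nr_ge0.
(* The summand [e] keeps the scaling factor meaningful when [k] is 0. *)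
pose c := (e + nr k)^-1; have c0 : 0 < c by rewrite invr_gt0.
have : nr (f (c%:C *: k)) <= 1.
  apply: star_hom_sa_le1; first exact: subalgZ.
    by rewrite cstarZ ks conj_Creal // complex_real.
  rewrite nrZr gtr0_norm // mulrC ler_pdivrMr // mul1r.
  by rewrite ler_wpDl // ltW.
by rewrite (star_homZ fh) // nrZr gtr0_norm // mulrC ler_pdivrMr // mul1r.
Qed.

Theorem star_hom_le x : D x -> nr (f x) <= nr x.
Proof.
move=> Dx; rewrite -(ler_pXn2r (ltn0Sn 1)) ?nnegrE ?nr_ge0 //.
rewrite -!nr_star_mul -(star_hom_star fh) // -(star_homM fh) //; last first.
  exact: subalg_star.
apply: star_hom_sa_le; last by rewrite cstarM cstarK.
by apply: subalgM => //; exact: subalg_star.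
Qed.

End Contractive.

(** * Adjointable operators *)

(** Completeness of [W] is a hypothesis rather than a structure, so that the scalars [R[i]^o] can be
    used as [W]. *)
Lemma cauchy_lipschitz (R : realType) (V : normedModType R[i])
    (W : normedModType R[i]) (f : V -> W) (M : R)
    (F : set_system V) (FF : ProperFilter F) :
  (forall G : set_system W, ProperFilter G -> cauchy G -> cvg G) ->
  (forall x y, nr (f x - f y) <= M * nr (x - y)) -> cauchy F ->
  exists l : W, f @ F --> l.
Proof.
move=> Wc fM /cauchyP Fc; apply/cvg_ex; apply: Wc; apply/cauchyP => e e0.
pose M' := `|M| + 1; have M'0 : 0 < M' by rewrite ltr_wpDl.
have := RRe_real (gtr0_real e0); move: (complex.Re e) => r er.
move: e0; rewrite -{}er ltcR => r0.
have d0 : 0 < (r / M')%:C by rewrite ltcR divr_gt0.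
have [x Fx] := Fc _ d0; exists (f x).
change (F [set y | ball (f x) r%:C (f y)]); apply: filterS Fx => y.
rewrite -!ball_normE /= !nrE !ltcR.
rewrite ltr_pdivlMr // => h; apply: le_lt_trans (fM _ _) _; apply: le_lt_trans h.
by rewrite mulrC ler_wpM2l ?nr_ge0 // (le_trans (ler_norm _)) // lerDl.
Qed.

(* A Banach space H with a sesquilinear map into a normed space that behaves
   like an inner product: this covers both Hilbert spaces and a C*-algebra
   acting on itself, with (x, y) |-> x^* y. *)
Record ipmodule (R : realType) := IpModule {
  ipcar :> completeNormedModType R[i];
  ipval : normedModType R[i];
  ip : ipcar -> ipcar -> ipval;
  ipDl : forall x y z, ip (x + y) z = ip x z + ip y z;
  ipDr : forall x y z, ip x (y + z) = ip x y + ip x z;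
  ipZl : forall (c : R[i]) x y, ip (c *: x) y = (c^*)%R *: ip x y;
  ipZr : forall (c : R[i]) x y, ip x (c *: y) = c *: ip x y;
  ip_le : forall x y, nr (ip x y) <= nr x * nr y;
  ip_self : forall x, nr (ip x x) = nr x ^+ 2
}.

Section Adjointable.
Variables (R : realType) (H : ipmodule R).
Implicit Types (T S : H -> H) (x y z : H).

Lemma ipBr x y z : ip x (y - z) = ip x y - ip x z.
Proof. by rewrite ipDr -scaleN1r ipZr scaleN1r. Qed.

Lemma ipBl x y z : ip (x - y) z = ip x z - ip y z.
Proof. by rewrite ipDl -scaleN1r ipZl rmorphN1 scaleN1r. Qed.

Lemma ip_inj y z : (forall x, ip x y = ip x z) -> y = z.
Proof.
move=> h; apply/eqP; rewrite -subr_eq0 -nr_eq0 -sqrf_eq0 -ip_self ipBr h subrr.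
by rewrite nr0.
Qed.

(** [ip] is not assumed hermitian, its values lying in a mere normed space; so neither equation
    follows from the other by conjugation. *)
Definition is_adjoint T S :=
  forall x y, ip (T x) y = ip x (S y) /\ ip (S x) y = ip x (T y).

Definition bounded_by T M := forall x, nr (T x) <= M * nr x.

Definition adjointable T := exists S M, is_adjoint T S /\ bounded_by T M.

Definition adjointable_pred : {pred (H -> H)} := fun T => `[< adjointable T >].

Lemma adjoint_uniq T S S' : is_adjoint T S -> is_adjoint T S' -> S = S'.
Proof.
move=> h h'; apply/funext => y; apply: ip_inj => x.
by rewrite -(h x y).1 (h' x y).1.
Qed.

Lemma adjoint_sym T S : is_adjoint T S -> is_adjoint S T.
Proof. by move=> h x y; have [] := h x y. Qed.

(** Moving [T] across [ip] turns its linearity into that of [ip] in the second argument. *)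
Lemma adjoint_linear T S (c : R[i]) x y :
  is_adjoint T S -> T (c *: x + y) = c *: T x + T y.
Proof.
by move=> h; apply: ip_inj => z; rewrite -(h _ _).2 !ipDr !ipZr !(h _ _).2.
Qed.

Lemma adjoint_bounded T S M : is_adjoint T S -> bounded_by T M -> bounded_by S M.
Proof.
move=> h b x; have := nr_ge0 (S x); rewrite le_eqVlt => /predU1P[s0|s0].
  (* [M] may be negative when [H] is trivial; a nonzero [x] forces M >= 0 through [b x]. *)
  rewrite -s0; have := nr_ge0 x; rewrite le_eqVlt => /predU1P[<-|x0].
    by rewrite mulr0.
  by rewrite mulr_ge0 ?nr_ge0 // -(pmulr_lge0 _ x0) (le_trans _ (b x)) ?nr_ge0.
rewrite -(ler_pM2r s0) -expr2 -ip_self (h _ _).2.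
apply: le_trans (ip_le _ _) _.
by rewrite [M * _]mulrC -mulrA ler_wpM2l ?nr_ge0.
Qed.

Lemma adjointable_submod : submod_closed adjointable_pred.
Proof.
split.
  apply/asboolP; exists (fun=> 0), 0; split=> x; last by rewrite nr0 mul0r.
  move=> y; have i0l z : ip (0 : H) z = 0.
    by rewrite -(scale0r 0) ipZl conjC0 scale0r.
  have i0r z : ip z (0 : H) = 0 by rewrite -(scale0r 0) ipZr scale0r.
  by rewrite !i0l !i0r.
move=> c T T' /asboolP[S [M [h b]]] /asboolP[S' [M' [h' b']]]; apply/asboolP.
exists (fun x => (c^*)%R *: S x + S' x), (cabs c * M + M'); split=> x.
  move=> y; rewrite !ipDl !ipDr !ipZl !ipZr conjCK.
  by rewrite (h _ _).1 (h' _ _).1 (h _ _).2 (h' _ _).2.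
rewrite (le_trans (nrD _ _)) // nrZ mulrDl -mulrA lerD // ler_wpM2l //.
exact: cabs_ge0.
Qed.

Record adjop := AdjOp { aop :> H -> H; _ : aop \in adjointable_pred }.

HB.instance Definition _ := [isSub for aop].
HB.instance Definition _ := [Choice of adjop by <:].
HB.instance Definition _ := GRing.isSubmodClosed.Build _ _ adjointable_pred
  adjointable_submod.
HB.instance Definition _ := [SubChoice_isSubLmodule of adjop by <:].


Implicit Types U W : adjop.

Lemma adjop_ex U : exists S M, is_adjoint U S /\ bounded_by U M.
Proof. by case: U => T /= /asboolP. Qed.

Lemma adjop_inj U W : (forall x, U x = W x) -> U = W.
Proof. by move=> h; apply: val_inj; exact: funext. Qed.

Lemma adjopP U (c : R[i]) x y : U (c *: x + y) = c *: U x + U y.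
Proof. by have [S [M [h _]]] := adjop_ex U; exact: adjoint_linear h. Qed.

Lemma adjopD U x y : U (x + y) = U x + U y.
Proof. by have := adjopP U 1 x y; rewrite !scale1r. Qed.

Lemma adjop0 U : U 0 = 0.
Proof. by have := adjopD U 0 0; rewrite addr0 -[X in X = _]addr0 => /addrI. Qed.

Lemma adjopZ U (c : R[i]) x : U (c *: x) = c *: U x.
Proof. by rewrite -[c *: x]addr0 adjopP adjop0 addr0. Qed.

Definition opnorm (T : H -> H) : R := sup [set nr (T x) | x in [set x | nr x <= 1]].

Lemma opnorm_le T M : 0 <= M -> bounded_by T M -> opnorm T <= M.
Proof.
move=> M0 b; apply: ge_sup; first by exists (nr (T 0)), 0 => //=; rewrite nr0.
move=> _ [x /= x1 <-]; rewrite (le_trans (b x)) // -[leRHS]mulr1.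
exact: ler_wpM2l.
Qed.

Lemma opnorm_ub U x : nr x <= 1 -> nr (U x) <= opnorm U.
Proof.
move=> x1; have [S [M [h b]]] := adjop_ex U; apply: ub_le_sup; last by exists x.
exists `|M| => _ [y /= y1 <-]; rewrite (le_trans (b y)) //.
rewrite (le_trans (ler_norm _)) // normrM [X in _ * X]ger0_norm ?nr_ge0 //.
by rewrite -[leRHS]mulr1 ler_wpM2l.
Qed.

Lemma opnorm_ge0 U : 0 <= opnorm U.
Proof. by have := @opnorm_ub U 0; rewrite adjop0 !nr0; apply. Qed.

Lemma adjop_le U x : nr (U x) <= opnorm U * nr x.
Proof.
have := nr_ge0 x; rewrite le_eqVlt => /predU1P[x0|x0].
  have /eqP := esym x0; rewrite nr_eq0 => /eqP ->.
  by rewrite adjop0 nr0 mulr0.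
rewrite -ler_pdivrMr //.
have -> : nr (U x) / nr x = nr (U ((nr x)^-1%:C *: x)).
  by rewrite adjopZ nrZr gtr0_norm ?invr_gt0 // mulrC.
by apply: opnorm_ub; rewrite nrZr gtr0_norm ?invr_gt0 // mulVf // gt_eqF.
Qed.

Lemma opnormD U W : opnorm (U + W) <= opnorm U + opnorm W.
Proof.
apply: opnorm_le => [|x]; first by rewrite addr_ge0 ?opnorm_ge0.
rewrite mulrDl; apply: le_trans (nrD _ _) _.
by apply: lerD; exact: adjop_le.
Qed.

Lemma opnormZ (c : R[i]) U : opnorm (c *: U) = cabs c * opnorm U.
Proof.
have le (d : R[i]) W : opnorm (d *: W) <= cabs d * opnorm W.
  apply: opnorm_le => [|x]; first by rewrite mulr_ge0 ?opnorm_ge0 ?cabs_ge0.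
  by rewrite nrZ -mulrA ler_wpM2l ?cabs_ge0 // adjop_le.
have [->|c0] := eqVneq c 0.
  rewrite scale0r cabs0 mul0r; apply/eqP; rewrite eq_le opnorm_ge0 andbT.
  by apply: opnorm_le => // x; rewrite mul0r nr0.
apply/eqP; rewrite eq_le le /=; have cp : 0 < cabs c.
  by rewrite lt_def cabs_ge0 cabs_eq0 c0.
rewrite -ler_pdivlMl // -[U in leLHS](scalerK c0) (le_trans (le _ _)) //.
by rewrite ler_wpM2r ?opnorm_ge0 // -(ler_pM2l cp) -cabsM !mulfV ?cabs1 // gt_eqF.
Qed.

Lemma opnorm_eq0 U : opnorm U = 0 -> U = 0.
Proof.
move=> U0; apply: adjop_inj => x; apply/eqP; rewrite -nr_eq0.
by rewrite eq_le nr_ge0 andbT -(mul0r (nr x)) -U0 adjop_le.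
Qed.

Definition adjop_norm U : R[i] := (opnorm U)%:C.

Lemma adjop_normD U W : adjop_norm (U + W) <= adjop_norm U + adjop_norm W.
Proof. by rewrite /adjop_norm -rmorphD lecR opnormD. Qed.

Lemma adjop_normZ (c : R[i]) U : adjop_norm (c *: U) = `|c| * adjop_norm U.
Proof. by rewrite /adjop_norm opnormZ cabsE rmorphM. Qed.

Lemma adjop_norm_eq0 U : adjop_norm U = 0 -> U = 0.
Proof. by case=> /opnorm_eq0. Qed.

HB.instance Definition _ := Lmodule_isNormed.Build R[i] adjop
  adjop_normD adjop_normZ adjop_norm_eq0.

Lemma nr_adjopE U : nr U = opnorm U.
Proof. by []. Qed.

Lemma nr_adjop_le U x : nr (U x) <= nr U * nr x.
Proof. exact: adjop_le. Qed.

Definition adj_fun U : H -> H := projT1 (cid (adjop_ex U)).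

Lemma adj_funP U : is_adjoint U (adj_fun U).
Proof. by rewrite /adj_fun; case: cid => S /= [M []]. Qed.

Lemma adj_fun_pred U : adj_fun U \in adjointable_pred.
Proof.
apply/asboolP; exists U, (opnorm U); have h := adj_funP U.
by split; [exact: adjoint_sym | apply: adjoint_bounded h _; exact: adjop_le].
Qed.

Definition adj U : adjop := AdjOp (adj_fun_pred U).

Lemma adjP U : is_adjoint U (adj U).
Proof. exact: adj_funP. Qed.

Lemma adj_eq U W : is_adjoint U W -> adj U = W.
Proof.
by move=> h; apply: adjop_inj => x; rewrite (adjoint_uniq (adjP U) h).
Qed.

Lemma opnorm_adj U : opnorm (adj U) = opnorm U.
Proof.
have le W : opnorm (adj W) <= opnorm W.
  apply: opnorm_le; first exact: opnorm_ge0.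
  by apply: adjoint_bounded (adjP W) _; exact: adjop_le.
apply/eqP; rewrite eq_le le /= -{1}(adj_eq (adjoint_sym (adjP U))).
exact: le.
Qed.

Lemma adjop_mul_pred U W : U \o W \in adjointable_pred.
Proof.
apply/asboolP; exists (adj W \o adj U), (opnorm U * opnorm W); split=> x.
  move=> y /=.
  by rewrite (adjP U _ _).1 (adjP W _ _).1 (adjP W _ _).2 (adjP U _ _).2.
by rewrite /= (le_trans (adjop_le _ _)) // -mulrA ler_wpM2l ?opnorm_ge0 ?adjop_le.
Qed.

Definition adjop_mul U W : adjop := AdjOp (adjop_mul_pred U W).

Lemma adjD U W : adj (U + W) = adj U + adj W.
Proof.
apply: adj_eq => x y; rewrite !ipDl !ipDr.
by rewrite (adjP U _ _).1 (adjP W _ _).1 (adjP U _ _).2 (adjP W _ _).2.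
Qed.

Lemma adjZ (c : R[i]) U : adj (c *: U) = (c^*)%R *: adj U.
Proof.
apply: adj_eq => x y; rewrite !ipZl !ipZr conjCK.
by rewrite (adjP U _ _).1 (adjP U _ _).2.
Qed.

Lemma adjM U W : adj (adjop_mul U W) = adjop_mul (adj W) (adj U).
Proof.
apply: adj_eq => x y /=.
by rewrite (adjP U _ _).1 (adjP W _ _).1 (adjP W _ _).2 (adjP U _ _).2.
Qed.

Lemma opnormM U W : opnorm (adjop_mul U W) <= opnorm U * opnorm W.
Proof.
apply: opnorm_le => [|x]; first by rewrite mulr_ge0 ?opnorm_ge0.
by rewrite /= (le_trans (adjop_le _ _)) // -mulrA ler_wpM2l ?opnorm_ge0 ?adjop_le.
Qed.

Lemma opnorm_star_mul U : opnorm (adjop_mul (adj U) U) = opnorm U ^+ 2.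
Proof.
apply/eqP; rewrite eq_le; apply/andP; split.
  by rewrite (le_trans (opnormM _ _)) // opnorm_adj expr2.
set n := opnorm (adjop_mul _ _); have n0 : 0 <= n by exact: opnorm_ge0.
rewrite -[n]sqr_sqrtr // ler_pXn2r ?nnegrE ?sqrtr_ge0 ?opnorm_ge0 //.
apply: opnorm_le => [|x]; first exact: sqrtr_ge0.
rewrite -(ler_pXn2r (ltn0Sn 1)) ?nnegrE ?nr_ge0 ?mulr_ge0 ?sqrtr_ge0 ?nr_ge0 //.
rewrite exprMn sqr_sqrtr // -ip_self (adjP _ _ _).1.
apply: le_trans (ip_le _ _) _; rewrite expr2 mulrC mulrA ler_wpM2r ?nr_ge0 //.
exact: (adjop_le (adjop_mul (adj U) U)).
Qed.

(** Pointwise limits are taken of the operators and of their adjoints at the same time, so that the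
    limit is again adjointable. *)
Lemma adjop_cauchy_cvg (F : set_system adjop) :
  ProperFilter F -> cauchy F -> cvg F.
Proof.
move=> FF Fc; have FF' : Filter F by exact: filter_filter.
have evL x (U W : adjop) : nr (U x - W x) <= nr x * nr (U - W).
  by rewrite mulrC; exact: (nr_adjop_le (U - W)).
have adL x (U W : adjop) : nr (adj U x - adj W x) <= nr x * nr (U - W).
  have -> : adj U x - adj W x = adj (U - W) x.
    by rewrite adjD -[- W]scaleN1r adjZ rmorphN1 scaleN1r.
  rewrite mulrC; apply: le_trans (nr_adjop_le _ _) _.
  by rewrite !nr_adjopE opnorm_adj.
have /choice[T TE] x := cauchy_lipschitz FF (@cauchy_cvg H) (evL x) Fc.
have /choice[S SE] x := cauchy_lipschitz FF (@cauchy_cvg H) (adL x) Fc.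
have TS : is_adjoint T S.
  have ipL (y : H) : forall a b, nr (ip a y - ip b y) <= nr y * nr (a - b).
    by move=> a b; rewrite -ipBl mulrC ip_le.
  have ipR (y : H) : forall a b, nr (ip y a - ip y b) <= nr y * nr (a - b).
    by move=> a b; rewrite -ipBr ip_le.
  move=> x y; split.
    have h1 := @cvg_lipschitz _ _ _ _ _ _ F FF' _ _ (ipL y) (TE x).
    have h2 := @cvg_lipschitz _ _ _ _ _ _ F FF' _ _ (ipR x) (SE y).
    apply: (cvg_unique (@norm_hausdorff _ (ipval H)) h1).
    by rewrite (funext (fun U : adjop => (adjP U x y).1)).
  have h1 := @cvg_lipschitz _ _ _ _ _ _ F FF' _ _ (ipL y) (SE x).
  have h2 := @cvg_lipschitz _ _ _ _ _ _ F FF' _ _ (ipR x) (TE y).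
  apply: (cvg_unique (@norm_hausdorff _ (ipval H)) h1).
  by rewrite (funext (fun U : adjop => (adjP U x y).2)).
(* [U] is compared with [T] at [x] through some [W] of the filter that depends on [x]; the resulting
   bound does not, so the convergence is in norm. *)
have near_le (e : R) : 0 < e -> exists2 U : adjop,
    (forall x, nr (T x - U x) <= e * nr x) & \forall W \near F, nr (U - W) < e.
  move=> e0; have ec : 0 < e%:C by rewrite ltcR.
  have /cauchyP/(_ _ ec)[U FU] := Fc.
  have FU' : \forall W \near F, nr (U - W) < e.
    by apply: filterS FU => W; rewrite -ball_normE /= nrE ltcR.
  exists U => // x; apply/ler_addgt0Pl => d d0.
  have /(@cvg_nrP _ _ _ F) := TE x => /(_ d d0) FT.
  have [W [WU WT]] := filter_ex (filterI FU' FT).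
  rewrite (le_trans (nr_triangle (W x) _ _)) // lerD //.
    by rewrite nr_distC ltW.
  rewrite (le_trans (nr_adjop_le (W - U) x)) // ler_wpM2r ?nr_ge0 //.
  by rewrite nr_distC ltW.
have TP : T \in adjointable_pred.
  apply/asboolP; exists S; have [U UT _] := near_le 1 ltr01.
  exists (1 + nr U); split => // x; rewrite -[T x](subrK (U x)) mulrDl.
  by rewrite (le_trans (nrD _ _)) // lerD ?UT ?nr_adjop_le.
apply/cvg_ex; exists (AdjOp TP); apply/(@cvg_nrP _ _ _ F) => e e0.
have e2 : 0 < e / 2 by rewrite divr_gt0.
have [U UT FU] := near_le _ e2; apply: filterS FU => W WU.
rewrite [e](splitr e) (le_lt_trans (nr_triangle U _ _)) //.
rewrite ltr_leD //; first by rewrite nr_distC.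
rewrite nr_adjopE opnorm_le // => [|x]; first exact: ltW.
by rewrite /= nr_distC; exact: UT.
Qed.

HB.instance Definition _ := Uniform_isComplete.Build adjop adjop_cauchy_cvg.

Lemma adjop_mulA : associative adjop_mul.
Proof. by move=> U V W; exact: adjop_inj. Qed.

Lemma adjop_mulDl : left_distributive adjop_mul +%R.
Proof. by move=> U V W; exact: adjop_inj. Qed.

Lemma adjop_mulDr : right_distributive adjop_mul +%R.
Proof. by move=> U V W; apply: adjop_inj => x /=; rewrite adjopD. Qed.

Lemma adjop_mulZl (c : R[i]) U W : adjop_mul (c *: U) W = c *: adjop_mul U W.
Proof. exact: adjop_inj. Qed.

Lemma adjop_mulZr (c : R[i]) U W : adjop_mul U (c *: W) = c *: adjop_mul U W.
Proof. by apply: adjop_inj => x /=; rewrite adjopZ. Qed.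

Lemma adjK : involutive adj.
Proof. by move=> U; apply: adj_eq; exact/adjoint_sym/adjP. Qed.

Lemma adjop_normM U W : `|adjop_mul U W| <= `|U| * `|W|.
Proof. by rewrite !nrE -rmorphM lecR opnormM. Qed.

Lemma adjop_norm_star_mul U : `|adjop_mul (adj U) U| = `|U| ^+ 2.
Proof. by rewrite !nrE nr_adjopE opnorm_star_mul rmorphXn. Qed.

HB.instance Definition _ := CompleteNormedModule_isCstarAlgebra.Build R adjop
  adjop_mulA adjop_mulDl adjop_mulDr adjop_mulZl adjop_mulZr adjK adjD adjZ adjM
  adjop_normM adjop_norm_star_mul.

Lemma adjop_cmulE U W x : (U ** W) x = U (W x).
Proof. by []. Qed.

Lemma cstar_adjE U : cstar U = adj U.
Proof. by []. Qed.

End Adjointable.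

Arguments adjop {R} H.

Section SelfModule.
Variables (R : realType) (X : cstarAlgType R).

Definition self_ip (x y : X) := cstar x ** y.

Lemma self_ipDl x y z : self_ip (x + y) z = self_ip x z + self_ip y z.
Proof. by rewrite /self_ip cstarD cmulDl. Qed.

Lemma self_ipDr x y z : self_ip x (y + z) = self_ip x y + self_ip x z.
Proof. exact: cmulDr. Qed.

Lemma self_ipZl (c : R[i]) x y : self_ip (c *: x) y = (c^*)%R *: self_ip x y.
Proof. by rewrite /self_ip cstarZ cmulZl. Qed.

Lemma self_ipZr (c : R[i]) x y : self_ip x (c *: y) = c *: self_ip x y.
Proof. exact: cmulZr. Qed.

Lemma self_ip_le x y : nr (self_ip x y) <= nr x * nr y.
Proof. by rewrite /self_ip (le_trans (nrM _ _)) // nr_star. Qed.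

Definition self_ipmodule : ipmodule R :=
  IpModule self_ipDl self_ipDr self_ipZl self_ipZr self_ip_le (@nr_star_mul R X).

End SelfModule.

(** * Isometry of injective *-homomorphisms *)

Section Unital.
Variables (R : realType) (M : cstarAlgType R) (one : M).
Hypotheses (mul1 : forall x : M, one ** x = x) (mulx1 : forall x, x ** one = x).
Implicit Types w x y z : M.

Definition comm x y := x ** y = y ** x.

Lemma comm_sym x y : comm x y -> comm y x. Proof. by []. Qed.

Lemma comm1 x : comm one x. Proof. by rewrite /comm mul1 mulx1. Qed.

Lemma commB x y z : comm x z -> comm y z -> comm (x - y) z.
Proof. by rewrite /comm cmulBl cmulBr => -> ->. Qed.

Lemma commM x y z : comm x z -> comm y z -> comm (x ** y) z.
Proof. by rewrite /comm => xz yz; rewrite -cmulA yz cmulA xz cmulA. Qed.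

Lemma commZ (c : R[i]) x y : comm x y -> comm (c *: x) y.
Proof. by rewrite /comm cmulZl cmulZr => ->. Qed.

Lemma star_one : cstar one = one.
Proof. by have := congr1 cstar (mul1 (cstar one)); rewrite cstarM !cstarK mul1. Qed.

(** Only an inequality, because the unit of the zero algebra has norm 0. *)
Lemma nr_one : nr one <= 1.
Proof.
have [/eqP|n0] := eqVneq (nr one) 0; first by move=> /eqP ->.
have n1 : 0 < nr one by rewrite lt_def n0 nr_ge0.
by rewrite -(ler_pM2r n1) mul1r -expr2 -nr_star_mul star_one mul1.
Qed.

(** The square root of [x] when |1 - x| <= 1, by [hrootE] at 1 - x. *)
Definition sroot x := one - hroot (one - x).

Section Sroot.
Variable x : M.
Hypothesis x1 : nr (one - x) <= 1.

Lemma srootE : sroot x ** sroot x = x.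
Proof.
rewrite /sroot; have := hrootE x1; set h := hroot _ => hE.
rewrite cmulBl !cmulBr !mul1 mulx1 opprB; apply: (addIr (h + h)).
by rewrite addrACA !subrK hE addrA [x + _]addrC subrK.
Qed.

Lemma nr_sroot : nr (one - sroot x) <= 1.
Proof. by rewrite /sroot opprB [one + _]addrC subrK nr_hroot. Qed.

Lemma sroot_star : cstar x = x -> cstar (sroot x) = sroot x.
Proof.
by move=> xs; rewrite cstarB star_one hroot_star // cstarB star_one xs.
Qed.

Lemma sroot_comm y : comm x y -> comm (sroot x) y.
Proof.
move=> xy; apply: commB; first exact: comm1.
by apply: hroot_comm => //; apply: commB => //; exact: comm1.
Qed.

End Sroot.

(** The root c of 1 - w^2 commutes with w and c^2 + w^2 = 1, so c is the real part of the unitary c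
    + i w and |c| <= 1; and 1 - w^2 is c^2. This makes [w ** w] itself admissible for [sroot]. *)
Lemma nr_one_sub_sqr w : cstar w = w -> nr w <= 1 -> nr (one - w ** w) <= 1.
Proof.
move=> ws w1; pose x := one - w ** w.
have x1 : nr (one - x) <= 1.
  rewrite /x opprB [one + _]addrC subrK (le_trans (nrM _ _)) //.
  by rewrite mulr_ile1 ?nr_ge0.
have xs : cstar x = x by rewrite cstarB star_one cstarM ws.
have cx : comm x w.
  by apply: commB; [exact: comm1 | exact: commM].
have c1 : nr (sroot x) <= 1.
  apply: le_trans nr_one; apply: (@re_part_le _ _ _ w).
    by rewrite sroot_star // srootE // ws star_one mul1 subrK.
  by rewrite sroot_star // ws; exact: sroot_comm.
by rewrite -/x -(srootE x1) (le_trans (nrM _ _)) // mulr_ile1 ?nr_ge0.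
Qed.

(** The absolute value of a self-adjoint contraction. *)
Definition sabs w := sroot (w ** w).

Section Sabs.
Variable w : M.
Hypotheses (ws : cstar w = w) (w1 : nr w <= 1).

Let w2 := nr_one_sub_sqr ws w1.

Lemma sabsE : sabs w ** sabs w = w ** w. Proof. exact: srootE. Qed.

Lemma nr_sabs : nr (one - sabs w) <= 1. Proof. exact: nr_sroot. Qed.

Lemma sabs_star : cstar (sabs w) = sabs w.
Proof. by apply: sroot_star => //; rewrite cstarM ws. Qed.

Lemma sabs_comm y : comm w y -> comm (sabs w) y.
Proof. by move=> wy; apply: sroot_comm => //; exact: commM. Qed.

End Sabs.

(* The difference d of |c^2| = n^2 and c^2 satisfies c^2 d = - n^2 d, hence
   (c d)^2 + (n d)^2 = 0, a sum of two commuting self-adjoint squares. *)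
Lemma sabs_sqr (c : M) : cstar c = c -> nr (c ** c) <= 1 ->
  sabs (c ** c) = c ** c.
Proof.
move=> cs w1; set w := c ** c; have ws : cstar w = w by rewrite cstarM cs.
pose m := sabs w; pose n := sroot m; pose d := m - w.
have m1 := nr_sabs ws w1; have ms := sabs_star ws w1.
have ns : cstar n = n by exact: sroot_star.
have nn : n ** n = m by exact: srootE.
have cw : comm w c by rewrite /comm /w cmulA.
have mc : comm m c by exact: sabs_comm.
have mw : comm m w by apply: sabs_comm.
have dc : comm d c by exact: commB.
have dw : comm d w by exact: commB.
have dm : comm d m by apply: commB => //; exact: comm_sym.
have nc : comm n c by exact: sroot_comm.
have nd : comm n d by apply: sroot_comm => //; exact: comm_sym.
have ds : cstar d = d by rewrite cstarB ms ws.
have wd : w ** d = - (m ** d).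
  have mm : m ** m = w ** w := sabsE ws w1.
  by rewrite /d (cmulBr w m w) (cmulBr m m w) -mw mm opprB.
have nd0 : n ** d = 0.
  have : nr (n ** d) <= nr (0 : M).
    apply: (@re_part_le _ _ _ (c ** d)).
      rewrite cmulx0 !cstarM ns cs ds -!cmulA.
      rewrite (cmulA n) nn (cmulA c) -/w wd.
      by rewrite cmulxN subrr.
    rewrite !cstarM ns cs ds -!cmulA; congr (_ ** _).
    by rewrite !cmulA nc.
  rewrite nr0 => h; apply/eqP; rewrite -nr_eq0 eq_le nr_ge0 andbT.
  exact: h.
have md : m ** d = 0 by rewrite -nn -cmulA nd0 cmulx0.
have : d = 0.
  apply: star_mul_eq0; rewrite ds /d cmulBl -/d md sub0r wd md !oppr0.
  by [].
by move=> /eqP; rewrite subr_eq0 => /eqP.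
Qed.

End Unital.

(** * Left multiplication as an operator on the algebra *)

Section LeftMultiplier.
Variables (R : realType) (X : cstarAlgType R).

Local Notation M := (adjop (self_ipmodule X)).

Lemma id_adjointable : @id X \in @adjointable_pred R (self_ipmodule X).
Proof.
apply/asboolP; exists id, 1; split=> [x y|x]; last by rewrite mul1r.
by [].
Qed.

Definition idop : M := AdjOp id_adjointable.

Lemma idop_mull (U : M) : idop ** U = U.
Proof. exact: adjop_inj. Qed.

Lemma idop_mulr (U : M) : U ** idop = U.
Proof. exact: adjop_inj. Qed.

Lemma cmul_adjointable (x : X) :
  cmul x \in @adjointable_pred R (self_ipmodule X).
Proof.
apply/asboolP; exists (cmul (cstar x)), (nr x); split=> [y z|y]; last exact: nrM.
by rewrite /= /self_ip !cstarM cstarK !cmulA.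
Qed.

Definition lmul (x : X) : M := AdjOp (cmul_adjointable x).

Lemma lmul_star x : cstar (lmul x) = lmul (cstar x).
Proof.
apply: adj_eq => y z; split; rewrite /= /self_ip cstarM ?cstarK cmulA //.
Qed.

Lemma nr_lmul x : nr (lmul x) <= nr x.
Proof.
by rewrite nr_adjopE opnorm_le ?nr_ge0 // => y; exact: nrM.
Qed.

End LeftMultiplier.
Arguments idop {R X}.

Section Isometric.
Variables (R : realType) (X Y : cstarAlgType R).
Variables (D : set X) (f : X -> Y).
Hypotheses (DD : cstar_subalgebra D) (fh : star_hom_on D f).

Local Notation MX := (adjop (self_ipmodule X)).
Local Notation MY := (adjop (self_ipmodule Y)).

(** Stands in for an extension of [f] to operators: [U] must preserve [D], and [U'] is prescribed
    only on the image of [D]. The relation survives sums, products and limits, hence square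
    roots. *)
Definition intertwines (U : MX) (U' : MY) :=
  forall y, D y -> D (U y) /\ f (U y) = U' (f y).

Lemma intertwinesD U U' W W' : intertwines U U' -> intertwines W W' ->
  intertwines (U + W) (U' + W').
Proof.
move=> h h' y Dy; have [h1 h2] := h y Dy; have [h1' h2'] := h' y Dy.
by split; [exact: subalgD | rewrite (star_homD fh) //= h2 h2'].
Qed.

Lemma intertwinesZ (c : R[i]) U U' : intertwines U U' ->
  intertwines (c *: U) (c *: U').
Proof.
move=> h y Dy; have [h1 h2] := h y Dy.
by split; [exact: subalgZ | rewrite (star_homZ fh) //= h2].
Qed.

Lemma intertwinesB U U' W W' : intertwines U U' -> intertwines W W' ->
  intertwines (U - W) (U' - W').
Proof.
move=> h h'; rewrite -[- W]scaleN1r -[- W']scaleN1r.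
by apply: intertwinesD => //; exact: intertwinesZ.
Qed.

Lemma intertwinesM U U' W W' : intertwines U U' -> intertwines W W' ->
  intertwines (U ** W) (U' ** W').
Proof.
move=> h h' y Dy; have [h1' h2'] := h' y Dy; have [h1 h2] := h _ h1'.
by split; [exact: h1 | rewrite !adjop_cmulE h2 h2'].
Qed.

Lemma intertwines1 : intertwines idop idop.
Proof. by []. Qed.

Lemma intertwines_lmul k : D k -> intertwines (lmul k) (lmul (f k)).
Proof. by move=> Dk y Dy; split; [exact: subalgM | exact: star_homM fh _ _ _ _]. Qed.

(** [f] passes to the limit because it is contractive on [D], by [star_hom_le]. *)
Lemma intertwines_cvg (u : nat -> MX) (u' : nat -> MY) (U : MX) (U' : MY) :
  (forall n, intertwines (u n) (u' n)) -> u @ \oo --> U -> u' @ \oo --> U' ->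
  intertwines U U'.
Proof.
move=> h uU uU' y Dy.
have evX (Z : cstarAlgType R) (z : Z) (v : nat -> adjop (self_ipmodule Z))
      (V : adjop (self_ipmodule Z)) :
    v @ \oo --> V -> (fun n => v n z) @ \oo --> V z.
  apply: (@cvg_lipschitz _ _ _ (fun V : adjop (self_ipmodule Z) => V z) (nr z)).
  by move=> a b; rewrite mulrC; exact: (nr_adjop_le (a - b) z).
have DU : D (U y).
  apply: closed_cvgn (evX _ y _ _ uU); first exact: subalg_closed_top DD.
  by move=> n; have [] := h n y Dy.
split=> //; apply: (@cvg_nr_unique _ _ (fun n => u' n (f y))); last exact: evX.
rewrite -(funext (fun n => (h n y Dy).2)).
apply/cvgn_nrP => e e0; have /cvgn_nrP/(_ e e0)[N hN] := evX _ y _ _ uU.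
exists N => n /hN; apply: le_lt_trans; have [Du _] := h n y Dy.
rewrite -(star_homB DD fh) //; apply: star_hom_le DD fh _ _.
exact: subalgB.
Qed.

Lemma intertwines_hroot U U' : intertwines U U' -> nr U <= 1 -> nr U' <= 1 ->
  intertwines (hroot U) (hroot U').
Proof.
move=> h U1 U'1; apply: intertwines_cvg (cvg_hroot U1) (cvg_hroot U'1).
elim=> [|n ih] /=.
  by move=> y Dy; split; [exact: (subalg0 DD) | rewrite (star_hom0 DD fh)].
by apply: intertwinesZ; apply: intertwinesD => //; exact: intertwinesM.
Qed.

Hypothesis f_inj : forall x, D x -> f x = 0 -> x = 0.

(* Work in the adjointable operators on X and on Y, which have a unit. For a
   multiple w of 1 - k^2, the operator |w| - w is sent by f to |w'| - w', which is
   0 because w' is the square of sqrt (1 - (f k)^2). As f is injective, w = |w|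
   on D, so 1 - k^2 has a square root there and k is the real part of a
   unitary. *)
Lemma star_hom_inj_sa_le1 k : D k -> cstar k = k -> nr (f k) <= 1 -> nr k <= 1.
Proof.
move=> Dk ks fk1; pose K := lmul k; pose L := lmul (f k).
have Ks : cstar K = K by rewrite lmul_star ks.
have Ls : cstar L = L by rewrite lmul_star -(star_hom_star fh) // ks.
have L1 : nr L <= 1 by exact: le_trans (nr_lmul _) fk1.
pose v := idop - K ** K; pose v' := idop - L ** L.
(* Scaling by th^2 brings [w] and [w'] into the unit ball together; the factor is a square so that
   th times the root of [v'] is a self-adjoint root of [w']. *)
pose th := (1 + nr v + nr v')^-1.
have th0 : 0 < 1 + nr v + nr v' by rewrite -addrA ltr_pwDl // addr_ge0 ?nr_ge0.
have th1 : 0 < th by rewrite invr_gt0.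
have thr : (th%:C^*)%R = th%:C by rewrite conj_Creal // complex_real.
have th2r : ((th * th)%:C^*)%R = (th * th)%:C by rewrite conj_Creal // complex_real.
pose w := (th * th)%:C *: v; pose w' := (th * th)%:C *: v'.
have nth (Z : normedModType R[i]) (z : Z) : nr z <= 1 + nr v + nr v' ->
    nr ((th * th)%:C *: z) <= 1.
  move=> h; rewrite nrZr ger0_norm; last by rewrite mulr_ge0 ?ltW.
  rewrite -mulrA; apply: mulr_ile1.
  - exact: ltW.
  - by rewrite mulr_ge0 ?nr_ge0 ?ltW.
  - by rewrite invf_le1 // -addrA lerDl addr_ge0 ?nr_ge0.
  - by rewrite mulrC ler_pdivrMr // mul1r.
have w1 : nr w <= 1.
  by apply: nth; rewrite addrAC lerDr addr_ge0 ?nr_ge0.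
have w'1 : nr w' <= 1 by apply: nth; rewrite lerDr addr_ge0 ?nr_ge0.
have mX := @idop_mull R X; have mY := @idop_mull R Y.
have mX' := @idop_mulr R X; have mY' := @idop_mulr R Y.
have ws : cstar w = w.
  by rewrite cstarZ cstarB cstarM Ks (star_one mX) th2r.
have ww' : intertwines w w'.
  apply: intertwinesZ; apply: intertwinesB; first exact: intertwines1.
  by apply: intertwinesM; exact: intertwines_lmul.
have w's : cstar w' = w'.
  by rewrite cstarZ cstarB cstarM Ls (star_one mY) th2r.
have w'abs : sabs idop w' = w'.
  pose c := th%:C *: sroot idop v'.
  have v'1 : nr (idop - v') <= 1.
    rewrite /v' opprB [idop + _]addrC subrK (le_trans (nrM _ _)) //.
    by rewrite mulr_ile1 ?nr_ge0.
  have v's : cstar v' = v' by rewrite cstarB cstarM Ls (star_one mY).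
  have cE : c ** c = w'.
    by rewrite cmulZl cmulZr scalerA (srootE mY mY' v'1) /w' rmorphM.
  rewrite -cE; apply: sabs_sqr => //; last by rewrite cE.
  by rewrite cstarZ thr (sroot_star mY).
pose m := sabs idop w; pose n := sroot idop m.
have mw' : intertwines m w'.
  rewrite -w'abs /m /sabs /sroot; apply: intertwinesB.
    exact: intertwines1.
  apply: intertwines_hroot.
  - apply: intertwinesB; first exact: intertwines1.
    exact: intertwinesM.
  - exact: nr_one_sub_sqr.
  - exact: nr_one_sub_sqr.
have mE y : D y -> m y = w y.
  move=> Dy; apply/eqP; rewrite -subr_eq0; apply/eqP.
  have [h1 h2] := mw' y Dy; have [h3 h4] := ww' y Dy.
  by apply: f_inj; [exact: subalgB | rewrite (star_homB DD fh) // h2 h4 subrr].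
have m1 : nr (idop - m) <= 1 by exact: nr_sabs.
have ns : cstar n = n by apply: sroot_star => //; exact: sabs_star.
have nK : n ** K = K ** n.
  apply: (sroot_comm mX mX' m1); apply: (sabs_comm mX mX' ws w1).
  apply: commZ; apply: commB; first exact: comm1.
  by rewrite /comm cmulA.
have nnE y : D y -> n (n y) = (th * th)%:C *: (y - k ** (k ** y)).
  by move=> Dy; rewrite -adjop_cmulE (srootE mX mX' m1) mE.
(* On [D], n^2 is th^2 (1 - k^2), so th k y and n y are the two parts in [re_part_le] for th y. *)
have kle y : D y -> nr (k ** y) <= nr y.
  move=> Dy; rewrite -(ler_pM2l th1) -{1 2}(ger0_norm (ltW th1)) -!nrZr.
  apply: (@re_part_le _ _ _ (n y)).
    have -> : cstar (n y) ** n y = cstar y ** n (n y).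
      by have := (adjP n y (n y)).1; rewrite -cstar_adjE ns.
    rewrite nnE // !cstarZ thr !cmulZl !cmulZr !scalerA -rmorphM cstarM ks.
    by rewrite -scalerDr cmulBr !cmulA [X in _ *: X]addrC subrK.
  have -> : cstar (n y) ** (th%:C *: (k ** y)) = cstar y ** n (th%:C *: (k ** y)).
    by have := (adjP n y (th%:C *: (k ** y))).1; rewrite -cstar_adjE ns.
  have -> : n (th%:C *: (k ** y)) = th%:C *: (k ** n y).
    rewrite adjopZ; congr (_ *: _).
    by have := congr1 (fun U : MX => U y) nK; rewrite !adjop_cmulE.
  by rewrite cstarZ thr cmulZl cmulZr cstarM ks cmulA.
have := kle k Dk; have := nr_ge0 k; rewrite le_eqVlt => /predU1P[<- //|k0].
by rewrite -{1}ks nr_star_mul expr2 -[leRHS]mul1r ler_pM2r.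
Qed.

Theorem star_hom_inj_isometric x : D x -> nr (f x) = nr x.
Proof.
move=> Dx; apply/eqP; rewrite eq_le (star_hom_le DD fh) //=.
rewrite -(ler_pXn2r (ltn0Sn 1)) ?nnegrE ?nr_ge0 // -!nr_star_mul.
rewrite -(star_hom_star fh) // -(star_homM fh) //; last exact: subalg_star.
set k := cstar x ** x.
have Dk : D k by apply: subalgM => //; exact: subalg_star.
apply/ler_addgt0Pl => e e0.
have k0 : 0 < e + nr (f k) by rewrite ltr_wpDr ?nr_ge0.
pose c := (e + nr (f k))^-1; have c0 : 0 < c by rewrite invr_gt0.
have : nr (c%:C *: k) <= 1.
  apply: star_hom_inj_sa_le1; first exact: subalgZ.
    by rewrite cstarZ cstarM cstarK conj_Creal // complex_real.
  rewrite (star_homZ fh) // nrZr gtr0_norm // mulrC ler_pdivrMr // mul1r.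
  by rewrite ler_wpDl // ltW.
by rewrite nrZr gtr0_norm // mulrC ler_pdivrMr // mul1r.
Qed.

End Isometric.

(** * The Hilbert space l2 *)

(* [R[i]^o] is not declared as an instance of [Complete], which the library
   already attaches to [R^o] for a [realType]. *)
Section ComplexComplete.
Variable R : realType.

Lemma cabs_nr (z : R[i]^o) : nr z = cabs z. Proof. by []. Qed.

Lemma Re_le_cabs (z : R[i]) : `|complex.Re z| <= cabs z.
Proof. by rewrite -lecR -cabsE normc_ge_Re. Qed.

Lemma Im_le_cabs (z : R[i]) : `|complex.Im z| <= cabs z.
Proof.
have := Re_le_cabs ('i%C * z); rewrite mulrC ReiNIm normrN cabsM.
by rewrite /cabs normc_def /= expr0n expr1n /= add0r sqrtr1 mulr1.
Qed.

Lemma cabs_le_ReIm (z : R[i]) : cabs z <= `|complex.Re z| + `|complex.Im z|.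
Proof.
rewrite {1}[z]complexE -[cabs _]/(nr (_ : R[i]^o)) (le_trans (nrD _ _)) //.
rewrite !cabs_nr cabsM !cabsr lerD // /cabs normc_def /= expr0n expr1n /=.
by rewrite add0r sqrtr1 mul1r.
Qed.

Lemma complex_cauchy_cvg (F : set_system R[i]^o) :
  ProperFilter F -> cauchy F -> cvg F.
Proof.
move=> FF Fc.
have FF' : Filter F by exact: filter_filter.
have part (h : R[i]^o -> R) : (forall x y, `|h x - h y| <= nr (x - y)) ->
    exists l : R, forall e : R, 0 < e -> \forall z \near F, `|h z - l| < e.
  move=> hL; have : cvg (h @ F).
    apply: cauchy_cvg; apply/cauchyP => e e0.
    have ec : 0 < e%:C by rewrite ltcR.
    have /cauchyP/(_ _ ec)[x Fx] := Fc; exists (h x).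
    change (F [set y | ball (h x) e (h y)]); apply: filterS Fx => y.
    rewrite -!ball_normE /= nrE ltcR; exact: le_lt_trans.
  move=> /cvg_ex[l /cvgrPdist_lt hl]; exists l => e /hl.
  by apply: filterS => z /=; rewrite distrC.
have ReL (x y : R[i]^o) : `|complex.Re x - complex.Re y| <= nr (x - y).
  by case: x y => [x1 x2] [y1 y2]; exact: (Re_le_cabs ((x1 +i* x2) - (y1 +i* y2))).
have ImL (x y : R[i]^o) : `|complex.Im x - complex.Im y| <= nr (x - y).
  by case: x y => [x1 x2] [y1 y2]; exact: (Im_le_cabs ((x1 +i* x2) - (y1 +i* y2))).
have [a ha] := part _ ReL.
have [b hb] := part _ ImL.
apply/cvg_ex; exists (a +i* b : R[i]^o); apply/(@cvg_nrP _ _ _ F) => e e0.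
have e2 : 0 < e / 2 by rewrite divr_gt0.
apply: filterS (filterI (ha _ e2) (hb _ e2)) => -[x y] [/= hx hy].
by rewrite cabs_nr (le_lt_trans (cabs_le_ReIm _)) // [e]splitr ltrD.
Qed.

End ComplexComplete.

Section SquareSummable.
Variables (R : realType) (I : choiceType).
Implicit Types (f g : I -> R[i]) (F G : {fset I}).

Definition sqsum f F : R := \sum_(i <- F) cabs (f i) ^+ 2.

Definition l2bounded f (M : R) := forall F, sqsum f F <= M.

Definition sqsums f : set R := [set sqsum f F | F in setT].

(** For an unbounded [f] the supremum has a default value, so lower estimates of [l2norm] carry an
    [l2bounded] hypothesis. *)
Definition l2norm f : R := Num.sqrt (sup (sqsums f)).

Lemma sqsum_ge0 f F : 0 <= sqsum f F.
Proof. by apply: sumr_ge0 => i _; rewrite sqr_ge0. Qed.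

Lemma l2norm_ge0 f : 0 <= l2norm f. Proof. exact: sqrtr_ge0. Qed.

Lemma l2norm_le f M : 0 <= M -> l2bounded f (M ^+ 2) -> l2norm f <= M.
Proof.
move=> M0 fM; rewrite -(ger0_norm M0) -sqrtr_sqr ler_sqrt ?sqr_ge0 //.
apply: ge_sup; first by exists (sqsum f fset0), fset0.
by move=> _ [F _ <-].
Qed.

Lemma sqsum_le f M F : l2bounded f M -> sqsum f F <= l2norm f ^+ 2.
Proof.
move=> fM; have h G : sqsum f G <= sup (sqsums f).
  by apply: ub_le_sup; [exists M => _ [G' _ <-] | exists G].
by rewrite sqr_sqrtr // (le_trans (sqsum_ge0 f F)).
Qed.

Lemma sqrt_sqsum_le f M F : l2bounded f M -> Num.sqrt (sqsum f F) <= l2norm f.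
Proof.
move=> fM; rewrite -[leRHS]ger0_norm ?l2norm_ge0 // -sqrtr_sqr.
by rewrite ler_wsqrtr // (sqsum_le F fM).
Qed.

Lemma coord_le f M i : l2bounded f M -> cabs (f i) <= l2norm f.
Proof.
move=> fM; rewrite -(ler_pXn2r (ltn0Sn 1)) ?nnegrE ?cabs_ge0 ?l2norm_ge0 //.
by have := sqsum_le [fset i]%fset fM; rewrite /sqsum big_seq_fset1.
Qed.

Lemma cauchy_schwarz_seq (l : seq I) (a b : I -> R) :
  (forall i, 0 <= a i) -> (forall i, 0 <= b i) ->
  \sum_(i <- l) a i * b i <=
  Num.sqrt (\sum_(i <- l) a i ^+ 2) * Num.sqrt (\sum_(i <- l) b i ^+ 2).
Proof.
move=> a0 b0; elim: l => [|i l ih]; first by rewrite !big_nil sqrtr0 mul0r.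
rewrite !big_cons.
set S := \sum_(j <- l) _ in ih *; set P := \sum_(j <- l) a j ^+ 2 in ih *.
set Q := \sum_(j <- l) b j ^+ 2 in ih *.
have P0 : 0 <= P by apply: sumr_ge0 => j _; rewrite sqr_ge0.
have Q0 : 0 <= Q by apply: sumr_ge0 => j _; rewrite sqr_ge0.
have := sqr_sqrtr P0; have := sqr_sqrtr Q0; move: ih.
have := sqrtr_ge0 P; have := sqrtr_ge0 Q.
move: (Num.sqrt P) (Num.sqrt Q) => p q q0 p0 ih qE pE.
rewrite -sqrtrM ?addr_ge0 ?sqr_ge0 // (le_trans (lerD (lexx _) ih)) //.
have h0 : 0 <= a i * b i + p * q by rewrite addr_ge0 ?mulr_ge0.
rewrite -[leLHS]ger0_norm // -sqrtr_sqr ler_wsqrtr // -pE -qE.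
rewrite -subr_ge0 [leRHS](_ : _ = (a i * q - p * b i) ^+ 2) ?sqr_ge0 //.
by ring.
Qed.

Lemma l2_cauchy_schwarz f g M N F : l2bounded f M -> l2bounded g N ->
  \sum_(i <- F) cabs (f i) * cabs (g i) <= l2norm f * l2norm g.
Proof.
move=> fM gN.
apply: le_trans (cauchy_schwarz_seq _ _ _) _ => [i|i|]; try exact: cabs_ge0.
by rewrite ler_pM ?sqrtr_ge0 ?(sqrt_sqsum_le _ fM) ?(sqrt_sqsum_le _ gN).
Qed.

Lemma cabsD (z w : R[i]) : cabs (z + w) <= cabs z + cabs w.
Proof. exact: (nrD (z : R[i]^o) w). Qed.

Lemma l2boundedD f g M N : l2bounded f M -> l2bounded g N ->
  l2bounded (f + g) ((l2norm f + l2norm g) ^+ 2).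
Proof.
move=> fM gN F.
have : sqsum (f + g) F <= sqsum f F + (\sum_(i <- F) cabs (f i) * cabs (g i)) *+ 2
    + sqsum g F.
  rewrite -sumrMnl -!big_split; apply: ler_sum => i _ /=.
  by rewrite -sqrrD ler_pXn2r ?nnegrE ?addr_ge0 ?cabs_ge0 // cabsD.
move=> /le_trans; apply; rewrite sqrrD lerD ?(sqsum_le _ gN) //.
by rewrite lerD ?(sqsum_le _ fM) // lerMn2r (l2_cauchy_schwarz _ fM gN).
Qed.

Lemma l2boundedZ (c : R[i]) f M : l2bounded f M ->
  l2bounded (c *: f) ((cabs c * l2norm f) ^+ 2).
Proof.
move=> fM F; rewrite exprMn.
have -> : sqsum (c *: f) F = cabs c ^+ 2 * sqsum f F.
  by rewrite /sqsum mulr_sumr; apply: eq_bigr => i _; rewrite -exprMn -cabsM.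
by rewrite ler_wpM2l ?sqr_ge0 ?(sqsum_le _ fM).
Qed.

Definition l2_pred : {pred (I -> R[i])} := fun f => `[< exists M, l2bounded f M >].

Lemma l2_submod : submod_closed l2_pred.
Proof.
split.
  apply/asboolP; exists 0 => F; rewrite /sqsum big1 // => i _.
  by rewrite cabs0 expr0n.
move=> c f g /asboolP[M fM] /asboolP[N gN]; apply/asboolP.
by eexists; exact: l2boundedD (l2boundedZ c fM) gN.
Qed.

Record l2 := L2 { l2fun :> I -> R[i]; _ : l2fun \in l2_pred }.

HB.instance Definition _ := [isSub for l2fun].
HB.instance Definition _ := [Choice of l2 by <:].
HB.instance Definition _ := GRing.isSubmodClosed.Build _ _ l2_pred l2_submod.
HB.instance Definition _ := [SubChoice_isSubLmodule of l2 by <:].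

Lemma l2P (f : l2) : exists M, l2bounded f M.
Proof. by case: f => f /= /asboolP. Qed.

Lemma l2_eq (f g : l2) : (forall i, f i = g i) -> f = g.
Proof. by move=> h; apply: val_inj; exact: funext. Qed.

Definition l2_norm (f : l2) : R[i] := (l2norm f)%:C.

Lemma l2_normD (f g : l2) : l2_norm (f + g) <= l2_norm f + l2_norm g.
Proof.
rewrite /l2_norm -rmorphD lecR; have [M fM] := l2P f; have [N gN] := l2P g.
by apply: l2norm_le (l2boundedD fM gN); rewrite addr_ge0 ?l2norm_ge0.
Qed.

Lemma l2_norm_eq0 (f : l2) : l2_norm f = 0 -> f = 0.
Proof.
case=> f0; apply: l2_eq => i; have [M fM] := l2P f; apply/eqP.
by rewrite -cabs_eq0 eq_le cabs_ge0 andbT -f0 (coord_le i fM).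
Qed.

Lemma l2_normZ (c : R[i]) (f : l2) : l2_norm (c *: f) = `|c| * l2_norm f.
Proof.
have le (d : R[i]) (g : l2) : l2norm (d *: g) <= cabs d * l2norm g.
  have [M gM] := l2P g; apply: l2norm_le (l2boundedZ d gM).
  by rewrite mulr_ge0 ?cabs_ge0 ?l2norm_ge0.
rewrite /l2_norm cabsE -rmorphM; congr (_%:C).
have [->|c0] := eqVneq c 0.
  have [M fM] := l2P f; rewrite cabs0 mul0r; apply/eqP.
  rewrite eq_le l2norm_ge0 andbT; apply: l2norm_le => // F.
  by rewrite expr0n /sqsum big1 // => i _; rewrite scale0r cabs0 expr0n.
apply/eqP; rewrite eq_le le /=; have cp : 0 < cabs c.
  by rewrite lt_def cabs_ge0 cabs_eq0 c0.
rewrite -ler_pdivlMl // -[f in leLHS](scalerK c0) (le_trans (le _ _)) //.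
by rewrite ler_wpM2r ?l2norm_ge0 // -(ler_pM2l cp) -cabsM !mulfV ?cabs1 // gt_eqF.
Qed.

HB.instance Definition _ := Lmodule_isNormed.Build R[i] l2
  l2_normD l2_normZ l2_norm_eq0.

Lemma nr_l2E (f : l2) : nr f = l2norm f. Proof. by []. Qed.

Lemma l2_coord_le (f : l2) i : cabs (f i) <= nr f.
Proof. by have [M fM] := l2P f; exact: coord_le fM. Qed.

(** The limit is coordinatewise. Bounds over a finite index set pass to it, uniformly in the set,
    which gives both membership in l2 and convergence in norm. *)
Lemma l2_cauchy_cvg (Fl : set_system l2) :
  ProperFilter Fl -> cauchy Fl -> cvg Fl.
Proof.
move=> FF Fc; have FF' : Filter Fl by exact: filter_filter.
have evL i (f g : l2) : nr ((f i : R[i]^o) - g i) <= 1 * nr (f - g).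
  by rewrite mul1r; exact: l2_coord_le (f - g) i.
have /choice[u uE] i := cauchy_lipschitz FF (@complex_cauchy_cvg R) (evL i) Fc.
have near_le (e : R) : 0 < e -> exists2 f : l2,
    l2bounded (fun i => u i - f i) (e ^+ 2) & \forall g \near Fl, nr (f - g) < e.
  move=> e0; have ec : 0 < e%:C by rewrite ltcR.
  have /cauchyP/(_ _ ec)[f Ff] := Fc.
  have Ff' : \forall g \near Fl, nr (f - g) < e.
    by apply: filterS Ff => g; rewrite -ball_normE /= nrE ltcR.
  exists f => // F; have ev i : (cabs (g i - f i) ^+ 2) @[g --> Fl] -->
      cabs (u i - f i) ^+ 2.
    have uf : cabs (g i - f i) @[g --> Fl] --> cabs (u i - f i).
      apply/cvgrPdist_lt => d d0.
      have /(@cvg_nrP _ _ _ Fl)/(_ d d0) := uE i; apply: filterS => g.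
      apply: le_lt_trans; rewrite cabs_nr.
      have le (z w : R[i]) : cabs z - cabs w <= cabs (z - w).
        by rewrite lerBlDr -[z in leLHS](subrK w) cabsD.
      rewrite ler_norml; apply/andP; split; last first.
        apply: le_trans (le _ _) _; rewrite opprB addrA subrK.
        by rewrite -[u i - g i]opprB -cabs_nr nrN.
      rewrite lerNl opprB; apply: le_trans (le _ _) _.
      by rewrite opprB addrA subrK.
    by rewrite expr2; under eq_fun do rewrite expr2; exact: cvgM.
  have cv : sqsum (fun i => g i - f i) F @[g --> Fl] -->
      sqsum (fun i => u i - f i) F.
    by apply: cvg_big => [|i _]; [exact: add_continuous | exact: ev].
  apply: cvgr_to_le cv _; apply: filterS Ff' => g fg.
  have [M gM] := l2P (g - f); rewrite (le_trans (sqsum_le F gM)) //.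
  rewrite ler_pXn2r ?nnegrE ?l2norm_ge0 ?(ltW e0) // -nr_l2E nr_distC.
  exact: ltW.
have uP : u \in l2_pred.
  apply/asboolP; have [f uf _] := near_le 1 ltr01; have [M fM] := l2P f.
  eexists; have := l2boundedD uf fM; congr (l2bounded _ _).
  by apply/funext => i /=; rewrite /GRing.add /= subrK.
apply/cvg_ex; exists (L2 uP); apply/(@cvg_nrP _ _ _ Fl) => e e0.
have e2 : 0 < e / 2 by rewrite divr_gt0.
have [f uf Ff] := near_le _ e2; apply: filterS Ff => g fg.
rewrite [e]splitr (le_lt_trans (nr_triangle f _ _)) //.
rewrite ltr_leD //; first by rewrite nr_distC.
by rewrite nr_distC nr_l2E; apply: l2norm_le uf; exact: ltW.
Qed.

HB.instance Definition _ := Uniform_isComplete.Build l2 l2_cauchy_cvg.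

Definition has_sum (u : I -> R[i]) (l : R[i]) :=
  forall e : R, 0 < e -> exists A : {fset I}, forall B : {fset I},
    (A `<=` B)%fset -> cabs (\sum_(i <- B) u i - l) < e.

Lemma has_sum_uniq u l l' : has_sum u l -> has_sum u l' -> l = l'.
Proof.
move=> ul ul'; apply/eqP; rewrite -subr_eq0; apply/eqP.
apply: (@nr_eq0_eps _ R[i]^o) => e e0.
have e2 : 0 < e / 2 by rewrite divr_gt0.
have [A hA] := ul _ e2; have [A' hA'] := ul' _ e2.
have := hA _ (fsubsetUl A A'); have := hA' _ (fsubsetUr A A').
move: (\sum_(_ <- _) _) => z; rewrite -!cabs_nr => h' h.
rewrite (le_trans (@nr_triangle _ R[i]^o z _ _)) // [e]splitr lerD // ltW //.
by rewrite nr_distC.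
Qed.

Lemma has_sumD u v l m : has_sum u l -> has_sum v m ->
  has_sum (fun i => u i + v i) (l + m).
Proof.
move=> ul vm e e0; have e2 : 0 < e / 2 by rewrite divr_gt0.
have [A hA] := ul _ e2; have [A' hA'] := vm _ e2.
exists (A `|` A')%fset => B; rewrite fsubUset => /andP[/hA h /hA' h'].
by rewrite big_split /= opprD addrACA (le_lt_trans (cabsD _ _)) // [e]splitr ltrD.
Qed.

Lemma has_sumZ (c : R[i]) u l : has_sum u l -> has_sum (fun i => c * u i) (c * l).
Proof.
move=> ul e e0; have c1 : 0 < cabs c + 1 by rewrite ltr_wpDl ?cabs_ge0.
have [|A hA] := ul (e / (cabs c + 1)); first by rewrite divr_gt0.
exists A => B /hA; rewrite ltr_pdivlMr // -mulr_sumr -mulrBr cabsM.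
by apply: le_lt_trans; rewrite mulrC ler_wpM2l ?cabs_ge0 // lerDl.
Qed.

Lemma has_sum_le u l M : has_sum u l ->
  (forall F, cabs (\sum_(i <- F) u i) <= M) -> cabs l <= M.
Proof.
move=> ul uM; apply/ler_addgt0Pl => e /ul[A /(_ A (fsubset_refl A)) h].
rewrite -cabs_nr -[l](subrK (\sum_(i <- A) u i)) (le_trans (nrD _ _)) //.
by rewrite lerD ?uM // nr_distC ltW.
Qed.

Lemma has_sum_sqr (f : l2) : has_sum (fun i => (cabs (f i) ^+ 2)%:C) (nr f ^+ 2)%:C.
Proof.
move=> e e0; have [M fM] := l2P f.
have ub : has_sup (sqsums f).
  by split; [exists (sqsum f fset0), fset0 | exists M => _ [F _ <-]].
have [_ [A _ <-] hA] := sup_adherent e0 ub.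
exists A => B AB; rewrite -rmorph_sum -rmorphB cabsr /= -[\sum_(i <- B) _]/(sqsum f B).
have BS := sqsum_le B fM.
rewrite nr_l2E distrC ger0_norm ?subr_ge0 // ltrBlDl -ltrBlDr.
rewrite /l2norm sqr_sqrtr; last first.
  by rewrite (le_trans (sqsum_ge0 f B)) // ub_le_sup //; [case: ub | exists B].
apply: lt_le_trans hA _; rewrite /sqsum [leRHS](big_fsetID _ (mem A)) /=.
have -> : [fset x in B | x \in A]%fset = A.
  apply/fsetP => i; rewrite !inE /= andbC; case: (boolP (i \in A)) => //= iA.
  exact: fsubsetP AB _ iA.
by rewrite lerDl sumr_ge0 // => i _; rewrite sqr_ge0.
Qed.

(** Reduces the summability of inner products to that of squares, whose finite partial sums are
    monotone and bounded. *)
Lemma polarization (z w : R[i]) : z^* * w = 4^-1%:C *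
  ((cabs (z + w) ^+ 2)%:C - (cabs (z - w) ^+ 2)%:C
   + 'i%C * ((cabs (z - 'i%C * w) ^+ 2)%:C - (cabs (z + 'i%C * w) ^+ 2)%:C)).
Proof.
have sq (x : R[i]) : cabs x ^+ 2 = complex.Re x ^+ 2 + complex.Im x ^+ 2.
  by rewrite /cabs normc_def /= sqr_sqrtr // addr_ge0 ?sqr_ge0.
rewrite !sq; case: z w => [a b] [c d] /=; simpc; apply/eqP.
rewrite eq_complex /=; apply/andP; split; apply/eqP; by field.
Qed.

Lemma has_sumB u v l m : has_sum u l -> has_sum v m ->
  has_sum (fun i => u i - v i) (l - m).
Proof.
move=> ul vm; rewrite -mulN1r.
under [fun i => _]funext do rewrite -mulN1r.
by apply: has_sumD => //; exact: has_sumZ.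
Qed.

Lemma l2_has_sum (f g : l2) : exists l, has_sum (fun i => (f i)^* * g i) l.
Proof.
have h (c : R[i]) := has_sum_sqr (f + c *: g).
have h1 : has_sum (fun i => (cabs (f i + g i) ^+ 2)%:C) (nr (f + g) ^+ 2)%:C.
  exact: has_sum_sqr (f + g).
have h2 : has_sum (fun i => (cabs (f i - g i) ^+ 2)%:C) (nr (f - g) ^+ 2)%:C.
  exact: has_sum_sqr (f - g).
have h3 : has_sum (fun i => (cabs (f i - 'i%C * g i) ^+ 2)%:C)
    (nr (f - 'i%C *: g) ^+ 2)%:C.
  exact: has_sum_sqr (f - 'i%C *: g).
have h4 : has_sum (fun i => (cabs (f i + 'i%C * g i) ^+ 2)%:C)
    (nr (f + 'i%C *: g) ^+ 2)%:C.
  exact: has_sum_sqr (f + 'i%C *: g).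
rewrite (funext (fun i => polarization (f i) (g i))); eexists.
apply: has_sumZ; apply: has_sumD; first exact: has_sumB h1 h2.
by apply: has_sumZ; exact: has_sumB h3 h4.
Qed.

Definition l2_ip (f g : l2) : R[i]^o := projT1 (cid (l2_has_sum f g)).

Lemma l2_ipP (f g : l2) : has_sum (fun i => (f i)^* * g i) (l2_ip f g).
Proof. by rewrite /l2_ip; case: cid. Qed.

Lemma l2_ip_eq (f g : l2) l : has_sum (fun i => (f i)^* * g i) l -> l2_ip f g = l.
Proof. exact: has_sum_uniq (l2_ipP f g). Qed.

Lemma l2_ipDl (f g h : l2) : l2_ip (f + g) h = l2_ip f h + l2_ip g h.
Proof.
apply: l2_ip_eq; have := has_sumD (l2_ipP f h) (l2_ipP g h).
by under eq_fun do rewrite -mulrDl -rmorphD.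
Qed.

Lemma l2_ipDr (f g h : l2) : l2_ip f (g + h) = l2_ip f g + l2_ip f h.
Proof.
apply: l2_ip_eq; have := has_sumD (l2_ipP f g) (l2_ipP f h).
by under eq_fun do rewrite -mulrDr.
Qed.

Lemma l2_ipZl (c : R[i]) (f g : l2) : l2_ip (c *: f) g = (c^*)%R *: l2_ip f g.
Proof.
apply: l2_ip_eq; have := has_sumZ (c^*) (l2_ipP f g).
by under eq_fun do rewrite mulrA -rmorphM.
Qed.

Lemma l2_ipZr (c : R[i]) (f g : l2) : l2_ip f (c *: g) = c *: l2_ip f g.
Proof.
apply: l2_ip_eq; have := has_sumZ c (l2_ipP f g).
by under eq_fun do rewrite mulrCA.
Qed.

Lemma l2_ip_le (f g : l2) : nr (l2_ip f g) <= nr f * nr g.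
Proof.
rewrite cabs_nr; apply: has_sum_le (l2_ipP f g) _ => F.
have [M fM] := l2P f; have [N gN] := l2P g.
apply: le_trans (l2_cauchy_schwarz F fM gN).
rewrite -[cabs _]/(nr (_ : R[i]^o)) (le_trans (nr_sum _ _ _)) //.
by apply: ler_sum => i _; rewrite cabs_nr cabsM cabsJ.
Qed.

Lemma l2_ip_self (f : l2) : nr (l2_ip f f) = nr f ^+ 2.
Proof.
rewrite (@l2_ip_eq f f (nr f ^+ 2)%:C) ?cabs_nr ?cabsr ?ger0_norm ?sqr_ge0 //.
have := has_sum_sqr f; congr (has_sum _ _); apply/funext => i.
by rewrite rmorphXn /= -cabsE normCK mulrC.
Qed.

Definition l2_ipmodule : ipmodule R :=
  IpModule l2_ipDl l2_ipDr l2_ipZl l2_ipZr l2_ip_le l2_ip_self.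

(* The partial bijection [sg] from [P] onto [Q], with inverse [ta]. *)
Section PartialBijection.
Variables (P Q : pred I) (sg ta : I -> I).
Hypothesis PQ : forall i, P i -> Q (sg i) /\ ta (sg i) = i.
Hypothesis QP : forall j, Q j -> P (ta j) /\ sg (ta j) = j.

Definition pb_fun (f : I -> R[i]) i : R[i] := if P i then f (sg i) else 0.

Lemma pb_image_sum (T : nmodType) (F : {fset I}) (u : I -> T) :
  \sum_(i <- F | P i) u (sg i) =
  \sum_(j <- (sg @` [fset i in F | P i])%fset) u j.
Proof.
rewrite big_imfset /=; last first.
  move=> i j; rewrite !inE /= => /andP[_ /PQ[_ ei]] /andP[_ /PQ[_ ej]] e.
  by rewrite -ei e ej.
exact: big_fset_condE.
Qed.

Lemma pb_bounded (f : l2) : l2bounded (pb_fun f) (nr f ^+ 2).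
Proof.
move=> F; have [M fM] := l2P f; apply: le_trans (sqsum_le (sg @` [fset i in F | P i])%fset fM).
rewrite /sqsum -pb_image_sum [leRHS]big_mkcond /=; apply: ler_sum => i _.
by rewrite /pb_fun; case: ifP => // _; rewrite cabs0 expr0n.
Qed.

Lemma pb_pred (f : l2) : pb_fun f \in l2_pred.
Proof. by apply/asboolP; eexists; exact: pb_bounded. Qed.

Definition pb_map (f : l2) : l2 := L2 (pb_pred f).

Lemma nr_pb_map (f : l2) : nr (pb_map f) <= nr f.
Proof. by rewrite nr_l2E; apply: l2norm_le (pb_bounded f); exact: nr_ge0. Qed.

Lemma has_sum_pb (h : I -> R[i]) l : (forall j, ~~ Q j -> h j = 0) ->
  has_sum h l -> has_sum (pb_fun h) l.
Proof.
(* An index of [A] outside the image of [B] is not in [Q], so [h] vanishes there, and the sum over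
   [B] equals a sum of [h] over a set that contains [A]. *)
move=> h0 hl e /hl[A hA]; exists (ta @` [fset j in A | Q j])%fset => B AB.
pose B' := (sg @` [fset i in B | P i])%fset.
have -> : \sum_(i <- B) pb_fun h i = \sum_(j <- (A `|` B')%fset) h j.
  rewrite -big_mkcond /= (pb_image_sum B h); apply: big_fset_incl.
    exact: fsubsetUr.
  move=> j; rewrite inE => /orP[jA jB|jB /negP[]//]; apply: h0.
  apply: contraNN jB => Qj; have [Pj ej] := QP Qj.
  apply/imfsetP; exists (ta j) => //=; rewrite !inE Pj andbT.
  apply: (fsubsetP AB); apply/imfsetP; exists j => //=.
  by rewrite !inE jA.
by apply: hA; exact: fsubsetUl.
Qed.

End PartialBijection.

Section PartialBijectionOperator.
Variables (P Q : pred I) (sg ta : I -> I).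
Hypothesis PQ : forall i, P i -> Q (sg i) /\ ta (sg i) = i.
Hypothesis QP : forall j, Q j -> P (ta j) /\ sg (ta j) = j.

Lemma pb_ip (f g : l2) :
  l2_ip (pb_map PQ f) g = l2_ip f (pb_map QP g).
Proof.
apply: l2_ip_eq.
have h0 j : ~~ Q j -> (f j)^* * (pb_map QP g) j = 0.
  by move=> /negbTE Qj; rewrite /= /pb_fun Qj mulr0.
have := has_sum_pb PQ QP h0 (l2_ipP f (pb_map QP g)); congr (has_sum _ _).
apply/funext => i; rewrite /= /pb_fun; case: ifP => Pi; last by rewrite conjC0 mul0r.
by have [-> ->] := PQ Pi.
Qed.

Lemma l2_ipC (f g : l2) : l2_ip f g = ((l2_ip g f : R[i])^*).
Proof.
apply: l2_ip_eq => e /(l2_ipP g f)[A hA]; exists A => B /hA.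
rewrite -[cabs (_ - l2_ip g f)]cabsJ rmorphB /= rmorph_sum.
congr (cabs (_ - _) < e); apply: eq_bigr => i _.
by rewrite rmorphM /= conjCK mulrC.
Qed.

Lemma pb_adjoint : @is_adjoint R l2_ipmodule (pb_map PQ) (pb_map QP).
Proof.
move=> f g; split; first exact: pb_ip.
by rewrite /= l2_ipC -pb_ip -l2_ipC.
Qed.

Lemma pb_adjointable : pb_map PQ \in @adjointable_pred R l2_ipmodule.
Proof.
apply/asboolP; exists (pb_map QP), 1; split; first exact: pb_adjoint.
by move=> f; rewrite mul1r nr_pb_map.
Qed.

Definition pbop : adjop l2_ipmodule := AdjOp pb_adjointable.

End PartialBijectionOperator.

Lemma cstar_pbop (P Q : pred I) sg ta (PQ : forall i : I, P i -> Q (sg i) /\ ta (sg i) = i)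
    (QP : forall j : I, Q j -> P (ta j) /\ sg (ta j) = j) :
  cstar (pbop PQ QP) = pbop QP PQ.
Proof. by apply: adj_eq; exact: pb_adjoint. Qed.

Lemma delta_pred j : (fun i => (i == j)%:R : R[i]) \in l2_pred.
Proof.
apply/asboolP; exists 1 => F; rewrite /sqsum.
have [jF|jF] := boolP (j \in F).
  rewrite (big_fsetD1 j) //= eqxx cabs1 expr1n big1_fset ?addr0 // => i.
  by rewrite !inE => /andP[/negbTE-> _] _; rewrite cabs0 expr0n.
rewrite big1_fset // => i iF _; case: eqP => [e|_]; last by rewrite cabs0 expr0n.
by rewrite -e iF in jF.
Qed.

Definition delta j : l2 := L2 (delta_pred j).

End SquareSummable.
Arguments l2_ipmodule : clear implicits.

(** * Boundary paths *)

Section LabelledSpace.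
Variables (Al : countType) (E : digraph) (L : edge E -> Al).
Variable B : set (set (vertex E)).
Hypotheses (L_surj : forall a, exists e, L e = a)
  (B_acc : accommodating L B) (B_norm : normal_collection B)
  (B_wlr : weakly_left_resolving L B).
Implicit Types (A : set (vertex E)) (a : Al).

Definition rA A a := rel_range L A [:: a].

Definition ra a := wrange L [:: a].

Lemma rAP A a v :
  rA A a v <-> exists e, [/\ L e = a, A (esource e) & erange e = v].
Proof.
split=> [[[e l le] [/= + Ae ev]]|[e [La Ae ev]]].
  by case: l le Ae ev => [|e' l] le //= Ae ev [La]; exists e; split.
exists (@GPath E e [::] I); split=> //=.
by rewrite /plabel /= La.
Qed.

Lemma raP a v : ra a v <-> exists e, L e = a /\ erange e = v.
Proof.
split=> [[[e l le] [/= + ev]]|[e [La ev]]].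
  by case: l le ev => [|e' l] le //= ev [La]; exists e.
exists (@GPath E e [::] I); split=> //=.
by rewrite /plabel /= La.
Qed.

Lemma word1 a : labelled_words L [:: a].
Proof.
have [e Le] := L_surj a; exists (@GPath E e [::] I) => //.
by rewrite /plabel /= Le.
Qed.

Lemma B_ra a : B (ra a).
Proof. exact: accom_wrange B_acc _ (word1 a). Qed.

Lemma B_rA A a : B A -> B (rA A a).
Proof. by move=> BA; exact: accom_rel_range B_acc _ _ BA (word1 a). Qed.

Lemma rA_setI A A' a : B A -> B A' -> rA (A `&` A') a = rA A a `&` rA A' a.
Proof. by move=> BA BA'; rewrite /rA (B_wlr BA BA' (word1 a)). Qed.

Lemma rA_setU A A' a : rA (A `|` A') a = rA A a `|` rA A' a.
Proof.
apply/seteqP; split=> v.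
  move=> /rAP[e [La [Ae|Ae] ev]]; [left|right]; apply/rAP; exists e; by split.
by case=> /rAP[e [La Ae ev]]; apply/rAP; exists e; split=> //; [left|right].
Qed.

Lemma rA_set0 a : rA set0 a = set0.
Proof. by apply/seteqP; split=> v // /rAP[e []]. Qed.

Lemma rA_subset A A' a : A `<=` A' -> rA A a `<=` rA A' a.
Proof. by move=> AA' v /rAP[e [La Ae ev]]; apply/rAP; exists e; split=> //; exact: AA'. Qed.

Lemma rA_sub_ra A a : rA A a `<=` ra a.
Proof. by move=> v /rAP[e [La Ae ev]]; apply/raP; exists e. Qed.

Lemma rA_out A a : rA A a !=set0 -> out_labels L A a.
Proof. by move=> [v /rAP[e [La Ae _]]]; exists e. Qed.

Lemma out_rA A a : out_labels L A a -> rA A a !=set0.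
Proof. by move=> [e Ae La]; exists (erange e); apply/rAP; exists e. Qed.

(** The sets to which [rep_sum] applies. *)
Definition regular A := [/\ B A, finite_set (out_labels L A)
  & forall A', B A' -> A' `<=` @sinks E -> A `&` A' = set0].

Record prime_filter (chi : set (set (vertex E))) : Prop := PrimeFilter {
  pf_sub : chi `<=` B;
  pf_set0 : ~ chi set0;
  pf_setI : forall A A', chi A -> chi A' -> chi (A `&` A');
  pf_up : forall A A', chi A -> B A' -> A `<=` A' -> chi A';
  pf_prime : forall A A', B A -> B A' -> chi (A `|` A') -> chi A \/ chi A'
}.

Definition pullback a (chi : set (set (vertex E))) : set (set (vertex E)) :=
  [set A | B A /\ chi (rA A a)].

(** Weak left-resolution is what makes the pullback closed under intersections. *)
Lemma prime_filter_pullback a chi : prime_filter chi -> prime_filter (pullback a chi).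
Proof.
move=> chiP; split.
- by move=> A [].
- by move=> [_]; rewrite rA_set0; exact: pf_set0.
- move=> A A' [BA cA] [BA' cA']; split; first exact: (accom_setI B_acc).
  by rewrite rA_setI //; exact: pf_setI.
- move=> A A' [BA cA] BA' AA'; split=> //.
  by apply: pf_up cA _ _ => //; [exact: B_rA | exact: rA_subset].
- move=> A A' BA BA' [_]; rewrite rA_setU => /(pf_prime chiP).
  by case; [exact: B_rA | exact: B_rA | left | right].
Qed.

Lemma prime_filter_principal v : prime_filter [set A | B A /\ A v].
Proof.
split=> //.
- by move=> A [].
- by case.
- by move=> A A' [BA Av] [BA' Av']; split=> //; exact: (accom_setI B_acc).
- by move=> A A' [BA Av] BA' AA'; split=> //; exact: AA'.
- by move=> A A' BA BA' [_ [Av|Av]]; [left|right].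
Qed.

(** If every label failed, each of the finitely many labels leaving [A0] would be excluded by some
    member of [chi]. The intersection of these members with [A0] would belong to [chi] and consist
    of sinks, hence be empty by regularity. *)
Lemma prime_filter_label chi A0 : prime_filter chi -> chi A0 -> regular A0 ->
  exists a, forall A, chi A -> rA A a !=set0.
Proof.
move=> chiP cA0 [BA0 /finite_seqP[s sE] sinkA0]; apply: contrapT => /forallNP h.
have /choice[W hW] a : exists A, chi A /\ ~ (rA A a !=set0).
  by have /existsNP[A /not_implyP[cA nA]] := h a; exists A.
have [A1 [cA1 A10 A1W]] : exists A1, [/\ chi A1, A1 `<=` A0
    & forall a, a \in s -> A1 `<=` W a].
  elim: s {sE} => [|a s [A1 [cA1 A10 A1W]]]; first by exists A0; split=> //.
  exists (A1 `&` W a); split.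
  - by apply: pf_setI => //; have [] := hW a.
  - by move=> v [/A10].
  - move=> b; rewrite in_cons => /predU1P[->|/A1W bW] v []// Av _.
    exact: bW.
apply: (pf_set0 chiP); suff <- : A1 = set0 by [].
rewrite -(@sinkA0 A1); first by rewrite setIidr.
  exact: pf_sub cA1.
move=> v A1v e ev.
have : out_labels L A0 (L e) by exists e => //=; rewrite ev; exact: A10.
rewrite sE => /= /A1W Ws; have [_] := hW (L e); apply; exists (erange e).
by apply/rAP; exists e; split=> //; apply: Ws; rewrite ev.
Qed.

Definition next_to (chi : set (set (vertex E))) (x : option Al * set (set (vertex E))) :=
  prime_filter x.2 /\
  if x.1 is Some a then x.2 (ra a) /\ chi = pullback a x.2
  else forall A, regular A -> ~ chi A.

(** When [chi] contains a regular set, the ranges of its members along a suitable label generate a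
    proper filter on the vertices. The trace on [B] of an ultrafilter above it is the next prime
    filter. *)
Lemma next_to_ex chi : prime_filter chi -> exists x, next_to chi x.
Proof.
move=> chiP; have [[A0 [cA0 rA0]]|/forallNP h] := pselect (exists A, chi A /\ regular A); last first.
  by exists (None, chi); split=> // A rA0 cA; apply: (h A).
have [a ha] := prime_filter_label chiP cA0 rA0.
pose F : set_system (vertex E) := [set U | exists2 A, chi A & rA A a `<=` U].
have FF : ProperFilter F.
  split; first by move=> [A cA]; have [v Av] := ha A cA; move=> /(_ v Av).
  split.
  - by exists A0.
  - move=> U U' [A cA AU] [A' cA' AU']; exists (A `&` A'); first exact: pf_setI.
    rewrite rA_setI; [|exact: pf_sub cA|exact: pf_sub cA'].
    by move=> v [/AU ? /AU' ?].
  - by move=> U U' UU' [A cA AU]; exists A => // v /AU /UU'.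
have [G [GU FG]] := ultraFilterLemma FF.
have GF : Filter G by exact: (@ultra_proper _ _ GU).
have G0 : ~ G set0 by exact: (@filter_not_empty _ _ (@ultra_proper _ _ GU)).
have BA0 := pf_sub chiP cA0.
exists (Some a, [set A | B A /\ G A]); split=> /=.
  split.
  - by move=> A [].
  - by case.
  - move=> A A' [BA GA] [BA' GA']; split; first exact: (accom_setI B_acc).
    exact: filterI.
  - by move=> A A' [BA GA] BA' AA'; split=> //; exact: filterS GA.
  - move=> A A' BA BA' [_ GAA'].
    have [GA|GA] := in_ultra_setVsetC A GU; first by left.
    right; split=> //; apply: filterS (filterI GAA' GA).
    by move=> v [[|//]].
split.
  split; first exact: B_ra.
  by apply: FG; exists A0 => //; exact: rA_sub_ra.
apply/seteqP; split=> A.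
  move=> cA; have BA := pf_sub chiP cA; split=> //; split; first exact: B_rA.
  by apply: FG; exists A.
move=> [BA [_ GA]].
(* If [A] were not in [chi], the difference of [A0] and [A] would be, by primality. Its range along
   [a] is disjoint from that of [A] by weak left-resolution, yet both belong to [G]. *)
have BI : B (A0 `&` A) by exact: (accom_setI B_acc).
have BD : B (A0 `\` A) by exact: B_norm.
have : chi ((A0 `&` A) `|` (A0 `\` A)) by rewrite setUIDK.
case/(pf_prime chiP BI BD) => [cI|cD].
  by apply: (pf_up chiP cI BA) => v [].
exfalso; apply: G0; have GD : G (rA (A0 `\` A) a) by apply: FG; exists (A0 `\` A).
apply: filterS (filterI GD GA) => v; rewrite -rA_setI // => /rAP[e [_ [[_ +] +]]].
by [].
Qed.


(* Boundary paths: a labelled path together with the prime filters of sets that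
   it passes through. It may stop, with label [None], only at a filter without
   regular sets; what follows is then irrelevant. *)
Definition bpath : Type := nat -> set (set (vertex E)) * option Al.

Definition valid_bpath (x : bpath) := forall i, prime_filter (x i).1 /\
  if (x i).2 is Some a then (x i.+1).1 (ra a) /\ (x i).1 = pullback a (x i.+1).1
  else forall A, regular A -> ~ (x i).1 A.

Definition bshift (x : bpath) : bpath := fun i => x i.+1.

Definition bcons a (x : bpath) : bpath :=
  fun i => if i is j.+1 then x j else (pullback a (x 0%N).1, Some a).

Lemma valid_bshift x : valid_bpath x -> valid_bpath (bshift x).
Proof. by move=> xv i; exact: xv. Qed.

Lemma valid_bcons a x : valid_bpath x -> (x 0%N).1 (ra a) -> valid_bpath (bcons a x).
Proof.
move=> xv xa [|i] /=; last exact: xv.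
by split=> //; apply: prime_filter_pullback; have [] := xv 0%N.
Qed.

Lemma bpath_ex A : B A -> A !=set0 -> exists2 x, valid_bpath x & (x 0%N).1 A.
Proof.
move=> BA [v Av].
have /choice[nx nxP] (chi : set (set (vertex E))) : exists y, prime_filter chi -> next_to chi y.
  have [/next_to_ex[y hy]|h] := pselect (prime_filter chi); first by exists y.
  by exists (None, chi) => /h.
pose st := fix st n := if n is n'.+1 then (nx (st n')).2 else [set A | B A /\ A v].
have stP n : prime_filter (st n).
  elim: n => [|n ih] /=; first exact: prime_filter_principal.
  by have [] := nxP _ ih.
exists (fun n => (st n, (nx (st n)).1)) => //= i /=; split; first exact: stP.
by have [_] := nxP _ (stP i).
Qed.

(** * The representation on l2 of the boundary paths *)

Section BoundaryRepresentation.
Variable R : realType.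

Local Notation I := bpath.

(** Validity is part of the predicates, so that the Hilbert space can be indexed by all of [bpath]:
    every operator of the representation vanishes at invalid sequences. *)
Definition in_proj A (x : I) : bool := `[< valid_bpath x /\ (x 0%N).1 A >].

Definition in_dom a (x : I) : bool := `[< valid_bpath x /\ (x 0%N).2 = Some a >].

Lemma in_projP A x : in_proj A x -> in_proj A (id x) /\ id x = x.
Proof. by []. Qed.

Lemma in_domP a x : in_dom a x -> in_proj (ra a) (bshift x) /\ bcons a (bshift x) = x.
Proof.
move=> /asboolP[xv xa]; have := (xv 0%N).2; rewrite xa => -[xr xp]; split.
  by apply/asboolP; split=> //; exact: valid_bshift.
by apply/funext => -[|i] //=; rewrite -xp -xa; case: (x 0%N).
Qed.

Lemma in_ranP a x : in_proj (ra a) x -> in_dom a (bcons a x) /\ bshift (bcons a x) = x.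
Proof.
move=> /asboolP[xv xr]; split; last exact/funext.
by apply/asboolP; split=> //; exact: valid_bcons.
Qed.

Definition bd_proj A : adjop (l2_ipmodule R I) := pbop R (@in_projP A) (@in_projP A).

Definition bd_iso a : adjop (l2_ipmodule R I) := pbop R (@in_domP a) (@in_ranP a).


Local Notation H := (l2_ipmodule R I).
Local Notation ev U f x := ((U f : l2 R I) x).

Lemma bd_ext (U W : adjop H) : (forall (f : l2 R I) x, ev U f x = ev W f x) -> U = W.
Proof. by move=> h; apply: adjop_inj => f; exact: l2_eq. Qed.

Lemma bd_projE A (f : l2 R I) x : ev (bd_proj A) f x = if in_proj A x then f x else 0.
Proof. by []. Qed.

Lemma bd_isoE a (f : l2 R I) x :
  ev (bd_iso a) f x = if in_dom a x then f (bshift x) else 0.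
Proof. by []. Qed.

Lemma cstar_bd_isoE a (f : l2 R I) x :
  ev (cstar (bd_iso a)) f x = if in_proj (ra a) x then f (bcons a x) else 0.
Proof. by rewrite cstar_pbop. Qed.

Lemma cstar_bd_proj A : cstar (bd_proj A) = bd_proj A.
Proof. by rewrite cstar_pbop. Qed.

Lemma in_proj_dom A a x : B A -> in_dom a x -> in_proj A x = in_proj (rA A a) (bshift x).
Proof.
move=> BA /asboolP[xv xa]; have := (xv 0%N).2; rewrite xa => -[xr xp].
apply/asboolP/asboolP => -[_ h]; split=> //.
- exact: valid_bshift.
- by move: h; rewrite xp => -[].
- by rewrite xp; split.
Qed.

Lemma bd_evD (U W : adjop H) (f : l2 R I) x : ev (U + W) f x = ev U f x + ev W f x.
Proof. by []. Qed.

Lemma bd_ev_sum (l : seq Al) (U : Al -> adjop H) (f : l2 R I) x :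
  ev (\sum_(a <- l) U a) f x = \sum_(a <- l) ev (U a) f x.
Proof. by elim: l => [|a l ih]; rewrite ?big_nil // !big_cons bd_evD ih. Qed.

Lemma bd_representation : representation (X := adjop H) L B bd_proj bd_iso.
Proof.
split.
- move=> A BA; split; last exact: cstar_bd_proj.
  by apply: bd_ext => f x; rewrite adjop_cmulE !bd_projE; case: (in_proj A x).
- move=> a; apply: bd_ext => f x; rewrite !adjop_cmulE !bd_isoE cstar_bd_isoE.
  case: ifP => // xa; have [xr xe] := in_domP xa.
  by rewrite xr bd_isoE xe xa.
- move=> B0; apply: bd_ext => f x; rewrite bd_projE.
  by case: ifP => // /asboolP[/(_ 0%N)[/pf_set0]].
- move=> A A' BA BA'; apply: bd_ext => f x; rewrite adjop_cmulE !bd_projE.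
  suff -> : in_proj (A `&` A') x = in_proj A x && in_proj A' x.
    by case: (in_proj A x).
  apply/asboolP/andP => [[xv h]|[/asboolP[xv h] /asboolP[_ h']]].
    have [p _] := xv 0%N.
    by split; apply/asboolP; split=> //; apply: (pf_up p h) => // v [].
  by split=> //; have [p _] := xv 0%N; exact: pf_setI.
- move=> A A' BA BA'; apply: bd_ext => f x.
  rewrite bd_evD bd_evD -scaleN1r !bd_projE.
  change (ev (-1 *: bd_proj (A `&` A')) f x) with (-1 * ev (bd_proj (A `&` A')) f x).
  rewrite bd_projE mulN1r.
  have [xv|xv] := pselect (valid_bpath x); last first.
    have n W : in_proj W x = false by apply/asboolP => -[].
    by rewrite !n oppr0 !addr0.
  have [p _] := xv 0%N.
  have pE W : in_proj W x = `[< (x 0%N).1 W >].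
    by apply/asboolP/asboolP => [[]|].
  rewrite !pE.
  have -> : `[< (x 0%N).1 (A `|` A') >] = `[< (x 0%N).1 A >] || `[< (x 0%N).1 A' >].
    apply/asboolP/orP => [/(pf_prime p BA BA')[h|h]|[/asboolP h|/asboolP h]].
    - by left; apply/asboolP.
    - by right; apply/asboolP.
    - by apply: (pf_up p h); [exact: (accom_setU B_acc) | left].
    - by apply: (pf_up p h); [exact: (accom_setU B_acc) | right].
  have -> : `[< (x 0%N).1 (A `&` A') >] = `[< (x 0%N).1 A >] && `[< (x 0%N).1 A' >].
    apply/asboolP/andP => [h|[/asboolP h /asboolP h']]; last exact: pf_setI.
    by split; apply/asboolP; apply: (pf_up p h) => // v [].
  by do 2![case: asboolP => _] => /=; rewrite ?oppr0 ?addr0 ?add0r ?addrK.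
- move=> A a BA; apply: bd_ext => f x; rewrite !adjop_cmulE bd_projE !bd_isoE.
  case: (boolP (in_dom a x)) => xa; last by case: ifP.
  by rewrite (in_proj_dom BA xa) bd_projE.
- move=> a; apply: bd_ext => f x; rewrite adjop_cmulE cstar_bd_isoE bd_projE.
  by case: ifP => // xr; have [xd xe] := in_ranP xr; rewrite bd_isoE xd xe.
- move=> a b ab; apply: bd_ext => f x; rewrite adjop_cmulE cstar_bd_isoE.
  case: ifP => // xr; rewrite bd_isoE; case: ifP => // /asboolP[_ /= [eab]].
  by case: ab.
- move=> A BA fin sinkA; apply: bd_ext => f x.
  rewrite (fsbig_finite _ _ fin) bd_ev_sum bd_projE.
  have term a : ev (bd_iso a ** bd_proj (rA A a) ** cstar (bd_iso a)) f x =
      if in_dom a x && in_proj A x then f x else 0.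
    rewrite !adjop_cmulE bd_isoE; case: ifP => // xa; have [xr xe] := in_domP xa.
    by rewrite bd_projE /= (in_proj_dom BA xa) cstar_bd_isoE xr xe.
  under eq_bigr do rewrite term.
  case: ifP => xA; last first.
    by rewrite big1 // => a _; rewrite andbF.
  (* The first filter contains the regular set [A], so the path does not stop there. Its first label
     belongs to [out_labels L A], and only the term of that label survives. *)
  have /asboolP[xv xA'] := xA; have [p] := xv 0%N.
  case xa : (x 0%N).2 => [a|]; last by move=> h; exfalso; apply: (h A).
  move=> [xr xp].
  have da : in_dom a x by apply/asboolP.
  rewrite (big_fsetD1 a) /=; last first.
    rewrite in_fset_set // inE; apply: rA_out; move: xA'; rewrite xp => -[_ h].
    have [p1 _] := xv 1%N; apply/set0P/eqP => r0; apply: (pf_set0 p1).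
    by rewrite -r0.
  rewrite da /= big1_fset ?addr0 // => b; rewrite !inE => /andP[/negP ba _] _.
  case: ifP => // /andP[/asboolP[_ xb] _]; exfalso; apply: ba.
  by move: xb; rewrite xa => -[->].
Qed.

Lemma bd_proj_neq0 A : B A -> A <> set0 -> bd_proj A <> 0.
Proof.
move=> BA /eqP/set0P A0 p0; have [x xv xA] := bpath_ex BA A0.
have := congr1 (fun U : adjop H => ev U (delta R x) x) p0.
rewrite /= /pb_fun /in_proj asboolT //= eqxx => /eqP.
by rewrite oner_eq0.
Qed.

End BoundaryRepresentation.

End LabelledSpace.

(** * Norms of powers *)

(** If a = (1 + d) b with b, d > 0, Bernoulli's inequality bounds (1 + d)^m below only linearly,
    which does not beat K m. Squaring it, that is, passing from 2^j to 2^(j + 1), gives quadratic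
    growth. *)
Lemma powers_le (R : realType) (a b K : R) : 0 <= a -> 0 <= b ->
  (forall j, a ^+ (2 ^ j) <= K * (2 ^ j)%:R * b ^+ (2 ^ j)) -> a <= b.
Proof.
move=> a0 b0 h; rewrite leNgt; apply/negP => ab.
have [b00|bn] := eqVneq b 0.
  have := h 0%N; rewrite b00 expn0 !expr1 mulr0 leNgt => /negP[].
  by rewrite -b00.
have bp : 0 < b by rewrite lt_def bn b0.
pose d := a / b - 1; have d0 : 0 < d by rewrite subr_gt0 ltr_pdivlMr // mul1r.
have bern m : 1 + m%:R * d <= (1 + d) ^+ m.
  elim: m => [|m ih]; first by rewrite mul0r addr0 expr0.
  rewrite exprSr; apply: le_trans (ler_wpM2r _ ih); last by rewrite addr_ge0 // ltW.
  rewrite -subr_ge0.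
  have -> : (1 + m%:R * d) * (1 + d) - (1 + m.+1%:R * d) = m%:R * d * d.
    by rewrite -natr1; ring.
  by rewrite !mulr_ge0 // ltW.
have hd j : (1 + d) ^+ (2 ^ j) <= K * (2 ^ j)%:R.
  rewrite /d addrC subrK expr_div_n ler_pdivrMr ?exprn_gt0 //.
have lin j : (2 ^ j)%:R * d ^+ 2 <= K *+ 2.
  have := hd j.+1; rewrite expnS mulnC exprM => hj.
  have h1 : ((2 ^ j)%:R * d) ^+ 2 <= K * (2 ^ j * 2)%:R.
    apply: le_trans hj; rewrite ler_pXn2r ?nnegrE ?mulr_ge0 ?exprn_ge0 ?(ltW d0) //.
      apply: le_trans (bern _); by rewrite lerDr.
    by rewrite addr_ge0 // ltW.
  have p2 : 0 < (2 ^ j)%:R :> R by rewrite ltr0n expn_gt0.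
  rewrite -(ler_pM2l p2) (le_trans _ (le_trans h1 _)) //.
    by rewrite exprMn mulrA -expr2.
  by rewrite natrM -[K *+ 2]mulr_natr mulrCA.
have d2 : 0 < d ^+ 2 by rewrite exprn_gt0.
have [j hj] : exists j, K *+ 2 / d ^+ 2 < (2 ^ j)%:R.
  exists (Num.bound `|K *+ 2 / d ^+ 2|).
  apply: le_lt_trans (ler_norm _) _; apply: lt_le_trans (archi_boundP _) _ => //.
  by rewrite ler_nat; exact/ltnW/ltn_expl.
by have := lin j; rewrite leNgt -ltr_pdivrMr // hj.
Qed.

Section RepeatedSquare.
Variables (R : realType) (X : cstarAlgType R).
Implicit Types x y : X.

Fixpoint sqn x j := if j is j'.+1 then sqn x j' ** sqn x j' else x.

Lemma sqn_star x j : cstar x = x -> cstar (sqn x j) = sqn x j.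
Proof. by move=> xs; elim: j => //= j ih; rewrite cstarM ih. Qed.

Lemma nr_sqn x j : cstar x = x -> nr (sqn x j) = nr x ^+ (2 ^ j).
Proof.
move=> xs; elim: j => [|j ih] /=; first by rewrite expr1.
by rewrite -{1}(sqn_star j xs) nr_star_mul ih -exprM expnS mulnC.
Qed.

Lemma sqn_orth x y j : x ** y = 0 -> y ** x = 0 ->
  [/\ sqn (x + y) j = sqn x j + sqn y j, sqn x j ** sqn y j = 0
    & sqn y j ** sqn x j = 0].
Proof.
move=> xy yx; elim: j => [|j [e1 e2 e3]] //=; split.
- by rewrite e1 cmulDl !cmulDr e2 e3 addr0 add0r.
- by rewrite -cmulA (cmulA _ (sqn y j)) e2 cmul0x cmulx0.
- by rewrite -cmulA (cmulA _ (sqn x j)) e3 cmul0x cmulx0.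
Qed.

(** Powers of the sum of the orthogonal elements x^* x and y^* y have no cross terms, so the bound
    holds up to a factor 2 in each power, and [powers_le] removes the factor. *)
Lemma nr_orth_le x y M : x ** cstar y = 0 -> cstar x ** y = 0 ->
  nr x <= M -> nr y <= M -> nr (x + y) <= M.
Proof.
move=> xy' xy xM yM; have M0 : 0 <= M by exact: le_trans (nr_ge0 x) xM.
have yx' : y ** cstar x = 0 by rewrite -[LHS]cstarK cstarM cstarK xy' cstar0.
have yx : cstar y ** x = 0 by rewrite -[LHS]cstarK cstarM cstarK xy cstar0.
rewrite -(ler_pXn2r (ltn0Sn 1)) ?nnegrE ?nr_ge0 // -nr_star_mul.
rewrite cstarD cmulDl !cmulDr xy yx addr0 add0r.
set u := cstar x ** x; set v := cstar y ** y.
have us : cstar u = u by rewrite cstarM cstarK.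
have vs : cstar v = v by rewrite cstarM cstarK.
have uv : u ** v = 0 by rewrite /u /v -cmulA (cmulA x) xy' cmul0x cmulx0.
have vu : v ** u = 0 by rewrite /u /v -cmulA (cmulA y) yx' cmul0x cmulx0.
apply: (@powers_le _ _ _ 2) => [||j]; [exact: nr_ge0|exact: exprn_ge0|].
rewrite -nr_sqn; last by rewrite cstarD us vs.
have [-> _ _] := sqn_orth j uv vu.
apply: le_trans (nrD _ _) _; rewrite !nr_sqn // !nr_star_mul.
have h (z : X) : nr z <= M -> (nr z ^+ 2) ^+ (2 ^ j) <= (M ^+ 2) ^+ (2 ^ j).
  by move=> zM; rewrite !lerXn2r ?nnegrE ?exprn_ge0 ?nr_ge0 // ler_pXn2r ?nnegrE ?nr_ge0.
apply: le_trans (lerD (h _ xM) (h _ yM)) _.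
rewrite -mulr2n -[X in X <= _]mulr_natl ler_wpM2r ?exprn_ge0 ?sqr_ge0 //.
by rewrite ler_pMr // ler1n expn_gt0.
Qed.

End RepeatedSquare.

(** * Monomials, degrees and levels *)

Section RepresentationAlgebra.
Variables (Al : countType) (E : digraph) (L : edge E -> Al).
Variable B : set (set (vertex E)).
Hypotheses (L_surj : forall a, exists e, L e = a)
  (B_acc : accommodating L B) (B_norm : normal_collection B).
Variables (R : realType) (X : cstarAlgType R).
Variables (p : set (vertex E) -> X) (s : Al -> X).
Hypothesis psR : representation L B p s.
Implicit Types (x y z : X) (A : set (vertex E)) (a b : Al).

Local Notation rA := (rA L).
Local Notation ra := (ra L).
Let Bra := B_ra L_surj B_acc.
Let BrA := B_rA L_surj B_acc.

Lemma rep_pp A : B A -> p A ** p A = p A.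
Proof. by move=> /(rep_projection psR)[]. Qed.

Lemma rep_star A : B A -> cstar (p A) = p A.
Proof. by move=> /(rep_projection psR)[]. Qed.

Lemma rep_p0 A : B A -> p set0 = 0.
Proof. by move=> BA; apply: (rep_set0 psR); rewrite -(setDv A); exact: B_norm. Qed.

Lemma rep_ps A a : B A -> p A ** s a = s a ** p (rA A a).
Proof. exact: (rep_commute psR). Qed.

Lemma rep_sp A a : B A -> cstar (s a) ** p A = p (rA A a) ** cstar (s a).
Proof.
move=> BA; have := congr1 cstar (rep_ps a BA).
by rewrite !cstarM !rep_star //; exact: BrA.
Qed.

Lemma rep_ss a : cstar (s a) ** s a = p (ra a).
Proof. exact: (rep_initial psR). Qed.

Lemma rep_s_ra a : s a ** p (ra a) = s a.
Proof. by rewrite -rep_ss cmulA; exact: (rep_partial_isometry psR). Qed.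

Lemma nr_rep_p_le1 A : B A -> nr (p A) <= 1.
Proof.
move=> BA; have [e|n0] := eqVneq (nr (p A)) 0; first by rewrite e.
have n1 : 0 < nr (p A) by rewrite lt_def n0 nr_ge0.
by rewrite -(ler_pM2r n1) mul1r -expr2 -nr_star_mul rep_star // rep_pp.
Qed.

Lemma nr_rep_p A : B A -> p A <> 0 -> nr (p A) = 1.
Proof.
move=> BA /eqP p0; have n0 : nr (p A) != 0 by rewrite nr_eq0.
by apply: (mulIf n0); rewrite mul1r -expr2 -nr_star_mul rep_star // rep_pp.
Qed.

Lemma nr_rep_s_le1 a : nr (s a) <= 1.
Proof.
rewrite -(ler_pXn2r (ltn0Sn 1)) ?nnegrE ?nr_ge0 // -nr_star_mul rep_ss expr1n.
exact: nr_rep_p_le1.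
Qed.

(* The products s_a1 ... s_am p_A s_bn^* ... s_b1^*, where the letters may be
   adjoined on the two sides in any order, and 0. *)
Inductive monomial : nat -> nat -> X -> Prop :=
| mon_zero m n : monomial m n 0
| mon_p A : B A -> monomial 0 0 (p A)
| mon_s a m n x : monomial m n x -> monomial m.+1 n (s a ** x)
| mon_star b m n x : monomial m n x -> monomial m n.+1 (x ** cstar (s b)).

Lemma monomial_star m n x : monomial m n x -> monomial n m (cstar x).
Proof.
elim=> [m' n'|A BA|a m' n' y _ ih|b m' n' y _ ih].
- by rewrite cstar0; exact: mon_zero.
- by rewrite rep_star //; exact: mon_p.
- by rewrite cstarM; exact: mon_star.
- by rewrite cstarM cstarK; exact: mon_s.
Qed.

Lemma monomial_pl m n x : monomial m n x -> forall A, B A -> monomial m n (p A ** x).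
Proof.
elim=> [m' n'|A BA|a m' n' y _ ih|b m' n' y _ ih] A' BA'.
- by rewrite cmulx0; exact: mon_zero.
- by rewrite (rep_setI psR) //; apply: mon_p; exact: (accom_setI B_acc).
- by rewrite cmulA rep_ps // -cmulA; apply: mon_s; apply: ih; exact: BrA.
- by rewrite cmulA; apply: mon_star; exact: ih.
Qed.

(** Cancelling s_b^* against s_b shortens the product, so only the degree is additive: the equation
    is m2 - n2 = (m - n) + (m' - n') without subtraction. A vanishing product counts as a zero
    monomial of the right degree. *)
Lemma monomialM m n x : monomial m n x -> forall m' n' y, monomial m' n' y ->
  exists m2 n2, (m2 + (n + n') = n2 + (m + m'))%N /\ monomial m2 n2 (x ** y).
Proof.
elim=> [k l|A BA|a k l {}x _ ih|b k l {}x _ ih] m' n' y.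
- move=> _; exists (k + m')%N, (l + n')%N; split; first by rewrite addnC.
  by rewrite cmul0x; exact: mon_zero.
- by move=> yM; exists m', n'; split; [rewrite addnC | exact: monomial_pl].
- move=> /ih[m2 [n2 [e xy]]]; exists m2.+1, n2; split; first by rewrite addSn e addSn addnS.
  by rewrite -cmulA; exact: mon_s.
- elim=> [k' l'|A BA|a k' l' {}y yM _|c k' l' {}y yM [m2 [n2 [e xy]]]].
  + exists (k + k')%N, (l.+1 + l')%N; split; first by rewrite addnC.
    by rewrite cmulx0; exact: mon_zero.
  + rewrite -cmulA rep_sp // cmulA.
    have [m2 [n2 [e xy]]] := ih _ _ _ (mon_p (BrA b BA)).
    exists m2, n2.+1; split; last exact: mon_star.
    by rewrite addSn !addnS e addSn.
  + have [<-|/eqP ba] := eqVneq b a; last first.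
      rewrite -cmulA (cmulA (cstar _)) (rep_orthogonal psR ba) cmul0x cmulx0.
      exists (k + k'.+1)%N, (l.+1 + l')%N; split; first by rewrite addnC.
      exact: mon_zero.
    rewrite -cmulA (cmulA (cstar _)) rep_ss.
    have [m2 [n2 [e xy]]] := ih _ _ _ (monomial_pl yM (Bra b)).
    exists m2, n2; split=> //.
    by rewrite addSn !addnS e.
  + rewrite cmulA; exists m2, n2.+1; split; last exact: mon_star.
    by rewrite addnS addnS e addSn.
Qed.

Inductive homog (k : int) : X -> Prop :=
| homog_mon m n x : monomial m n x -> k = m%:Z - n%:Z -> homog k x
| homogD x y : homog k x -> homog k y -> homog k (x + y)
| homogZ (c : R[i]) x : homog k x -> homog k (c *: x).

Lemma homog0 k : homog k 0.
Proof.
case: k => n; first by apply: homog_mon (mon_zero n 0) _; rewrite subr0.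
by apply: homog_mon (mon_zero 0 n.+1) _; rewrite NegzE sub0r.
Qed.

Lemma homog_sum k (I : eqType) (l : seq I) (P : pred I) (F : I -> X) :
  (forall i, i \in l -> P i -> homog k (F i)) -> homog k (\sum_(i <- l | P i) F i).
Proof.
move=> h; rewrite big_seq_cond; elim/big_rec: _ => [|i x /andP[il Pi] Dx].
  exact: homog0.
by apply: homogD => //; exact: h.
Qed.

Lemma homogM k x : homog k x -> forall k' y, homog k' y -> homog (k + k') (x ** y).
Proof.
elim=> [m n {}x xM ke|x1 x2 _ ih1 _ ih2|c {}x _ ih] k' y.
- elim=> [m' n' {}y yM ke'|y1 y2 _ ih1 _ ih2|c {}y _ ih].
  + have [m2 [n2 [e xy]]] := monomialM xM yM.
    apply: homog_mon xy _; rewrite ke ke'; lia.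
  + by rewrite cmulDr; exact: homogD.
  + by rewrite cmulZr; exact: homogZ.
- by move=> yh; rewrite cmulDl; apply: homogD; [exact: ih1|exact: ih2].
- by move=> yh; rewrite cmulZl; apply: homogZ; exact: ih.
Qed.

Lemma homog_star k x : homog k x -> homog (- k) (cstar x).
Proof.
elim=> [m n {}x xM ke|x1 x2 _ ih1 _ ih2|c {}x _ ih].
- by apply: homog_mon (monomial_star xM) _; rewrite ke opprB.
- by rewrite cstarD; exact: homogD.
- by rewrite cstarZ; exact: homogZ.
Qed.

(** Independence of the homogeneous parts is not presupposed: the decomposition is carried as a
    list, possibly with repeated degrees, and a component is formed by filtering it. *)
Definition graded (n : nat) y := exists2 l : seq (int * X),
  (forall kx, kx \in l -> (`|kx.1| <= n)%N /\ homog kx.1 kx.2)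
  & y = \sum_(kx <- l) kx.2.

Lemma graded_homog (k : int) (n : nat) x : (`|k| <= n)%N -> homog k x -> graded n x.
Proof.
move=> kn xh; exists [:: (k, x)]; last by rewrite big_seq1.
by move=> kx; rewrite inE => /eqP ->.
Qed.

Lemma gradedD n m x y : graded n x -> graded m y -> graded (maxn n m) (x + y).
Proof.
move=> [l lP ->] [l' lP' ->]; exists (l ++ l'); last by rewrite big_cat.
move=> kx; rewrite mem_cat => /orP[/lP[kn h]|/lP'[kn h]]; split=> //.
  by rewrite (leq_trans kn) // leq_maxl.
by rewrite (leq_trans kn) // leq_maxr.
Qed.

Lemma gradedZ n (c : R[i]) x : graded n x -> graded n (c *: x).
Proof.
move=> [l lP ->]; exists [seq (kx.1, c *: kx.2) | kx <- l].
  by move=> kx /mapP[ky /lP[kn h] ->]; split=> //; exact: homogZ.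
by rewrite big_map scaler_sumr.
Qed.

Lemma graded_star n x : graded n x -> graded n (cstar x).
Proof.
move=> [l lP ->]; exists [seq (- kx.1, cstar kx.2) | kx <- l].
  by move=> kx /mapP[ky /lP[kn h] ->] /=; rewrite abszN; split=> //; exact: homog_star.
by rewrite big_map cstar_sum.
Qed.

Lemma gradedM n m x y : graded n x -> graded m y -> graded (n + m) (x ** y).
Proof.
move=> [l lP ->] [l' lP' ->].
exists [seq (kx.1 + ky.1, kx.2 ** ky.2) | kx <- l, ky <- l'].
  move=> kx /allpairsP[[u v] /= [/lP[un uh] /lP'[vn vh] ->]] /=.
  split; last exact: homogM.
  by move: (u.1) (v.1) un vn => i j; lia.
rewrite big_allpairs_dep /= cmul_suml; apply: eq_bigr => u _.
by rewrite cmul_sumr.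
Qed.

Definition graded_any x := exists n, graded n x.

Lemma graded_sqn n x j : graded n x -> graded (n * 2 ^ j) (sqn x j).
Proof.
move=> xn; elim: j => [|j ih] /=; first by rewrite muln1.
by rewrite expnS mulnCA mul2n -addnn; exact: gradedM.
Qed.


Inductive level : nat -> X -> Prop :=
| lev_zero n : level n 0
| lev_p n A : B A -> level n (p A)
| lev_s n a b x : level n x -> level n.+1 (s a ** x ** cstar (s b))
| levD n x y : level n x -> level n y -> level n (x + y)
| levZ n (c : R[i]) x : level n x -> level n (c *: x).

Lemma levelS n x : level n x -> level n.+1 x.
Proof.
elim=> {n x} [n|n A BA|n a b x _ ih|n x y _ ihx _ ihy|n c x _ ih].
- exact: lev_zero.
- exact: lev_p.
- exact: lev_s.
- exact: levD.
- exact: levZ.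
Qed.

Lemma level_leq n m x : (n <= m)%N -> level n x -> level m x.
Proof. by move=> /subnKC <-; elim: (m - n)%N => [|k ih]; rewrite ?addn0 ?addnS // => /ih/levelS. Qed.

Lemma level_star n x : level n x -> level n (cstar x).
Proof.
elim=> {n x} [n|n A BA|n a b x _ ih|n x y _ ihx _ ihy|n c x _ ih].
- by rewrite cstar0; exact: lev_zero.
- by rewrite rep_star //; exact: lev_p.
- by rewrite !cstarM cstarK cmulA; exact: lev_s.
- by rewrite cstarD; exact: levD.
- by rewrite cstarZ; exact: levZ.
Qed.

Lemma level_pl n x : level n x -> forall A, B A -> level n (p A ** x).
Proof.
elim=> {n x} [n|n A BA|n a b x _ ih|n x y _ ihx _ ihy|n c x _ ih] A' BA'.
- by rewrite cmulx0; exact: lev_zero.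
- by rewrite (rep_setI psR) //; apply: lev_p; exact: (accom_setI B_acc).
- rewrite !cmulA rep_ps // -(cmulA (s a)); apply: lev_s; apply: ih; exact: BrA.
- by rewrite cmulDr; apply: levD; [exact: ihx | exact: ihy].
- by rewrite cmulZr; apply: levZ; exact: ih.
Qed.

Lemma level_pr n x A : B A -> level n x -> level n (x ** p A).
Proof.
move=> BA /level_star/level_pl/(_ _ BA)/level_star.
by rewrite cstarM cstarK rep_star.
Qed.

Lemma levelM n x y : level n x -> level n y -> level n (x ** y).
Proof.
elim: n x y => [|n ihn] x y.
  move=> xL; move e : 0%N xL => m xL; elim: xL y e => {m x}.
  - by move=> n y e _; rewrite cmul0x; exact: lev_zero.
  - by move=> n A BA y e yL; exact: level_pl.
  - by [].
  - move=> n x1 x2 _ ih1 _ ih2 y e yL; rewrite cmulDl.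
    by apply: levD; [exact: ih1 | exact: ih2].
  - by move=> n c x _ ih y e yL; rewrite cmulZl; apply: levZ; exact: ih.
move=> xL; move e : n.+1 xL => m xL; elim: xL y e => {m x}.
- by move=> m y e _; rewrite cmul0x; exact: lev_zero.
- by move=> m A BA y e yL; exact: level_pl.
- move=> m a b x xL _ y [e] yL; rewrite -{}e in xL yL *.
  move e : n.+1 yL => k yL; elim: yL e => {y k}.
  + by move=> k e; rewrite cmulx0; exact: lev_zero.
  + move=> k A BA e; rewrite -cmulA rep_sp // cmulA -(cmulA (s a)) -e.
    by apply: lev_s; apply: level_pr => //; exact: BrA.
  + move=> k c d y yL _ [e]; rewrite -{}e in yL *.
    have [<-|/eqP bc] := eqVneq b c; last first.
      rewrite -cmulA !(cmulA (cstar (s b))) (rep_orthogonal psR bc).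
      by rewrite !cmul0x cmulx0; exact: lev_zero.
    have -> : s a ** x ** cstar (s b) ** (s b ** y ** cstar (s d)) =
        s a ** (x ** (p (ra b) ** y)) ** cstar (s d).
      by rewrite -rep_ss !cmulA.
    by apply: lev_s; apply: ihn => //; exact: level_pl.
  + by move=> k y1 y2 _ ih1 _ ih2 e; rewrite cmulDr; apply: levD; [exact: ih1|exact: ih2].
  + by move=> k c y _ ih e; rewrite cmulZr; apply: levZ; exact: ih.
- move=> m x1 x2 _ ih1 _ ih2 y e yL; rewrite cmulDl.
  by apply: levD; [exact: ih1 | exact: ih2].
- by move=> m c x _ ih y e yL; rewrite cmulZl; apply: levZ; exact: ih.
Qed.

(** Stripping the outer letters lowers the level by one, which drives the induction in
    [core_inj]. *)
Lemma level_compress n x a b : level n.+1 x -> level n (cstar (s a) ** x ** s b).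
Proof.
move e : n.+1 => m xL; elim: xL e => {m x}.
- by move=> m _; rewrite cmulx0 cmul0x; exact: lev_zero.
- move=> m A BA _; rewrite rep_sp // -cmulA.
  have [<-|/eqP ab] := eqVneq a b.
    by rewrite rep_ss; apply: level_pl; [exact: lev_p | exact: BrA].
  by rewrite (rep_orthogonal psR ab) cmulx0; exact: lev_zero.
- move=> m c d x xL _ [e]; rewrite -{}e in xL *.
  have -> : cstar (s a) ** (s c ** x ** cstar (s d)) ** s b =
     (cstar (s a) ** s c) ** x ** (cstar (s d) ** s b) by rewrite !cmulA.
  have [<-|/eqP ac] := eqVneq a c; last first.
    by rewrite (rep_orthogonal psR ac) !cmul0x; exact: lev_zero.
  have [<-|/eqP db] := eqVneq d b; last first.
    by rewrite (rep_orthogonal psR db) !cmulx0; exact: lev_zero.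
  by rewrite !rep_ss; apply: level_pr => //; exact: level_pl.
- move=> m x y _ ih1 _ ih2 e; rewrite cmulDr cmulDl.
  by apply: levD; [exact: ih1 | exact: ih2].
- by move=> m c x _ ih e; rewrite cmulZr cmulZl; apply: levZ; exact: ih.
Qed.

Lemma monomial_peel_r m n x : monomial m n.+1 x ->
  x = 0 \/ exists y b, monomial m n y /\ x = y ** cstar (s b).
Proof.
move e : n.+1 => k xM; elim: xM n e => {m k x}.
- by left.
- by [].
- move=> a m k x _ ih n e; have [->|[y [b [yM ->]]]] := ih n e.
    by left; rewrite cmulx0.
  by right; exists (s a ** y), b; split; [exact: mon_s | rewrite cmulA].
- by move=> b m k x xM _ n [e]; right; exists x, b; rewrite e.
Qed.

Lemma monomial_peel m n x : monomial m.+1 n.+1 x ->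
  x = 0 \/ exists y a b, monomial m n y /\ x = s a ** y ** cstar (s b).
Proof.
move e : m.+1 => k; move e' : n.+1 => l xM; elim: xM m n e e' => {k l x}.
- by left.
- by [].
- move=> a k l x xM _ m n [e] e'; rewrite -e -e' in xM.
  have [->|[y [b [yM ->]]]] := monomial_peel_r xM; first by left; rewrite cmulx0.
  by right; exists y, a, b; rewrite cmulA.
- move=> b k l x xM _ m n e [e']; rewrite -e -e' in xM.
  have /monomial_peel_r := monomial_star xM.
  case=> [x0|[y [a [yM xE]]]].
    by left; rewrite -[x]cstarK x0 cstar0 cmul0x.
  right; exists (cstar y), a, b; split; first exact: monomial_star yM.
  by rewrite -[x]cstarK xE cstarM cstarK.
Qed.

Lemma monomial_level n x : monomial n n x -> level n x.
Proof.
elim: n x => [|n ih] x.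
  move e : {1}0%N => k; move e' : 0%N => l xM; elim: xM e e' => //.
    by move=> *; exact: lev_zero.
  by move=> *; exact: lev_p.
case/monomial_peel => [->|[y [a [b [yM ->]]]]]; first exact: lev_zero.
by apply: lev_s; exact: ih.
Qed.

Lemma homog_level x : homog 0 x -> exists n, level n x.
Proof.
elim=> [m n {}x xM ke|x1 x2 _ [n1 h1] _ [n2 h2]|c {}x _ [n h]].
- have e : m = n by lia.
  by exists n; apply: monomial_level; rewrite -{1}e.
- exists (maxn n1 n2); apply: levD.
    by apply: level_leq h1; exact: leq_maxl.
  by apply: level_leq h2; exact: leq_maxr.
- by exists n; exact: levZ.
Qed.

Definition psum (l : seq (R[i] * set (vertex E))) : X := \sum_(cA <- l) cA.1 *: p cA.2.

(** The middle factors are arbitrary: the arguments below act on the outer letters alone. *)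
Definition ssum (l : seq (Al * X * Al)) : X :=
  \sum_(axb <- l) s axb.1.1 ** axb.1.2 ** cstar (s axb.2).

Lemma level_decomp n x : level n x -> exists l l',
  [/\ forall cA, cA \in l -> B cA.2, x = psum l + ssum l' & n = 0%N -> l' = [::]].
Proof.
elim=> {n x} [n|n A BA|n a b x _ _|n x y _ [l1 [l1' [h1 -> e1]]] _ [l2 [l2' [h2 -> e2]]]
  |n c x _ [l [l' [h -> e]]]].
- by exists [::], [::]; rewrite /psum /ssum !big_nil addr0.
- exists [:: (1, A)], [::]; rewrite /psum /ssum big_seq1 big_nil addr0 scale1r.
  by split=> // cA; rewrite inE => /eqP ->.
- exists [::], [:: (a, x, b)]; rewrite /psum /ssum big_seq1 big_nil add0r.
  by split.
- exists (l1 ++ l2), (l1' ++ l2'); split.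
  + by move=> cA; rewrite mem_cat => /orP[/h1|/h2].
  + by rewrite /psum /ssum !big_cat /= addrACA.
  + by move=> n0; rewrite e1 // e2.
- exists [seq (c * cA.1, cA.2) | cA <- l], [seq (axb.1.1, c *: axb.1.2, axb.2) | axb <- l'].
  split.
  + by move=> cA /mapP[dD /h BD ->].
  + rewrite /psum /ssum !big_map scalerDr !scaler_sumr; congr (_ + _).
      by apply: eq_bigr => cA _; rewrite scalerA.
    by apply: eq_bigr => axb _; rewrite cmulZr cmulZl.
  + by move=> /e ->.
Qed.

Fixpoint disjoint_list (l : seq (R[i] * set (vertex E))) : Prop :=
  if l is cA :: l' then
    (forall dD, dD \in l' -> cA.2 `&` dD.2 = set0) /\ disjoint_list l'
  else True.

Lemma psum_cons c A l : psum ((c, A) :: l) = c *: p A + psum l.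
Proof. by rewrite /psum big_cons. Qed.

(** A head [D] with coefficient d is split by [A] into a part with coefficient c + d and a part with
    coefficient d, and the rest of [A] goes on to the tail. The last clause keeps the new sets
    inside [A] and the old ones, which preserves disjointness from [D]. Closure of [B] under
    relative complements enters here. *)
Lemma psum_insert c A l : B A -> (forall dD, dD \in l -> B dD.2) ->
  disjoint_list l -> exists l', [/\ (forall dD, dD \in l' -> B dD.2),
    disjoint_list l', psum l' = c *: p A + psum l &
    forall dD v, dD \in l' -> dD.2 v -> A v \/ exists2 eF, eF \in l & eF.2 v].
Proof.
elim: l A => [|[d D] l ih] A BA lB.
  move=> _; exists [:: (c, A)]; split=> //.
  - by move=> dD; rewrite inE => /eqP ->.
  - by rewrite /psum big_seq1 big_nil addr0.
  - by move=> dD v; rewrite inE => /eqP -> ?; left.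
move=> [/= Dl dl]; have BD : B D by exact: (lB _ (mem_head _ _)).
have lB' dD : dD \in l -> B dD.2 by move=> h; apply: lB; rewrite inE h orbT.
have [l' [l'B dl' l'E l'S]] := ih _ (B_norm BA BD) lB' dl.
have l'D dD : dD \in l' -> D `&` dD.2 = set0.
  move=> h; apply/seteqP; split=> v // -[Dv dDv].
  have [[//]|[eF eFl eFv]] := l'S _ _ h dDv.
  by have := Dl _ eFl => /seteqP[/(_ v) + _]; apply; split.
exists ((c + d, D `&` A) :: (d, D `\` A) :: l'); split.
- move=> dD; rewrite !inE => /or3P[/eqP ->|/eqP ->|/l'B //] /=.
    exact: (accom_setI B_acc).
  exact: B_norm.
- split=> /=; last split=> //.
    move=> dD; rewrite inE => /predU1P[->|/l'D h] /=.
      by apply/seteqP; split=> v // -[[_ Av] [_]].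
    by rewrite setIAC h set0I.
  by move=> dD /l'D h; rewrite setDE setIAC h set0I.
- rewrite !psum_cons l'E.
  have pD W W' : B W -> B W' -> p W = p (W `&` W') + p (W `\` W').
    move=> BW BW'; have BI : B (W `&` W') by exact: (accom_setI B_acc).
    have BS : B (W `\` W') by exact: B_norm.
    have := rep_setU psR BI BS; rewrite setUIDK => ->.
    rewrite (_ : _ `&` _ `&` _ = set0) ?(rep_p0 BW) ?subr0 //.
    by apply/seteqP; split=> v // -[[_ ?] []].
  rewrite [in RHS](pD D A) // [in RHS](pD A D) // scalerDl !scalerDr.
  rewrite (setIC A D) -!addrA; congr (_ + _).
  by rewrite [RHS]addrCA; congr (_ + _); exact: addrCA.
- move=> dD v; rewrite !inE => /or3P[/eqP -> [Dv Av]|/eqP -> [Dv nAv]|h dv].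
  + by left.
  + by right; exists (d, D) => //; exact: mem_head.
  + have [[Av _]|[eF eFl eFv]] := l'S _ _ h dv; first by left.
    by right; exists eF => //; rewrite inE eFl orbT.
Qed.


Lemma psum_disjoint l : (forall cA, cA \in l -> B cA.2) ->
  exists l', [/\ (forall cA, cA \in l' -> B cA.2 /\ cA.2 <> set0), disjoint_list l'
    & psum l' = psum l].
Proof.
move=> lB; suff [l' [l'B l'd <-]] : exists l', [/\ (forall cA, cA \in l' -> B cA.2),
    disjoint_list l' & psum l' = psum l].
  exists [seq cA <- l' | cA.2 != set0]; split.
  - by move=> cA; rewrite mem_filter => /andP[/eqP h /l'B].
  - elim: l' l'd {l'B} => [//|dD l' ih /= [h /ih dl']]; case: ifP => // _ /=.
    by split=> // eF; rewrite mem_filter => /andP[_ /h].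
  - rewrite /psum big_filter big_mkcond /= big_seq [RHS]big_seq.
    apply: eq_bigr => cA /l'B BA; case: ifP => // /negPn/eqP e.
    by rewrite e (rep_p0 BA) scaler0.
elim: l lB => [|[c A] l ih] lB; first by exists [::].
have [|l' [l'B l'd l'E]] := ih.
  by move=> dD h; apply: lB; rewrite inE h orbT.
have BA : B A := lB _ (mem_head _ _).
have [l2 [l2B l2d l2E _]] := psum_insert c BA l'B l'd.
by exists l2; split=> //; rewrite l2E l'E psum_cons.
Qed.

Lemma psum_pl l A : B A -> (forall cA, cA \in l -> B cA.2 /\ A `&` cA.2 = set0) ->
  p A ** psum l = 0.
Proof.
move=> BA lA; rewrite /psum cmul_sumr big_seq big1 // => cA /lA[BcA e].
by rewrite cmulZr (rep_setI psR) // e (rep_p0 BA) scaler0.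
Qed.

Lemma psum_coef l c A : (forall cA, cA \in l -> B cA.2) -> disjoint_list l ->
  (c, A) \in l -> p A ** psum l = c *: p A.
Proof.
elim: l => [//|[d D] l ih] lB [/= Dl dl]; rewrite psum_cons inE.
have BD : B D by exact: (lB _ (mem_head _ _)).
have lB' dD : dD \in l -> B dD.2 by move=> h; apply: lB; rewrite inE h orbT.
rewrite cmulDr cmulZr => /predU1P[[-> ->]|cAl].
  rewrite rep_pp // psum_pl ?addr0 // => dD h; split; [exact: lB' | exact: Dl].
rewrite ih // (rep_setI psR) //; last exact: lB' cAl.
by rewrite setIC (Dl _ cAl) (rep_p0 BD) scaler0 add0r.
Qed.

Lemma psum_star l : (forall cA, cA \in l -> B cA.2) ->
  cstar (psum l) = psum [seq ((cA.1^*)%R, cA.2) | cA <- l].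
Proof.
move=> lB; rewrite /psum cstar_sum big_map big_seq [RHS]big_seq.
by apply: eq_bigr => cA /lB BA; rewrite cstarZ rep_star.
Qed.

Lemma nr_psum_le l (M : R) : 0 <= M -> (forall cA, cA \in l -> B cA.2) ->
  disjoint_list l -> (forall cA, cA \in l -> cabs cA.1 <= M) -> nr (psum l) <= M.
Proof.
move=> M0; elim: l => [|[c A] l ih] lB; first by rewrite /psum big_nil nr0.
move=> [/= Al' dl] lM; have BA : B A by exact: (lB _ (mem_head _ _)).
have lB' dD : dD \in l -> B dD.2 by move=> h; apply: lB; rewrite inE h orbT.
rewrite psum_cons; apply: nr_orth_le.
- rewrite psum_star // cmulZl psum_pl ?scaler0 // => dD /mapP[eF h ->] /=.
  by split; [exact: lB' | exact: Al'].
- rewrite cstarZ rep_star // cmulZl psum_pl ?scaler0 // => dD h.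
  by split; [exact: lB' | exact: Al'].
- rewrite nrZ -[M]mulr1 ler_pM ?cabs_ge0 ?nr_ge0 ?nr_rep_p_le1 //.
  exact: (lM _ (mem_head _ _)).
- by apply: ih => // cA h; apply: lM; rewrite inE h orbT.
Qed.

(* Multiplying the sum by p_A, and then by s_a^* for a label a that does not occur
   in l', or by p_A' for a set A' of sinks, kills ssum l' and leaves c times an
   element of norm 1 or 0. *)
Lemma regular_or_small (faithful : forall A, B A -> A <> set0 -> p A <> 0)
    l l' c A : (forall cA, cA \in l -> B cA.2) -> disjoint_list l ->
  (c, A) \in l -> regular L B A \/ cabs c <= nr (psum l + ssum l').
Proof.
move=> lB dl cAl; have BA : B A := lB _ cAl.
have [small|/negP big] := boolP (cabs c <= nr (psum l + ssum l')).
  by right.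
left; set x := psum l + ssum l' in big.
have px : p A ** x = c *: p A + p A ** ssum l'.
  by rewrite cmulDr (psum_coef lB dl cAl).
have nocoef y : nr y <= 1 -> y ** p A ** ssum l' = 0 -> nr (y ** p A) = 1 -> False.
  move=> y1 y0 yA1; apply: big; rewrite -[cabs c]mulr1 -yA1 -nrZ -cmulZr.
  have -> : y ** (c *: p A) = y ** p A ** x.
    by rewrite -cmulA px cmulDr (cmulA y) y0 addr0.
  rewrite (le_trans (nrM _ _)) // -[leRHS]mul1r.
  by rewrite ler_wpM2r ?nr_ge0 // yA1.
split=> //.
  apply: (@sub_finite_set _ _ [set` [seq axb.1.1 | axb <- l']]); last exact: finite_seq.
  move=> a aA; apply: contrapT => /= /negP al'.
  have BrAa := BrA a BA.
  have r0 : p (rA A a) <> 0 by apply: faithful => //; apply/eqP/set0P; exact: out_rA.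
  apply: (nocoef (cstar (s a))); first by rewrite nr_star nr_rep_s_le1.
    rewrite rep_sp // /ssum cmul_sumr big_seq big1 // => -[[b y] d] h /=.
    have ab : a <> b.
      move=> ab; move/negP: al'; apply; apply/mapP.
      by exists (b, y, d).
    rewrite -cmulA !(cmulA (cstar (s a))) (rep_orthogonal psR ab).
    by rewrite !cmul0x cmulx0.
  have -> : cstar (s a) ** p A = cstar (s a ** p (rA A a)).
    by rewrite rep_sp // cstarM rep_star.
  rewrite nr_star; apply/eqP; rewrite -(@pexpr_eq1 _ _ 2) ?nr_ge0 //.
  rewrite -nr_star_mul cstarM rep_star // -cmulA (cmulA (cstar (s a))) rep_ss.
  rewrite !(rep_setI psR) //; last first.
    by apply: (accom_setI B_acc).
  rewrite setIA setIC setIA setIid setIidl ?nr_rep_p //.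
  exact: rA_sub_ra.
move=> A' BA' A'sinks; apply: contrapT => A0.
have BI : B (A `&` A') by exact: (accom_setI B_acc).
apply: (nocoef (p (A `&` A'))); first exact: nr_rep_p_le1.
  rewrite (rep_setI psR) // setIAC setIid /ssum cmul_sumr big1 // => -[[b y] d] _ /=.
  rewrite -cmulA !cmulA rep_ps // (_ : rA _ b = set0).
    by rewrite (rep_p0 BA) cmulx0 !cmul0x.
  apply/seteqP; split=> v // /rAP[e [_ [_ /A'sinks h] _]].
  exact: (h e).
by rewrite (rep_setI psR) // setIAC setIid nr_rep_p //; exact: faithful.
Qed.

End RepresentationAlgebra.

(** * Injectivity on the core *)

Section ClosureSubalgebra.
Variables (R : realType) (X : cstarAlgType R) (D : set X).
Hypotheses (D0 : D 0) (DD : forall x y, D x -> D y -> D (x + y))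
  (DZ : forall (c : R[i]) x, D x -> D (c *: x))
  (DM : forall x y, D x -> D y -> D (x ** y)) (Ds : forall x, D x -> D (cstar x)).

Lemma closure_subalgebra : cstar_subalgebra (closure D).
Proof.
split.
- exact: closed_closure.
- exact: subset_closure.
- move=> x y /closure_nrP xD /closure_nrP yD; apply/closure_nrP => e e0.
  have e2 : 0 < e / 2 by rewrite divr_gt0.
  have [x' Dx' hx] := xD _ e2; have [y' Dy' hy] := yD _ e2.
  exists (x' + y'); first exact: DD.
  by rewrite opprD addrACA (le_lt_trans (nrD _ _)) // [e]splitr ltrD.
- move=> c x /closure_nrP xD; apply/closure_nrP => e e0.
  have c1 : 0 < cabs c + 1 by rewrite ltr_wpDl ?cabs_ge0.
  have [|x' Dx'] := xD (e / (cabs c + 1)); first by rewrite divr_gt0.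
  rewrite ltr_pdivlMr // => hx; exists (c *: x'); first exact: DZ.
  rewrite -scalerBr nrZ; apply: le_lt_trans hx.
  by rewrite mulrC ler_wpM2l ?nr_ge0 // lerDl.
- move=> x y /closure_nrP xD /closure_nrP yD; apply/closure_nrP => e e0.
  have e2 : 0 < e / 2 by rewrite divr_gt0.
  have y1 : 0 < nr y + 1 by rewrite ltr_wpDl ?nr_ge0.
  have [|x' Dx'] := xD (e / 2 / (nr y + 1)); first by rewrite divr_gt0.
  rewrite ltr_pdivlMr // => hx.
  have x1 : 0 < nr x' + 1 by rewrite ltr_wpDl ?nr_ge0.
  have [|y' Dy'] := yD (e / 2 / (nr x' + 1)); first by rewrite divr_gt0.
  rewrite ltr_pdivlMr // => hy; exists (x' ** y'); first exact: DM.
  rewrite (le_lt_trans (nr_triangle (x' ** y) _ _)) // [e]splitr ltrD //.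
    rewrite -cmulBl; apply: le_lt_trans hx; rewrite (le_trans (nrM _ _)) //.
    by rewrite ler_wpM2l ?nr_ge0 // lerDl.
  rewrite -cmulBr; apply: le_lt_trans hy; rewrite (le_trans (nrM _ _)) //.
  by rewrite mulrC ler_wpM2l ?nr_ge0 // lerDl.
- move=> x /closure_nrP xD; apply/closure_nrP => e /xD[y Dy xy].
  by exists (cstar y); [exact: Ds | rewrite -cstarB nr_star].
Qed.

End ClosureSubalgebra.

Lemma cstar_subalgebraT (R : realType) (X : cstarAlgType R) :
  cstar_subalgebra [set: X].
Proof. by split=> //; exact: closedT. Qed.

Section Core.
Variables (Al : countType) (E : digraph) (L : edge E -> Al).
Variable B : set (set (vertex E)).
Hypotheses (L_surj : forall a, exists e, L e = a)
  (B_acc : accommodating L B) (B_norm : normal_collection B).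
Variables (R : realType) (C X : cstarAlgType R).
Variables (p : set (vertex E) -> C) (s : Al -> C).
Hypothesis psR : representation L B p s.
Variables (q : set (vertex E) -> X) (t : Al -> X).
Hypothesis qtR : representation L B q t.
Variable pi : C -> X.
Hypotheses (pih : star_hom pi) (pi_p : forall A, B A -> pi (p A) = q A)
  (pi_s : forall a, pi (s a) = t a).
Implicit Types (x y z : C) (A : set (vertex E)) (a b : Al).

Let TT := @cstar_subalgebraT R C.

Lemma piD x y : pi (x + y) = pi x + pi y. Proof. exact: (star_homD pih). Qed.
Lemma piZ (c : R[i]) x : pi (c *: x) = c *: pi x. Proof. exact: (star_homZ pih). Qed.
Lemma piM x y : pi (x ** y) = pi x ** pi y. Proof. exact: (star_homM pih). Qed.
Lemma pi_star x : pi (cstar x) = cstar (pi x). Proof. exact: (star_hom_star pih). Qed.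
Lemma piB x y : pi (x - y) = pi x - pi y. Proof. exact: (star_homB TT pih). Qed.
Lemma pi0 : pi 0 = 0. Proof. exact: (star_hom0 TT pih). Qed.
Lemma pi_le x : nr (pi x) <= nr x. Proof. exact: (star_hom_le TT pih). Qed.
Lemma pi_sum (I : eqType) (l : seq I) (P : pred I) (F : I -> C) :
  pi (\sum_(i <- l | P i) F i) = \sum_(i <- l | P i) pi (F i).
Proof. by rewrite (star_hom_sum TT pih). Qed.

Lemma pi_psum l : (forall cA, cA \in l -> B cA.2) -> pi (psum p l) = psum q l.
Proof.
move=> lB; rewrite /psum pi_sum big_seq [RHS]big_seq; apply: eq_bigr => cA /lB BA.
by rewrite piZ pi_p.
Qed.

Lemma pi_ssum l :
  pi (ssum s l) = ssum t [seq (axb.1.1, pi axb.1.2, axb.2) | axb <- l].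
Proof.
rewrite /ssum pi_sum big_map; apply: eq_bigr => axb _.
by rewrite !piM pi_star !pi_s.
Qed.

Lemma regular_ssum A (c : R[i]) : regular L B A -> exists l, c *: p A = ssum s l.
Proof.
move=> [BA fin sinkA].
exists [seq (a, c *: p (rA L A a), a) | a <- finmap.enum_fset (fset_set (out_labels L A))].
rewrite /ssum big_map (rep_sum psR BA fin sinkA) (fsbig_finite _ _ fin) scaler_sumr.
by apply: eq_bigr => a _; rewrite cmulZr cmulZl.
Qed.

Lemma ssum_cat l l' : ssum s (l ++ l') = ssum s l + ssum s l'.
Proof. by rewrite /ssum big_cat. Qed.

(** Closed, so that [star_hom_inj_isometric] applies to it. *)
Definition core n : set C := closure (level B p s n).

Lemma core_subalgebra n : cstar_subalgebra (core n).
Proof.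
apply: closure_subalgebra.
- exact: lev_zero.
- by move=> x y; exact: levD.
- by move=> c x; exact: levZ.
- by move=> x y; exact: (levelM L_surj B_acc psR).
- by move=> x; exact: (level_star psR).
Qed.

Lemma core_compress n x a b : core n.+1 x -> core n (cstar (s a) ** x ** s b).
Proof.
move=> /closure_nrP xc; apply/closure_nrP => e /xc[y yL xy].
exists (cstar (s a) ** y ** s b); first exact: (level_compress L_surj B_acc psR).
rewrite -cmulBl -cmulBr; apply: le_lt_trans xy.
rewrite (le_trans (nrM _ _)) // -[leRHS]mulr1 ler_pM ?nr_ge0 //; last first.
  exact: (nr_rep_s_le1 L_surj B_acc psR).
rewrite (le_trans (nrM _ _)) // nr_star -[leRHS]mul1r ler_wpM2r ?nr_ge0 //.
exact: (nr_rep_s_le1 L_surj B_acc psR).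
Qed.

Hypothesis faithful : forall A, B A -> A <> set0 -> q A <> 0.

(** The terms with small coefficients have a sum of norm at most [M], however many they are, because
    their sets are disjoint. The remaining terms are regular and become an [ssum]. *)
Lemma psum_split l (M : R) : 0 <= M ->
  (forall cA, cA \in l -> B cA.2) -> disjoint_list l ->
  (forall c A, (c, A) \in l -> regular L B A \/ cabs c <= M) ->
  exists l', nr (psum p l - ssum s l') <= M.
Proof.
move=> M0 lB dl h.
pose small (cA : R[i] * set (vertex E)) := cabs cA.1 <= M.
suff [l' l'E] : exists l', ssum s l' = psum p [seq cA <- l | ~~ small cA].
  exists l'; rewrite l'E /psum !big_filter (bigID small) /= addrK -big_filter.
  apply: (nr_psum_le B_norm psR) => //.
  - by move=> cA; rewrite mem_filter => /andP[_ /lB].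
  - elim: l dl {lB h l'E} => [//|dD l ih /= [dDl /ih dl]].
    by case: ifP => // _; split=> // eF; rewrite mem_filter => /andP[_ /dDl].
  - by move=> cA; rewrite mem_filter => /andP[].
have {}h c A : (c, A) \in [seq cA <- l | ~~ small cA] -> regular L B A.
  by rewrite mem_filter => /andP[/negP n /h[]].
elim: [seq cA <- l | ~~ small cA] h => [|[c A] k ih] h.
  by exists [::]; rewrite /ssum /psum !big_nil.
have [|l1 l1E] := ih; first by move=> d D dDk; apply: (h d); rewrite inE dDk orbT.
have [l2 l2E] := regular_ssum c (h c A (mem_head _ _)).
by exists (l2 ++ l1); rewrite ssum_cat l1E -l2E psum_cons.
Qed.

(* Approximate x in the core by u + w with u in the span of the p_A. By
   regular_or_small, and since pi x = 0, u is within a small distance of a sum of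
   regular terms, which the last relation of a representation rewrites in the
   form of w. So x is a limit of sums v of terms s_a y s_b^*, while
   s_a^* x s_b = 0 by induction, so that v^* x v^* = 0. *)
Lemma core_inj n x : core n x -> pi x = 0 -> x = 0.
Proof.
elim: n x => [|n ih] x xc x0.
  apply: nr_eq0_eps => e e0; have e2 : 0 < e / 2 by rewrite divr_gt0.
  have /closure_nrP/(_ _ e2)[y yL xy] := xc.
  have [l [l' [lB yE l'0]]] := level_decomp yL.
  have [l2 [l2B l2d l2E]] := psum_disjoint B_acc B_norm psR lB.
  have yE' : y = psum p l2 by rewrite yE l'0 // /ssum big_nil addr0 l2E.
  have piy : nr (pi y) <= e / 2.
    by rewrite -[pi y]subr0 -x0 -piB (le_trans (pi_le _)) // nr_distC ltW.
  have l2B' cA : cA \in l2 -> B cA.2 by move=> /l2B[].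
  have ye : nr y <= e / 2.
    rewrite yE'; apply: (nr_psum_le B_norm psR) => //; first exact: ltW.
    move=> [c A] cAl /=; have [BA A0] := l2B _ cAl.
    rewrite -[cabs c]mulr1 -(nr_rep_p qtR BA (faithful BA A0)) -nrZ.
    rewrite -(psum_coef B_norm qtR l2B' l2d cAl) -pi_psum // -yE'.
    rewrite (le_trans (nrM _ _)) // (nr_rep_p qtR BA) ?mul1r //.
    exact: faithful.
  rewrite -[x](subrK y) [e]splitr (le_trans (nrD _ _)) // lerD //.
  exact: ltW.
have comp a b : cstar (s a) ** x ** s b = 0.
  by apply: ih; [exact: core_compress | rewrite !piM x0 cmulx0 cmul0x].
have approx (e : R) : 0 < e -> exists l, nr (x - ssum s l) < e.
  move=> e0; have e2 : 0 < e / 2 by rewrite divr_gt0.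
  have /closure_nrP/(_ _ e2)[y yL xy] := xc.
  have [l [l' [lB yE _]]] := level_decomp yL.
  have [l2 [l2B l2d l2E]] := psum_disjoint B_acc B_norm psR lB.
  have l2B' cA : cA \in l2 -> B cA.2 by move=> /l2B[].
  have piy : nr (pi y) <= nr (x - y).
    by rewrite -[pi y]subr0 -x0 -piB (le_trans (pi_le _)) // nr_distC.
  have [|l3 hl3] := psum_split (nr_ge0 (x - y)) l2B' l2d.
    move=> c A cAl.
    (* Applied in [X], where the projections are known to be nonzero and the image of [y] has norm
       at most |x - y|; the coefficients are the same in both algebras. *)
    have [rA|h] := regular_or_small L_surj B_acc B_norm qtR faithful
      [seq (axb.1.1, pi axb.1.2, axb.2) | axb <- l'] l2B' l2d cAl.
      by left.
    right; apply: le_trans h _; rewrite -pi_psum // -pi_ssum -piD l2E -yE.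
    exact: piy.
  exists (l3 ++ l'); rewrite ssum_cat.
  rewrite (le_lt_trans (nr_triangle y _ _)) // [e]splitr ltr_leD //.
  rewrite yE l2E in hl3 *; rewrite opprD addrACA subrr addr0.
  by rewrite (le_trans hl3) // -?yE ltW.
have sxs l : cstar (ssum s l) ** x ** cstar (ssum s l) = 0.
  rewrite /ssum !cstar_sum cmul_suml cmul_suml big1 // => -[[a y] b] _ /=.
  rewrite cmul_sumr big1 // => -[[c z] d] _ /=; rewrite !cstarM !cstarK.
  have -> : s b ** (cstar y ** cstar (s a)) ** x ** (s d ** (cstar z ** cstar (s c)))
    = s b ** cstar y ** (cstar (s a) ** x ** s d) ** (cstar z ** cstar (s c)).
    by rewrite !cmulA.
  by rewrite comp cmulx0 cmul0x.
have xxx : cstar x ** x ** cstar x = 0.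
  (* [K] collects the two error terms below, with |v| <= |x| + 1; the final 1 makes it positive. *)
  apply: nr_eq0_eps => e e0; pose K := nr x * nr x + (nr x + 1) * nr x + 1.
  have K1 : 1 <= K by rewrite lerDr addr_ge0 // mulr_ge0 ?addr_ge0 ?nr_ge0.
  have K0 : 0 < K by exact: lt_le_trans K1.
  pose d := Num.min 1 (e / K).
  have d0 : 0 < d by rewrite lt_min ltr01 divr_gt0.
  have [l hl] := approx _ d0; set v := cstar (ssum s l).
  have vd : nr (cstar x - v) <= d by rewrite -cstarB nr_star ltW.
  have v1 : nr v <= nr x + 1.
    rewrite -[v](subrK (cstar x)) (le_trans (nrD _ _)) // nr_star addrC lerD //.
    by rewrite nr_distC (le_trans vd) // ge_min lexx.
  have -> : cstar x ** x ** cstar x =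
      (cstar x - v) ** (x ** cstar x) + v ** x ** (cstar x - v).
    by rewrite cmulBl cmulBr /v sxs subr0 !cmulA subrK.
  have h1 : nr ((cstar x - v) ** (x ** cstar x)) <= d * (nr x * nr x).
    rewrite (le_trans (nrM _ _)) // ler_pM ?nr_ge0 // (le_trans (nrM _ _)) //.
    by rewrite nr_star.
  have h2 : nr (v ** x ** (cstar x - v)) <= (nr x + 1) * nr x * d.
    rewrite (le_trans (nrM _ _)) // ler_pM ?nr_ge0 // (le_trans (nrM _ _)) //.
    by rewrite ler_wpM2r ?nr_ge0.
  have dK : d * K <= e by rewrite -ler_pdivlMr // ge_min lexx orbT.
  rewrite (le_trans (nrD _ _)) // (le_trans (lerD h1 h2)) // (le_trans _ dK) //.
  by rewrite [leLHS](_ : _ = d * K - d); [rewrite gerBl ltW | rewrite /K; ring].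
have : cstar (cstar x ** x) ** (cstar x ** x) = 0.
  by rewrite cstarM cstarK cmulA xxx cmul0x.
by move=> /star_mul_eq0/star_mul_eq0.
Qed.

End Core.

(** * The gauge action *)

Section Generated.
Variables (R : realType) (X : cstarAlgType R).

Lemma cstar_generated_subalgebra (S : set X) : cstar_subalgebra (cstar_generated S).
Proof.
split.
- apply: closed_bigI => D [DD _]; exact: subalg_closed_top DD.
- by move=> D [DD _]; exact: subalg0 DD.
- by move=> x y hx hy D DS; apply: (subalgD DS.1); [exact: hx | exact: hy].
- by move=> c x hx D DS; apply: (subalgZ DS.1); exact: hx.
- by move=> x y hx hy D DS; apply: (subalgM DS.1); [exact: hx | exact: hy].
- by move=> x hx D DS; apply: (subalg_star DS.1); exact: hx.
Qed.

Lemma cstar_generated_sub (S : set X) : S `<=` cstar_generated S.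
Proof. exact: sub_smallest. Qed.

Lemma cstar_generated_min (S D : set X) : cstar_subalgebra D -> S `<=` D ->
  cstar_generated S `<=` D.
Proof. by move=> DD SD; exact: smallest_sub. Qed.

End Generated.

Lemma half_double (R : realType) (V : lmodType R[i]) (v : V) :
  (2^-1 : R)%:C *: (v + v) = v.
Proof.
have -> : v + v = (2 : R)%:C *: v by rewrite rmorph_nat scaler_nat mulr2n.
by rewrite scalerA -rmorphM /= mulVf ?scale1r // pnatr_eq0.
Qed.

Lemma unit_root2 (R : realType) m : exists z : R[i], `|z| = 1 /\ z ^+ (2 ^ m) = -1.
Proof.
elim: m => [|m [z [z1 zm]]]; first by exists (-1); rewrite normrN normr1 expr1.
exists (sqrtC z); split; last by rewrite expnS exprM sqrtCK.
apply/eqP; rewrite -(@pexpr_eq1 _ _ 2) ?normr_ge0 // -normrX sqrtCK z1 //.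
Qed.

Section Graded.
Variables (Al : countType) (E : digraph) (L : edge E -> Al).
Variable B : set (set (vertex E)).
Hypotheses (L_surj : forall a, exists e, L e = a)
  (B_acc : accommodating L B) (B_norm : normal_collection B).
Variables (R : realType) (C X : cstarAlgType R).
Variables (p : set (vertex E) -> C) (s : Al -> C).
Hypotheses (psR : representation L B p s) (ps_gen : rep_algebra B p s = setT).
Variables (q : set (vertex E) -> X) (t : Al -> X).
Hypothesis qtR : representation L B q t.
Variable pi : C -> X.
Hypotheses (pih : star_hom pi) (pi_p : forall A, B A -> pi (p A) = q A)
  (pi_s : forall a, pi (s a) = t a).
Implicit Types (x y z : C) (A : set (vertex E)) (a b : Al).

Local Notation DX := (rep_algebra B q t).

Lemma generated_ind (P : set C) : cstar_subalgebra P -> (forall A, B A -> P (p A)) ->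
  (forall a, P (s a)) -> forall x, P x.
Proof.
move=> PP Pp Ps x; have : rep_algebra B p s x by rewrite ps_gen.
apply: (cstar_generated_min PP) => _ [[A BA <-]|[a _ <-]]; [exact: Pp | exact: Ps].
Qed.

Lemma DX_subalgebra : cstar_subalgebra DX.
Proof. exact: cstar_generated_subalgebra. Qed.

Lemma DX_q A : B A -> DX (q A).
Proof. by move=> BA; apply: cstar_generated_sub; left; exists A. Qed.

Lemma DX_t a : DX (t a).
Proof. by apply: cstar_generated_sub; right; exists a. Qed.

Lemma DX_pi x : DX (pi x).
Proof.
have DD := DX_subalgebra; apply: (@generated_ind [set x | DX (pi x)]) x => /=.
- split=> /=.
  + move=> x /closure_nrP xD; apply: (closed_nrP (subalg_closed_top DD)).
    move=> e /xD[y Dy xy]; exists (pi y) => //.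
    by rewrite -(piB pih); apply: le_lt_trans xy; exact: (pi_le pih).
  + by rewrite (pi0 pih); exact: subalg0 DD.
  + by move=> x y Dx Dy; rewrite (piD pih); exact: subalgD DD _ _ Dx Dy.
  + by move=> c x Dx; rewrite (piZ pih); exact: subalgZ DD _ _ Dx.
  + by move=> x y Dx Dy; rewrite (piM pih); exact: subalgM DD _ _ Dx Dy.
  + by move=> x Dx; rewrite (pi_star pih); exact: subalg_star DD _ Dx.
- by move=> A BA; rewrite pi_p //; exact: DX_q.
- by move=> a; rewrite pi_s; exact: DX_t.
Qed.

Lemma graded_dense x : closure (graded_any B p s) x.
Proof.
apply: generated_ind x.
- apply: closure_subalgebra.
  + by exists 0%N; apply: (@graded_homog _ _ _ _ _ _ _ 0) => //; exact: homog0.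
  + by move=> x y [n xn] [m ym]; exists (maxn n m); exact: gradedD.
  + by move=> c x [n xn]; exists n; exact: gradedZ.
  + by move=> x y [n xn] [m ym]; exists (n + m)%N; exact: (gradedM L_surj B_acc psR).
  + by move=> x [n xn]; exists n; exact: (graded_star psR).
- move=> A BA; apply: subset_closure; exists 0%N.
  apply: (@graded_homog _ _ _ _ _ _ _ 0) => //.
  by apply: homog_mon (mon_p _ _ BA) _; rewrite subr0.
- move=> a; apply: subset_closure; exists 1%N.
  apply: (@graded_homog _ _ _ _ _ _ _ 1) => //.
  rewrite -(rep_s_ra psR a).
  by apply: homog_mon (mon_s a (mon_p _ _ (B_ra L_surj B_acc a))) _; rewrite subr0.
Qed.

Lemma gauge_homog (z : R[i]) (beta : X -> X) k x : `|z| = 1 ->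
  star_hom_on DX beta -> (forall A, B A -> beta (q A) = q A) ->
  (forall a, beta (t a) = z *: t a) -> homog B p s k x ->
  beta (pi x) = z ^ k *: pi x.
Proof.
move=> z1 bh bq bt; have DD := DX_subalgebra.
have z0 : z != 0 by rewrite -normr_eq0 z1 oner_eq0.
have zC : (z^*)%R = z^-1 by rewrite -[z^-1]mul1r -(expr1n _ 2) -z1 normCK mulrAC mulfV ?mul1r.
elim=> [m n {}x xM ->|x1 x2 _ ih1 _ ih2|c {}x _ ih].
- have -> : z ^ (m%:Z - n%:Z) = z ^+ m * z^-1 ^+ n.
    by rewrite expfzDr // -exprnP -exprnN exprVn.
  elim: xM => [m' n'|A BA|a m' n' {}x _ ih|b m' n' {}x _ ih].
  + by rewrite (pi0 pih) (star_hom0 DD bh) scaler0.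
  + by rewrite pi_p // bq // !expr0 mulr1 scale1r.
  + rewrite (piM pih) pi_s (star_homM bh) ?bt ?ih; [|exact: DX_t|exact: DX_pi].
    by rewrite cmulZl cmulZr scalerA exprS mulrA.
  + rewrite (piM pih) (pi_star pih) pi_s (star_homM bh); [|exact: DX_pi|].
      rewrite (star_hom_star bh) ?bt ?ih; last exact: DX_t.
      by rewrite cstarZ cmulZl cmulZr scalerA zC [in RHS]exprSr mulrA.
    by apply: (subalg_star DD); exact: DX_t.
- rewrite (piD pih) (star_homD bh) ?ih1 ?ih2 ?scalerDr //; exact: DX_pi.
- rewrite (piZ pih) (star_homZ bh) ?ih; last exact: DX_pi.
  by rewrite !scalerA mulrC.
Qed.

Hypothesis faithful : forall A, B A -> A <> set0 -> q A <> 0.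

Lemma homog_isometric k x : homog B p s k x -> nr (pi x) = nr x.
Proof.
move=> xh; apply/eqP; rewrite -(eqrXn2 (ltn0Sn 1)) ?nr_ge0 //; apply/eqP.
rewrite -!nr_star_mul -(pi_star pih) -(piM pih).
have := homogM L_surj B_acc psR (homog_star psR xh) xh; rewrite addNr.
move=> /(homog_level psR)[n xn]; apply: (@star_hom_inj_isometric _ _ _ (core B p s n)).
- exact: (core_subalgebra L_surj B_acc psR).
- by split=> *; [exact: (piD pih)|exact: (piZ pih)|exact: (piM pih)|exact: (pi_star pih)].
- move=> y; exact: (core_inj L_surj B_acc B_norm psR qtR pih).
- exact: subset_closure.
Qed.


Hypothesis gauge : forall z : R[i], `|z| = 1 -> exists beta : X -> X,
  [/\ {homo beta : x / DX x >-> DX x}, star_hom_on DX beta,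
      forall A, B A -> beta (q A) = q A & forall a, beta (t a) = z *: t a].

Lemma cabs_exprz (z : R[i]) (k : int) : `|z| = 1 -> cabs (z ^ k) = 1.
Proof.
move=> z1; apply: complexI; rewrite -cabsE.
case: k => n; first by rewrite -exprnP normrX z1 expr1n.
by rewrite NegzE -exprnN normfV normrX z1 expr1n invr1.
Qed.

Lemma exprzN1 (c : int) : (-1 : R[i]) ^ c = if (2 %| c)%Z then 1 else -1.
Proof. by rewrite expN1r -signr_odd dvdzE /= dvdn2; case: odd. Qed.

(* Averaging the identity with z^(- k0) beta_z, where z^(2^m) = -1, kills the
   degrees k for which (k - k0) / 2^m is odd. *)
Lemma gauge_halve l (k0 : int) m : (forall kx, kx \in l -> homog B p s kx.1 kx.2) ->
  nr (pi (\sum_(kx <- l | ((2 ^ m.+1)%:Z %| kx.1 - k0)%Z) kx.2)) <=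
  nr (pi (\sum_(kx <- l | ((2 ^ m)%:Z %| kx.1 - k0)%Z) kx.2)).
Proof.
move=> lh; have [z [z1 zm]] := unit_root2 R m.
have z0 : z != 0 by rewrite -normr_eq0 z1 oner_eq0.
have [beta [_ bh bq bt]] := gauge z1.
set w := \sum_(kx <- l | ((2 ^ m)%:Z %| kx.1 - k0)%Z) kx.2.
have bw : beta (pi w) = \sum_(kx <- l | ((2 ^ m)%:Z %| kx.1 - k0)%Z) z ^ kx.1 *: pi kx.2.
  rewrite (pi_sum pih) (star_hom_sum DX_subalgebra bh); last by move=> *; exact: DX_pi.
  rewrite big_seq_cond [RHS]big_seq_cond; apply: eq_bigr => kx /andP[/lh h _].
  exact: (gauge_homog z1 bh bq bt h).
have -> : pi (\sum_(kx <- l | ((2 ^ m.+1)%:Z %| kx.1 - k0)%Z) kx.2) =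
    (2^-1)%:C *: (pi w + z ^ (- k0) *: beta (pi w)).
  rewrite bw !(pi_sum pih) scaler_sumr -big_split /= scaler_sumr.
  rewrite big_mkcond [RHS]big_mkcond /=; apply: eq_bigr => kx _.
  have -> : z ^ (- k0) *: (z ^ kx.1 *: pi kx.2) = z ^ (kx.1 - k0) *: pi kx.2.
    by rewrite scalerA -expfzDr // addrC.
  have e2 : (2 ^ m.+1)%:Z = (2 ^ m)%:Z * 2 by rewrite expnS mulnC PoszM.
  have m0 : (2 ^ m)%:Z != 0 by rewrite -lt0n expn_gt0.
  have [/dvdzP[c ->]|nd] := boolP ((2 ^ m)%:Z %| kx.1 - k0)%Z; last first.
    case: ifP => // /dvdzP[c h]; case/negP: nd; apply/dvdzP.
    by exists (c * 2); rewrite h e2 mulrAC mulrA.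
  have zc : z ^ (c * (2 ^ m)%:Z) = (-1) ^ c.
    by rewrite mulrC -exprz_exp -exprnP zm.
  rewrite zc e2 [(2 ^ m)%:Z * 2]mulrC dvdz_mul2r // exprzN1.
  case: ifP => _; last by rewrite scaleN1r subrr scaler0.
  by rewrite scale1r half_double.
rewrite nrZr ger0_norm ?invr_ge0 // mulrC ler_pdivrMr //.
rewrite (le_trans (nrD _ _)) // mulr_natr mulr2n lerD // nrZ.
rewrite cabs_exprz // mul1r; exact: (star_hom_le DX_subalgebra bh (DX_pi w)).
Qed.

Lemma gauge_component (l : seq (int * C)) n (k0 : int) :
  (forall kx, kx \in l -> (`|kx.1| <= n)%N /\ homog B p s kx.1 kx.2) -> (`|k0| <= n)%N ->
  nr (\sum_(kx <- l | kx.1 == k0) kx.2) <= nr (pi (\sum_(kx <- l) kx.2)).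
Proof.
move=> lP k0n.
have lh kx : kx \in l -> homog B p s kx.1 kx.2 by move=> /lP[].
rewrite -(@homog_isometric k0); last first.
  by apply: homog_sum => kx /lh h /eqP <-.
have le m : nr (pi (\sum_(kx <- l | ((2 ^ m)%:Z %| kx.1 - k0)%Z) kx.2)) <=
    nr (pi (\sum_(kx <- l) kx.2)).
  elim: m => [|m ih]; last by apply: le_trans ih; exact: gauge_halve.
  by rewrite (eq_bigl xpredT) // => kx; rewrite dvd1z.
(* Since |k - k0| <= 2 n < 2^(2 n + 1), divisibility by this modulus leaves only k = k0. *)
apply: le_trans (le n.*2.+1); rewrite le_eqVlt; apply/orP; left; apply/eqP.
congr (nr (pi _)); rewrite big_seq_cond [RHS]big_seq_cond; apply: eq_bigl => kx.
case: (boolP (kx \in l)) => //= /lP[kn _].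
apply/eqP/idP => [->|]; first by rewrite subrr dvdz0.
rewrite dvdzE /= => h; apply/eqP; rewrite -subr_eq0 -absz_eq0.
have small : (`|(kx.1 - k0)%R| < 2 ^ n.*2.+1)%N.
  apply: (@leq_ltn_trans n.*2); last by apply: ltn_trans (ltn_expl _ _).
  by move: (kx.1) kn => k kn; lia.
by have := small; rewrite ltnNge; apply: contraNT; rewrite -lt0n => /dvdn_leq; apply.
Qed.

Lemma graded_le n y : graded B p s n y -> nr y <= (n.*2.+1)%:R * nr (pi y).
Proof.
move=> [l lP ->]; set y' := \sum_(kx <- l) _.
have yE : y' = \sum_(i < n.*2.+1) \sum_(kx <- l | kx.1 == i%:Z - n%:Z) kx.2.
  under eq_bigr do rewrite big_mkcond.
  rewrite exchange_big /= /y' big_seq [RHS]big_seq; apply: eq_bigr => kx /lP[kn _].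
  have [i iE] : exists i : 'I_n.*2.+1, kx.1 = i%:Z - n%:Z.
    have h : (`|(kx.1 + n%:Z)%R| < n.*2.+1)%N by move: (kx.1) kn => k kn; lia.
    by exists (Ordinal h) => /=; move: (kx.1) kn => k kn; lia.
  rewrite (bigD1 i) //= iE eqxx big1 ?addr0 // => j ji.
  case: ifP => // /eqP e; case/eqP: ji; apply: val_inj => /=; lia.
rewrite {1}yE (le_trans (nr_sum _ _ _)) //.
have -> : n.*2.+1%:R * nr (pi y') = \sum_(i < n.*2.+1) nr (pi y').
  by rewrite sumr_const card_ord mulr_natl.
apply: ler_sum => i _; apply: gauge_component lP _.
by have := ltn_ord i; move: (val i) => k; lia.
Qed.

(* The linear bound of graded_le is applied to the powers of y^* y, whose
   degree only grows linearly while the norms grow geometrically. *)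
Lemma graded_isometric n y : graded B p s n y -> nr y <= nr (pi y).
Proof.
move=> yn; rewrite -(ler_pXn2r (ltn0Sn 1)) ?nnegrE ?nr_ge0 // -!nr_star_mul.
rewrite -(pi_star pih) -(piM pih); set h := cstar y ** y.
have hs : cstar h = h by rewrite cstarM cstarK.
have hn : graded B p s (n + n) h.
  exact: (gradedM L_surj B_acc psR (graded_star psR yn) yn).
have pisqn j : pi (sqn h j) = sqn (pi h) j.
  by elim: j => //= j ih; rewrite (piM pih) ih.
(* The 2^j-th power of [h] has degrees up to 2 n 2^j, and 2 (2 n 2^j) + 1 <= (4 n + 1) 2^j. *)
apply: (@powers_le _ _ _ ((n + n).*2.+1)%:R) => [||j]; try exact: nr_ge0.
have phs : cstar (pi h) = pi h by rewrite -(pi_star pih) hs.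
rewrite -!nr_sqn // -pisqn.
apply: le_trans (graded_le (graded_sqn L_surj B_acc psR j hn)) _.
rewrite ler_wpM2r ?nr_ge0 // -natrM ler_nat.
have : (0 < 2 ^ j)%N by rewrite expn_gt0.
by move: (2 ^ j)%N => k k0; nia.
Qed.

Theorem gauge_isometric x : nr (pi x) = nr x.
Proof.
apply/eqP; rewrite eq_le (pi_le pih) /=; apply/ler_addgt0Pl => e e0.
have e2 : 0 < e / 2 by rewrite divr_gt0.
have /closure_nrP/(_ _ e2)[y [n yn] xy] := @graded_dense x.
rewrite -[x in leLHS](subrK y) (le_trans (nrD _ _)) // [e]splitr -addrA.
rewrite lerD ?(ltW xy) // (le_trans (graded_isometric yn)) //.
rewrite -[y](subrK x) (piD pih) (le_trans (nrD _ _)) // lerD //.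
by rewrite (le_trans (pi_le pih _)) // nr_distC ltW.
Qed.

End Graded.

(** * Transport of the gauge maps along an isometric homomorphism *)

Lemma isometric_range_subalgebra (R : realType) (C X : cstarAlgType R) (f : C -> X) :
  star_hom f -> (forall x, nr (f x) = nr x) -> cstar_subalgebra (range f).
Proof.
move=> fh fi; have TT := @cstar_subalgebraT R C.
split.
- move=> y /closure_nrP yf.
  have /choice[u uP] n : exists x, nr (y - f x) < 2^-1 ^+ n.
    have [|_ [x _ <-] h] := yf (2^-1 ^+ n); first by rewrite exprn_gt0 ?invr_gt0.
    by exists x.
  (* The increments of this majorant are 2 * 2^-n, while by isometry successive preimages are at
     distance at most 2^-n + 2^-(n + 1). *)
  have [n|n|l ul] := @dominated_cvg _ _ u (fun n => - 4 * 2^-1 ^+ n) 0.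
  + by rewrite mulNr oppr_le0 mulr_ge0 // exprn_ge0 ?invr_ge0.
  + rewrite -fi (star_homB TT fh) // (le_trans (nr_triangle y _ _)) //.
    rewrite nr_distC (le_trans (lerD (ltW (uP n.+1)) (ltW (uP n)))) //.
    have : 0 <= 2^-1 ^+ n :> R by rewrite exprn_ge0 ?invr_ge0.
    by rewrite exprS; move: (2^-1 ^+ n) => r; lra.
  exists l => //; apply: (@cvg_nr_unique _ _ (fun n => f (u n))).
    apply: (@cvg_lipschitz _ _ _ f 1) ul => a b.
    by rewrite -(star_homB TT fh) // fi mul1r.
  apply/cvgn_nrP => e e0.
  have /cvgrPdist_lt/(_ e e0)[N _ hN] : (2^-1 : R) ^+ n @[n --> \oo] --> 0.
    by apply: cvg_expr; rewrite ger0_norm ?invr_ge0 // invf_lt1 // ltr1n.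
  exists N => n /hN; rewrite sub0r normrN ger0_norm ?exprn_ge0 ?invr_ge0 //.
  by apply: lt_trans; rewrite nr_distC.
- by exists 0 => //; exact: star_hom0 TT fh.
- by move=> _ _ [x _ <-] [y _ <-]; exists (x + y) => //; exact: (star_homD fh).
- by move=> c _ [x _ <-]; exists (c *: x) => //; exact: (star_homZ fh).
- by move=> _ _ [x _ <-] [y _ <-]; exists (x ** y) => //; exact: (star_homM fh).
- by move=> _ [x _ <-]; exists (cstar x) => //; exact: (star_hom_star fh).
Qed.

Lemma representation_gauge (Al : countType) (E : digraph) (L : edge E -> Al)
    (B : set (set (vertex E))) (R : realType) (C : cstarAlgType R)
    (p : set (vertex E) -> C) (s : Al -> C) (z : R[i]) : `|z| = 1 ->
  representation L B p s -> representation L B p (fun a => z *: s a).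
Proof.
move=> z1 psR.
have zz : z * (z^*)%R = 1 by rewrite -normCK z1 expr1n.
have zz' : (z^*)%R * z = 1 by rewrite mulrC.
split.
- exact: (rep_projection psR).
- move=> a; rewrite /is_partial_isometry cstarZ !(cmulZl, cmulZr) !scalerA.
  by rewrite (rep_partial_isometry psR) -mulrA zz mulr1.
- exact: (rep_set0 psR).
- exact: (rep_setI psR).
- exact: (rep_setU psR).
- by move=> A a BA; rewrite cmulZr (rep_commute psR) // cmulZl.
- move=> a; rewrite cstarZ cmulZl cmulZr scalerA zz' scale1r.
  exact: (rep_initial psR).
- by move=> a b ab; rewrite cstarZ cmulZl cmulZr (rep_orthogonal psR) // !scaler0.
- move=> A BA fin sinkA; rewrite {1}(rep_sum psR BA fin sinkA).
  apply: eq_fsbigr => a _.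
  by rewrite cstarZ !cmulZl cmulZr scalerA zz scale1r.
Qed.

Theorem corollary3p10 (R : realType) (Al : countType) (E : digraph)
    (L : edge E -> Al) (B : set (set (vertex E)))
    (L_surj : forall a, exists e, L e = a)
    (B_accommodating : accommodating L B)
    (B_normal : normal_collection B)
    (B_wlr : weakly_left_resolving L B)
    (C : cstarAlgType R) (p : set (vertex E) -> C) (s : Al -> C)
    (ps_universal : universal_representation L B p s)
    (X : cstarAlgType R) (q : set (vertex E) -> X) (t : Al -> X)
    (qt_rep : representation L B q t)
    (pi : C -> X) (pi_hom : star_hom pi)
    (pi_p : forall A, B A -> pi (p A) = q A)
    (pi_s : forall a, pi (s a) = t a) :
  injective pi <->
  (forall A, B A -> A <> set0 -> q A <> 0) /\
  (forall z : R[i], `|z| = 1 ->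
    exists beta : X -> X,
      [/\ {homo beta : x / rep_algebra B q t x >-> rep_algebra B q t x},
          star_hom_on (rep_algebra B q t) beta,
          forall A, B A -> beta (q A) = q A
        & forall a, beta (t a) = z *: t a]).
Proof.
have [psR ps_gen univ] := ps_universal; have TT := @cstar_subalgebraT R C.
split=> [inj|[faithful gauge]]; last first.
  move=> x y xy; apply/eqP; rewrite -subr_eq0 -nr_eq0.
  rewrite -(gauge_isometric L_surj B_accommodating B_normal psR ps_gen qt_rep
    pi_hom pi_p pi_s faithful gauge).
  by rewrite (piB pi_hom) xy subrr nr0.
have iso x : nr (pi x) = nr x.
  apply: (star_hom_inj_isometric TT pi_hom) => // y _ y0.
  by apply: inj; rewrite y0 (pi0 pi_hom).
split.
  move=> A BA A0 qA0.
  (* Injectivity turns q_A = 0 into p_A = 0, which universality would carry over to the boundary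
     path representation. *)
  have [f [fh fp _]] := univ _ _ _
    (bd_representation L_surj B_accommodating B_wlr R).
  apply: (bd_proj_neq0 L_surj B_accommodating B_normal B_wlr (R := R) BA A0).
  rewrite -fp // (_ : p A = 0) ?(pi0 fh) //.
  by apply: inj; rewrite pi_p // qA0 (pi0 pi_hom).
move=> z z1.
have [g [gh gp gs]] := univ _ _ _ (representation_gauge z1 psR).
(* The default 0 is taken only outside the range of [pi], and [Dpi] shows that the algebra generated
   by [q] and [t] lies inside that range. *)
pose inv x := xget 0 [set c | pi c = x].
have invK c : inv (pi c) = c.
  by apply: inj; rewrite /inv; case: xgetP => [y -> yc|/(_ c)/(_ erefl)].
have Dpi x : rep_algebra B q t x -> exists c, pi c = x.
  have : rep_algebra B q t `<=` range pi.
    apply: cstar_generated_min (isometric_range_subalgebra pi_hom iso) _.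
    move=> _ [[A BA <-]|[a _ <-]]; first by exists (p A); last exact: pi_p.
    by exists (s a); last exact: pi_s.
  by move=> h /h[c _ <-]; exists c.
exists (fun x => pi (g (inv x))); split.
- by move=> x _; exact: (DX_pi ps_gen pi_hom pi_p pi_s).
- split.
  + move=> _ _ /Dpi[c <-] /Dpi[d <-]; rewrite -(piD pi_hom) !invK.
    by rewrite (piD gh) (piD pi_hom).
  + by move=> k _ /Dpi[c <-]; rewrite -(piZ pi_hom) !invK (piZ gh) (piZ pi_hom).
  + move=> _ _ /Dpi[c <-] /Dpi[d <-]; rewrite -(piM pi_hom) !invK.
    by rewrite (piM gh) (piM pi_hom).
  + move=> _ /Dpi[c <-]; rewrite -(pi_star pi_hom) !invK.
    by rewrite (pi_star gh) (pi_star pi_hom).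
- by move=> A BA; rewrite -pi_p // invK gp.
- by move=> a; rewrite -pi_s invK gs (piZ pi_hom).
Qed.
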